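(* Let $\lambda\in\sum_{i\in I_0}\mathbb{Z}_{\ge 0}\varpi_i$ be a level-zero dominant integral weight, $\Lambda=\mathrm{cl}(\lambda)$, and $J=\{j\in I_0\mid \langle\Lambda,\alpha_j^\vee\rangle=0\}$. Then, identifying quantum LS paths with piecewise-linear maps as described in the context, $$\widetilde{\mathbb{B}}(\lambda)_{\mathrm{cl}}=\widehat{\mathbb{B}}(\lambda)_{\mathrm{cl}}=\mathbb{B}(\lambda)_{\mathrm{cl}}.$$
   Context: Affine data: $\mathfrak{g}$ is an untwisted affine Lie algebra over $\mathbb{C}$ with Cartan matrix $(a_{ij})_{i,j\in I}$ (nodes numbered as in Kac's book), $0\in I$ the distinguished node, $I_0=I\setminus\{0\}$. Its Cartan subalgebra is $\mathfrak{h}=\bigoplus_{j\in I}\mathbb{C}\alpha_j^\vee\oplus\mathbb{C}d$ with simple coroots $\alpha_j^\vee$ and degree operator $d$; $\alpha_j\in\mathfrak{h}^*$ are the simple roots, $\Lambda_j$ the fundamental weights, $\delta=\sum_j a_j\alpha_j$ the null root, $c=\sum_j a_j^\vee\alpha_j^\vee$ the canonical central element, $P=\bigoplus_{j\in I}\mathbb{Z}\Lambda_j\oplus\mathbb{Z}\delta$ the weight lattice. $W$ is the Weyl group generated by the simple reflections $r_j$ ($j\in I$), $r_\beta$ the reflection in a real root $\beta$, $\beta^\vee$ its dual root. $W_0=\langle r_j\mid j\in I_0\rangle$, $\Delta_0$ the finite root system with positive roots $\Delta_0^+$, negative roots $\Delta_0^-$ and highest root $\theta$; thus $\alpha_0=-\theta+\delta$,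 $\alpha_0^\vee=-\theta^\vee+c$. The level-zero fundamental weights are $\varpi_i=\Lambda_i-a_i^\vee\Lambda_0$ ($i\in I_0$). $\mathrm{cl}:\mathfrak{h}^*\to\mathfrak{h}^*/\mathbb{C}\delta$ is the projection, $P_{\mathrm{cl}}=\mathrm{cl}(P)$, paired with $\bigoplus_{j\in I}\mathbb{Z}\alpha_j^\vee$ via $\langle\mathrm{cl}(\mu),h\rangle=\langle\mu,h\rangle$; $W$ acts on $\mathfrak{h}^*/\mathbb{C}\delta$. Elements of the root lattice are identified with their images under cl, so $\alpha_0=-\theta$ in $P_{\mathrm{cl}}$. Parabolic quantum Bruhat graph: $W_J=\langle r_j\mid j\in J\rangle$, $\Delta_J=\Delta_0\cap\bigoplus_{j\in J}\mathbb{Z}\alpha_j$, $\Delta_J^{\pm}=\Delta_0^\pm\cap\Delta_J$, $W_0^J$ the set of minimal-length coset representatives of $W_0/W_J$, $\lfloor w\rfloor\in W_0^J$ the representative of $wW_J$, $\ell$ the length function, $\rho=\frac12\sum_{\alpha\in\Delta_0^+}\alpha$, $\rho_J=\frac12\sum_{\alpha\in\Delta_J^+}\alpha$. The parabolic quantum Bruhat graph has vertex set $W_0^J$ and an edge $\lfloor wr_\beta\rfloor\xleftarrow{\beta}w$ for $w\in W_0^J$, $\beta\in\Delta_0^+\setminus\Delta_J^+$ whenever either $\ell(\lfloor wr_\beta\rfloor)=\ell(w)+1$ (Bruhat edge) or $\ell(\lfloor wr_\beta\rfloor)=\ell(w)-2\langle\rho-\rho_J,\beta^\vee\rangle+1$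 (quantum edge). A directed path from $y$ to $x$ is a sequence $x=w_0\xleftarrow{\beta_1}w_1\xleftarrow{\beta_2}\cdots\xleftarrow{\beta_n}w_n=y$ of edges; $\ell(x\Leftarrow y)$ denotes the minimal length of such a path. For rational $0<\sigma<1$, a directed $\sigma$-path is a directed path with $\sigma\langle\Lambda,\beta_k^\vee\rangle\in\mathbb{Z}$ for all $k$. Quantum LS paths: $\widetilde{\mathbb{B}}(\lambda)_{\mathrm{cl}}$ (resp. $\widehat{\mathbb{B}}(\lambda)_{\mathrm{cl}}$) is the set of pairs $\eta=(x_1,\dots,x_s;\sigma_0,\dots,\sigma_s)$ with $x_k\in W_0^J$, $x_k\ne x_{k+1}$, and rationals $0=\sigma_0<\sigma_1<\dots<\sigma_s=1$ such that for each $1\le k\le s-1$ there is a directed $\sigma_k$-path (resp. a directed $\sigma_k$-path of length $\ell(x_k\Leftarrow x_{k+1})$) from $x_{k+1}$ to $x_k$. Such $\eta$ is identified with the map $\eta:[0,1]\to\mathbb{R}\otimes_{\mathbb{Z}}P_{\mathrm{cl}}$, $\eta(t)=\sum_{l=1}^{k-1}(\sigma_l-\sigma_{l-1})x_l\Lambda+(t-\sigma_{k-1})x_k\Lambda$ for $\sigma_{k-1}\le t\le\sigma_k$. LS paths: for $\mu\in P$ and $\mu',\nu\in W\mu$, write $\mu'\ge\nu$ if there are $\mu'=\mu_0,\mu_1,\dots,\mu_n=\nu$ in $W\mu$ and positive real roots $\beta_1,\dots,\beta_n$ with $\mu_k=r_{\beta_k}\mu_{k-1}$ and $\langle\mu_{k-1},\beta_k^\vee\rangle<0$;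 $\mathrm{dist}(\mu',\nu)$ is the maximal such $n$. For $\mu'>\nu$ and rational $0<\sigma<1$, a $\sigma$-chain for $(\mu',\nu)$ is a sequence $\mu'=\mu_0>\mu_1>\dots>\mu_n=\nu$ in $W\mu$ with $\mathrm{dist}(\mu_{k-1},\mu_k)=1$ and $\sigma\langle\mu_{k-1},\beta_k^\vee\rangle\in\mathbb{Z}_{<0}$, where $\beta_k$ is the positive real root with $r_{\beta_k}\mu_{k-1}=\mu_k$. An LS path of shape $\mu$ is a pair $(\nu_1>\nu_2>\dots>\nu_s;\,0=\sigma_0<\sigma_1<\dots<\sigma_s=1)$ with $\nu_k\in W\mu$, $\sigma_k$ rational, such that a $\sigma_k$-chain for $(\nu_k,\nu_{k+1})$ exists for $1\le k\le s-1$; it is identified with the map $\pi(t)=\sum_{l=1}^{k-1}(\sigma_l-\sigma_{l-1})\nu_l+(t-\sigma_{k-1})\nu_k$ ($\sigma_{k-1}\le t\le\sigma_k$) into $\mathbb{R}\otimes P$. $\mathbb{B}(\mu)$ is the set of LS paths of shape $\mu$, and $\mathbb{B}(\mu)_{\mathrm{cl}}=\{\mathrm{cl}\circ\pi\mid\pi\in\mathbb{B}(\mu)\}$. *)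

(* Defs.v *)
From HB Require Import structures.
From mathcomp Require Import all_boot all_order all_algebra.
From mathcomp Require Import boolp classical_sets fsbigop reals.
From Stdlib Require Import ClassicalEpsilon.
Set Implicit Arguments. Unset Strict Implicit. Unset Printing Implicit Defensive.
Import Order.TTheory GRing.Theory Num.Theory.
Local Open Scope ring_scope.

(* Generic root-lattice machinery for a (generalized) Cartan matrix M     *)
(* indexed by 'I_N, Kac convention  M i j = a_ij = <alpha_i^vee, alpha_j>. *)
(* Elements of the root lattice  (resp. coroot lattice) are coordinate     *)
(* vectors w.r.t. the simple roots alpha_j (resp. simple coroots).         *)

Definition ivec (N : nat) := {ffun 'I_N -> int}.
Definition GCM (N : nat) := 'I_N -> 'I_N -> int.
Definition evec (N : nat) (j : 'I_N) : ivec N := [ffun k => if k == j then 1 else 0].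

(* <m, alpha_j^vee> for m in the root lattice *)
Definition rt_pair N (M : GCM N) (m : ivec N) (j : 'I_N) : int :=
  \sum_(l < N) m l * M j l.
(* <alpha_j, c> for c in the coroot lattice *)
Definition cr_pair N (M : GCM N) (j : 'I_N) (c : ivec N) : int :=
  \sum_(l < N) c l * M l j.
(* <m, c> for m in the root lattice and c in the coroot lattice *)
Definition rc_pair N (M : GCM N) (m : ivec N) (c : ivec N) : int :=
  \sum_(l < N) c l * rt_pair M m l.

Definition sref N (M : GCM N) (j : 'I_N) (m : ivec N) : ivec N :=
  [ffun k => m k - (if k == j then rt_pair M m j else 0)].
Definition scref N (M : GCM N) (j : 'I_N) (c : ivec N) : ivec N :=
  [ffun k => c k - (if k == j then cr_pair M j c else 0)].

(* a word [:: i1; ...; ik] stands for r_{i1} ... r_{ik} *)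
Definition wact N (M : GCM N) (w : seq 'I_N) (m : ivec N) : ivec N :=
  foldr (sref M) m w.
Definition wcact N (M : GCM N) (w : seq 'I_N) (c : ivec N) : ivec N :=
  foldr (scref M) c w.

Definition is_real_root N (M : GCM N) (b : ivec N) : Prop :=
  exists (w : seq 'I_N) (j : 'I_N), wact M w (evec j) = b.
Definition is_pos N (b : ivec N) : Prop := forall k, 0 <= b k.
Definition is_pos_real_root N (M : GCM N) (b : ivec N) : Prop :=
  is_real_root M b /\ is_pos b.

(* dual root: if b = w alpha_j then b^vee = w alpha_j^vee (well defined, Kac 5.1) *)
Definition coroot N (M : GCM N) (b : ivec N) : ivec N :=
  epsilon (inhabits 0) (fun c => exists (w : seq 'I_N) (j : 'I_N),
     wact M w (evec j) = b /\ wcact M w (evec j) = c).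

Definition reflr N (M : GCM N) (b g : ivec N) : ivec N :=
  [ffun k => g k - rc_pair M g (coroot M b) * b k].

Definition is_GCM N (M : GCM N) : Prop :=
  (forall i, M i i = 2) /\ (forall i j, i != j -> M i j <= 0) /\
  (forall i j, M i j = 0 <-> M j i = 0).

Definition indecomposable N (M : GCM N) : Prop :=
  forall S : {set 'I_N}, (0 < #|S|)%N -> (#|S| < N)%N ->
    exists i j, [/\ i \in S, j \notin S & M i j != 0].

(* Kac, Cor. 4.3: an indecomposable GCM is of finite type iff
   there is u > 0 with A u > 0 *)
Definition finite_type N (M : GCM N) : Prop :=
  [/\ is_GCM M, indecomposable M &
      exists u : 'I_N -> rat, (forall i, 0 < u i) /\
        (forall i, 0 < \sum_(j < N) (M i j)%:~R * u j)].

(* Node 0 of I = 'I_n.+1 is ord0; node i of I_0 ('I_n) is lift ord0 i.    *)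

Definition highest_root n (A : GCM n) : ivec n :=
  epsilon (inhabits 0) (fun th => is_real_root A th /\
     forall g, is_real_root A g -> forall k, g k <= th k).
Definition theta_check n (A : GCM n) : ivec n := coroot A (highest_root A).

(* a_ij of the affine matrix; alpha_0 = delta - theta, alpha_0^vee = c - theta^vee *)
Definition aff n (A : GCM n) : GCM n.+1 := fun i j =>
  match unlift ord0 i, unlift ord0 j with
  | None, None => 2
  | None, Some j' => - cr_pair A j' (theta_check A)
  | Some i', None => - rt_pair A (highest_root A) i'
  | Some i', Some j' => A i' j'
  end.

(* a_i^vee for i in I_0 (c = alpha_0^vee + theta^vee, a_0^vee = 1) *)
Definition acheck n (A : GCM n) (i : 'I_n) : int := theta_check A i.

(* Weights.  mu in P is encoded by ((<mu, alpha_j^vee>)_{j in I}, <mu,d>), *)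
(* i.e. by its coordinates w.r.t. Lambda_j and delta.  P_cl is encoded by  *)
(* the first component (cl forgets the delta-coordinate).                 *)

Definition wt n := (ivec n.+1 * int)%type.

Definition rt2wt n (A : GCM n) (b : ivec n.+1) : wt n :=
  ([ffun k => rt_pair (aff A) b k], b ord0).

(* <mu, c> for c in the affine coroot lattice *)
Definition wt_pair n (mu : wt n) (c : ivec n.+1) : int :=
  \sum_(k < n.+1) c k * mu.1 k.

Definition rref n (A : GCM n) (b : ivec n.+1) (mu : wt n) : wt n :=
  let a := wt_pair mu (coroot (aff A) b) in
  ([ffun k => mu.1 k - a * (rt2wt A b).1 k], mu.2 - a * (rt2wt A b).2).

Definition wsref n (A : GCM n) (j : 'I_n.+1) (mu : wt n) : wt n :=
  ([ffun k => mu.1 k - mu.1 j * aff A k j],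
   mu.2 - mu.1 j * (if j == ord0 then 1 else 0)).

Definition wtact n (A : GCM n) (w : seq 'I_n.+1) (mu : wt n) : wt n :=
  foldr (wsref A) mu w.

Definition in_orbit n (A : GCM n) (lam mu : wt n) : Prop :=
  exists w, wtact A w lam = mu.

(* level-zero fundamental weight varpi_i = Lambda_i - a_i^vee Lambda_0 *)
Definition varpi n (A : GCM n) (i : 'I_n) : wt n :=
  ([ffun k => if k == lift ord0 i then 1
              else if k == ord0 then - acheck A i else 0], 0).

Definition lam n (A : GCM n) (m : 'I_n -> nat) : wt n :=
  ([ffun k => \sum_(i < n) (m i)%:Z * (varpi A i).1 k], 0).

Definition Lam n (A : GCM n) (m : 'I_n -> nat) : ivec n.+1 := (lam A m).1.

Definition Jof n (A : GCM n) (m : 'I_n -> nat) : {set 'I_n} :=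
  [set j : 'I_n | Lam A m (lift ord0 j) == 0].

Definition clact n (A : GCM n) (x : seq 'I_n) (L : ivec n.+1) : ivec n.+1 :=
  (wtact A (map (lift ord0) x) (L, 0)).1.

(* <Lambda, beta^vee> for beta^vee in the finite coroot lattice *)
Definition clpair n (L : ivec n.+1) (c : ivec n) : int :=
  \sum_(i < n) c i * L (lift ord0 i).

(* Elements of W_0 are words, compared through the (faithful) action on  *)
(* the finite root lattice.                                               *)

Definition weqb n (A : GCM n) (u v : seq 'I_n) : bool :=
  [forall i, wact A u (evec i) == wact A v (evec i)].

Lemma wlen_ex n (A : GCM n) (w : seq 'I_n) :
  exists k, [exists v : k.-tuple 'I_n, weqb A v w].
Proof.
exists (size w); apply/existsP; exists (in_tuple w).
by apply/forallP => i /=.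
Qed.

Definition wlen n (A : GCM n) (w : seq 'I_n) : nat := ex_minn (wlen_ex A w).

Definition Jword n (J : {set 'I_n}) (v : seq 'I_n) : bool := all (fun i => i \in J) v.

Definition minrep n (A : GCM n) (J : {set 'I_n}) (x : seq 'I_n) : Prop :=
  forall v, Jword J v -> (wlen A x <= wlen A (x ++ v))%N.

Definition in_DJ n (J : {set 'I_n}) (b : ivec n) : Prop :=
  forall k, k \notin J -> b k = 0.
Definition posroot_notJ n (A : GCM n) (J : {set 'I_n}) (b : ivec n) : Prop :=
  is_pos_real_root A b /\ ~ in_DJ J b.

(* 2 <rho - rho_J, beta^vee> = sum over alpha in Delta_0^+ \ Delta_J^+ of <alpha, beta^vee> *)
Definition two_rho_J n (A : GCM n) (J : {set 'I_n}) (b : ivec n) : int :=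
  \sum_(a \in [set a : ivec n | posroot_notJ A J a]) rc_pair A a (coroot A b).

Definition floor_is n (A : GCM n) (J : {set 'I_n}) (w : seq 'I_n) (b : ivec n)
    (u : seq 'I_n) : Prop :=
  minrep A J u /\ exists v, Jword J v /\
    forall i, wact A (u ++ v) (evec i) = wact A w (reflr A b (evec i)).

(* edge  u <-b- w  of the parabolic quantum Bruhat graph *)
Definition qedge n (A : GCM n) (J : {set 'I_n}) (w u : seq 'I_n) (b : ivec n) : Prop :=
  [/\ minrep A J w, posroot_notJ A J b, floor_is A J w b u &
      (wlen A u = (wlen A w).+1 \/
       (wlen A u)%:Z = (wlen A w)%:Z - two_rho_J A J b + 1)].

Definition dpath n (A : GCM n) (J : {set 'I_n}) (x y : seq 'I_n)
    (ws : seq (seq 'I_n)) (bs : seq (ivec n)) : Prop :=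
  [/\ size ws = (size bs).+1, nth [::] ws 0 = x, nth [::] ws (size bs) = y &
      forall i, (i < size bs)%N ->
        qedge A J (nth [::] ws i.+1) (nth [::] ws i) (nth 0 bs i)].

Definition rat_is_int (q : rat) : Prop := exists z : int, q = z%:~R.

Definition sigma_cond n (A : GCM n) (L : ivec n.+1) (s : rat) (bs : seq (ivec n)) : Prop :=
  forall i, (i < size bs)%N -> rat_is_int (s * (clpair L (coroot A (nth 0 bs i)))%:~R).

(* directed s-path from y to x *)
Definition spath n (A : GCM n) (J : {set 'I_n}) (L : ivec n.+1) (s : rat)
    (x y : seq 'I_n) : Prop :=
  exists ws bs, dpath A J x y ws bs /\ sigma_cond A L s bs.

Definition spath_min n (A : GCM n) (J : {set 'I_n}) (L : ivec n.+1) (s : rat)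
    (x y : seq 'I_n) : Prop :=
  exists ws bs, [/\ dpath A J x y ws bs, sigma_cond A L s bs &
    forall ws' bs', dpath A J x y ws' bs' -> (size bs <= size bs')%N].

Definition sigma_ok (sg : seq rat) (s : nat) : Prop :=
  [/\ size sg = s.+1, nth 0 sg 0 = 0, nth 0 sg s = 1 & sorted (fun a b => a < b) sg].

(* t |-> sum_l (s_l - s_{l-1}) v_l + (t - s_{k-1}) v_k  on [s_{k-1}, s_k]
   (extended to R by clamping t into [0,1]) *)
Definition plmap (R : realType) N (vs : seq (ivec N)) (sg : seq rat) : R -> 'I_N -> R :=
  fun t k => \sum_(l < size vs)
    (Num.min (Num.max t (ratr (nth 0 sg l))) (ratr (nth 0 sg l.+1)) - ratr (nth 0 sg l))
    * ((nth 0 vs l) k)%:~R.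

Definition QLS_gen n (A : GCM n) (m : 'I_n -> nat) (R : realType)
    (P : {set 'I_n} -> ivec n.+1 -> rat -> seq 'I_n -> seq 'I_n -> Prop)
    : set (R -> 'I_n.+1 -> R) :=
  [set eta | exists (xs : seq (seq 'I_n)) (sg : seq rat),
     let s := size xs in let J := Jof A m in let L := Lam A m in
     [/\ (1 <= s)%N, sigma_ok sg s,
         (forall k, (k < s)%N -> minrep A J (nth [::] xs k)),
         (forall k, (k.+1 < s)%N ->
             ~~ weqb A (nth [::] xs k) (nth [::] xs k.+1) /\
             P J L (nth 0 sg k.+1) (nth [::] xs k) (nth [::] xs k.+1)) &
         eta = @plmap R _ [seq clact A x L | x <- xs] sg]].

Arguments QLS_gen : clear implicits.
Arguments QLS_gen {n} A m R P.

Definition QLS_tilde n (A : GCM n) (m : 'I_n -> nat) (R : realType) :=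
  QLS_gen A m R (fun J L s x y => spath A J L s x y).
Definition QLS_hat n (A : GCM n) (m : 'I_n -> nat) (R : realType) :=
  QLS_gen A m R (fun J L s x y => spath_min A J L s x y).

Definition chain_len n (A : GCM n) (lm mu nu : wt n) (k : nat) : Prop :=
  exists (mus : seq (wt n)) (bs : seq (ivec n.+1)),
  [/\ size mus = k.+1 /\ size bs = k, nth (0, 0) mus 0 = mu, nth (0, 0) mus k = nu,
      (forall i, (i <= k)%N -> in_orbit A lm (nth (0, 0) mus i)) &
      forall i, (i < k)%N -> [/\ is_pos_real_root (aff A) (nth 0 bs i),
          nth (0, 0) mus i.+1 = rref A (nth 0 bs i) (nth (0, 0) mus i) &
          wt_pair (nth (0, 0) mus i) (coroot (aff A) (nth 0 bs i)) < 0]].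

Definition wge n (A : GCM n) (lm mu nu : wt n) : Prop := exists k, chain_len A lm mu nu k.
Definition wgt n (A : GCM n) (lm mu nu : wt n) : Prop := wge A lm mu nu /\ mu <> nu.
Definition dist1 n (A : GCM n) (lm mu nu : wt n) : Prop :=
  chain_len A lm mu nu 1 /\ forall k, chain_len A lm mu nu k -> (k <= 1)%N.

Definition schain n (A : GCM n) (lm : wt n) (s : rat) (mu nu : wt n) : Prop :=
  exists (k : nat) (mus : seq (wt n)),
  [/\ size mus = k.+1, nth (0, 0) mus 0 = mu, nth (0, 0) mus k = nu &
      forall i, (i < k)%N ->
        [/\ wgt A lm (nth (0, 0) mus i) (nth (0, 0) mus i.+1),
            dist1 A lm (nth (0, 0) mus i) (nth (0, 0) mus i.+1) &
            exists b, [/\ is_pos_real_root (aff A) b,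
               rref A b (nth (0, 0) mus i) = nth (0, 0) mus i.+1 &
               exists z : int, z < 0 /\
                 s * (wt_pair (nth (0, 0) mus i) (coroot (aff A) b))%:~R = z%:~R]]].

Definition LS_cl n (A : GCM n) (m : 'I_n -> nat) (R : realType) : set (R -> 'I_n.+1 -> R) :=
  [set eta | exists (nus : seq (wt n)) (sg : seq rat),
     let s := size nus in let lm := lam A m in
     [/\ (1 <= s)%N, sigma_ok sg s,
         (forall k, (k < s)%N -> in_orbit A lm (nth (0, 0) nus k)),
         (forall k, (k.+1 < s)%N ->
            wgt A lm (nth (0, 0) nus k) (nth (0, 0) nus k.+1) /\
            schain A lm (nth 0 sg k.+1) (nth (0, 0) nus k) (nth (0, 0) nus k.+1)) &
         eta = @plmap R _ [seq nu.1 | nu <- nus] sg]].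

Arguments QLS_tilde : clear implicits.
Arguments QLS_tilde {n} A m R.
Arguments QLS_hat : clear implicits.
Arguments QLS_hat {n} A m R.
Arguments LS_cl : clear implicits.
Arguments LS_cl {n} A m R.

(* Main.v *)
Require Import Defs.
From HB Require Import structures.
From mathcomp Require Import all_boot all_order all_algebra.
From mathcomp Require Import boolp classical_sets fsbigop reals.
From mathcomp Require Import ring lra zify.
From Stdlib Require Import ClassicalEpsilon.
Set Implicit Arguments. Unset Strict Implicit. Unset Printing Implicit Defensive.
Import Order.TTheory GRing.Theory Num.Theory.
Local Open Scope ring_scope.

(** For a level-zero weight y + a delta and an affine root g + k delta with
    <y, g> > 0, let D = N(r_g y) - N(y) + k <T(y), g^vee>, where N counts the
    positive finite roots that are negative on y and T is the sum of the finite
    roots that are positive on y; this is the increase of semi-infinite length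
    along the reflection.  An affine simple reflection r_j changes D exactly by
    the difference of the signs of the two endpoints on alpha_j.  Descending on
    the height of the affine root, this gives D >= 1 for positive affine roots,
    and, since covers in W lambda obey the same recursion (Deodhar's lemma), it
    shows that a reflection is a cover if and only if D = 1.  As D = 1 is also
    the length condition defining the edges of the parabolic quantum Bruhat
    graph (k = 0 for Bruhat and k = 1 for quantum edges), sigma-chains in W
    lambda are exactly the lifts of directed sigma-paths; an LS path whose
    consecutive directions agree modulo delta is merged before projecting.
    Finally, a directed sigma-path can be replaced by one of minimal length: as
    long as its endpoints x and y differ, affine simple reflections acting on
    both ends lead to a j on which the sign of x is smaller than that of y, and
    there an edge with label alpha_j can be cut off. *)

(** * Reflections, affine roots and step lengths *)

(** The orbit of a level-zero weight has in general no extremal element from which an induction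
    could start, so the inductions run on a positive affine root b. Some simple root alpha_j has (b,
    alpha_j) > 0, and unless b is alpha_j itself, r_j b is positive of smaller height. On that
    alpha_j the weight r_b y is smaller than y, so the sign correction has a known direction; this
    lets bounds pass from r_j b to b. D ignores the delta-coordinate of the weight and is affine in
    k with slope <T(y), g^vee> >= 2. Hence D = 1 is possible only at the smallest k for which g + k
    delta is positive, which is 0 or 1. Cosets are avoided by replacing w W_J with the vector w
    Lambda: N(w Lambda) is the length of the minimal representative, and T(w Lambda) = w (2 rho - 2
    rho_J). For the shortening, arbitrary directed paths are the case sigma = 0. One induction then
    cuts an arbitrary path and a sigma-path at the same end with the same label; the first bounds
    the length and the second supplies the integrality. *)

Lemma Qint_ge1 (q : rat) : q \is a Num.int -> 0 < q -> 1 <= q.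
Proof. by case/intrP=> z ->; rewrite ltr0z -[1]/(1%:~R) ler_int gtz0_ge1. Qed.

Lemma sgr_lt_ge1 (x y : rat) : Num.sg x < Num.sg y -> Num.sg x + 1 <= Num.sg y.
Proof. by case: (sgrP x) => _; case: (sgrP y) => _; lra. Qed.

Lemma le_sgr (x y : rat) : x <= y -> Num.sg x <= Num.sg y.
Proof. by move=> h; case: (sgrP x) => hx; case: (sgrP y) => hy; lra. Qed.

Lemma perm_map_involutive (T : eqType) (f : T -> T) (s : seq T) :
  uniq s -> involutive f -> (forall x, x \in s -> f x \in s) ->
  perm_eq (map f s) s.
Proof.
move=> us fK fs; apply: uniq_perm; rewrite ?(map_inj_uniq (inv_inj fK)) // => x.
apply/mapP/idP => [[y ys ->]|xs]; first exact: fs.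
by exists (f x); rewrite ?fs ?fK.
Qed.

Record symmetric_bilinear (V : lmodType rat) (B : V -> V -> rat) : Prop :=
  SymmetricBilinear {
    sb_Dl : forall u v w, B (u + v) w = B u w + B v w;
    sb_Zl : forall c u w, B (c *: u) w = c * B u w;
    sb_C : forall u v, B u v = B v u }.

Section Reflection.

Variables (V : lmodType rat) (B : V -> V -> rat).
Hypothesis Bsym : symmetric_bilinear B.
Let ipDl := sb_Dl Bsym.
Let ipZl := sb_Zl Bsym.
Let ipC := sb_C Bsym.

Definition copair (v g : V) : rat := 2 * B v g / B g g.
Definition hrefl (g v : V) : V := v - copair v g *: g.

Lemma ipDr u v w : B u (v + w) = B u v + B u w.
Proof. by rewrite ipC ipDl !(ipC u). Qed.
Lemma ipZr c u v : B u (c *: v) = c * B u v.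
Proof. by rewrite ipC ipZl ipC. Qed.
Lemma ip0l u : B 0 u = 0.
Proof. by rewrite -(scale0r 0) ipZl mul0r. Qed.
Lemma ipNl u v : B (- u) v = - B u v.
Proof. by rewrite -scaleN1r ipZl mulN1r. Qed.
Lemma ipNr u v : B u (- v) = - B u v.
Proof. by rewrite ipC ipNl ipC. Qed.
Lemma ipBl u v w : B (u - v) w = B u w - B v w.
Proof. by rewrite ipDl ipNl. Qed.
Lemma ipBr u v w : B w (u - v) = B w u - B w v.
Proof. by rewrite ipDr ipNr. Qed.
Lemma ip_suml (I : Type) (r : seq I) (P : pred I) (F : I -> V) u :
  B (\sum_(i <- r | P i) F i) u = \sum_(i <- r | P i) B (F i) u.
Proof.
elim/big_rec2: _ => [|i x y _ <-]; first exact: ip0l.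
by rewrite ipDl.
Qed.

Lemma copairB u v g : copair (u - v) g = copair u g - copair v g.
Proof. by rewrite /copair ipBl mulrBr mulrBl. Qed.
Lemma copairZ c v g : copair (c *: v) g = c * copair v g.
Proof. by rewrite /copair ipZl; ring. Qed.
Lemma copair_suml (I : Type) (r : seq I) (P : pred I) (F : I -> V) u :
  copair (\sum_(i <- r | P i) F i) u = \sum_(i <- r | P i) copair (F i) u.
Proof. by rewrite /copair ip_suml mulr_sumr mulr_suml. Qed.
Lemma copair_refl g : 0 < B g g -> copair g g = 2.
Proof. by move=> h; rewrite /copair mulfK // gt_eqF. Qed.
Lemma copairNr v g : copair v (- g) = - copair v g.
Proof. by rewrite /copair ipNl !ipNr opprK mulrN mulNr. Qed.
Lemma copairNl v g : copair (- v) g = - copair v g.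
Proof. by rewrite /copair ipNl mulrN mulNr. Qed.
Lemma sgr_copair v g : 0 < B g g -> Num.sg (copair v g) = Num.sg (B v g).
Proof.
by move=> h; rewrite /copair !sgrM sgrV (gtr0_sg h) mulr1 gtr0_sg ?mul1r ?ltr0n.
Qed.
Lemma copair_gt0 v g : 0 < B g g -> (0 < copair v g) = (0 < B v g).
Proof. by move=> h; rewrite -!(sgr_gt0 (_ v _)) sgr_copair. Qed.
Lemma copair_lt0 v g : 0 < B g g -> (copair v g < 0) = (B v g < 0).
Proof. by move=> h; rewrite -!(sgr_lt0 (_ v _)) sgr_copair. Qed.

Lemma hreflN g v : hrefl (- g) v = hrefl g v.
Proof. by rewrite /hrefl copairNr scaleNr scalerN opprK. Qed.
Lemma hrefl_opp g v : hrefl g (- v) = - hrefl g v.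
Proof. by rewrite /hrefl copairNl scaleNr opprD. Qed.
Lemma hreflB g u v : hrefl g (u - v) = hrefl g u - hrefl g v.
Proof. by rewrite /hrefl copairB scalerBl !opprD addrACA. Qed.
Lemma hreflZ g c v : hrefl g (c *: v) = c *: hrefl g v.
Proof. by rewrite /hrefl copairZ scalerBr scalerA. Qed.
Lemma hrefl_self g : 0 < B g g -> hrefl g g = - g.
Proof. by move=> h; rewrite /hrefl copair_refl // scaler_nat mulr2n opprD addNKr. Qed.

Lemma ip_hrefl a u v : 0 < B a a -> B (hrefl a u) (hrefl a v) = B u v.
Proof.
move=> h; rewrite /hrefl !(ipBl, ipBr, ipZl, ipZr) /copair.
by rewrite (ipC a v); field; rewrite gt_eqF.
Qed.
Lemma hreflK a : 0 < B a a -> involutive (hrefl a).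
Proof.
move=> h v; rewrite {1}/hrefl {2}/hrefl copairB copairZ copair_refl //.
rewrite /hrefl -addrA -opprD -scalerDl [X in X *: _](_ : _ = 0) ?scale0r ?subr0 //.
by ring.
Qed.
Lemma ip_hrefl_swap a u v : 0 < B a a -> B (hrefl a u) v = B u (hrefl a v).
Proof. by move=> h; rewrite -(ip_hrefl _ _ h) hreflK. Qed.
Lemma copair_hrefl a u v :
  0 < B a a -> copair (hrefl a u) (hrefl a v) = copair u v.
Proof. by move=> h; rewrite /copair !ip_hrefl. Qed.
Lemma hrefl_conj a g v : 0 < B a a ->
  hrefl (hrefl a g) (hrefl a v) = hrefl a (hrefl g v).
Proof. by move=> h; rewrite {1}/hrefl copair_hrefl // hreflB hreflZ. Qed.
Lemma ip_hrefl_self g v : 0 < B g g -> B (hrefl g v) g = - B v g.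
Proof. by move=> h; rewrite ip_hrefl_swap // hrefl_self // ipNr. Qed.

(* A pair (g, k) encodes the affine root g + k delta, a pair (v, a) the
   level-zero weight v + a delta. *)
Definition acopair (u b : V * rat) : rat := copair u.1 b.1.
Definition arefl (b u : V * rat) : V * rat :=
  (hrefl b.1 u.1, u.2 - acopair u b * b.2).

Lemma areflK a : 0 < B a.1 a.1 -> involutive (arefl a).
Proof.
move=> h [v x]; rewrite /arefl /acopair /= hreflK //; congr pair.
by rewrite /hrefl copairB copairZ copair_refl //; ring.
Qed.
Lemma arefl_conj a b u : 0 < B a.1 a.1 ->
  arefl (arefl a b) (arefl a u) = arefl a (arefl b u).
Proof.
move=> h; rewrite /arefl /acopair /= hrefl_conj // copair_hrefl //; congr pair.
by rewrite /hrefl copairB copairZ; ring.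
Qed.
Section AffineRoots.

Variables (Phi : seq V) (pos : pred V).

Definition ninv (y : V) : rat := (count (fun a => pos a && (B y a < 0)) Phi)%:R.
Definition possum (y : V) : V := \sum_(a <- Phi | 0 < B y a) a.

(* For y = w Lambda and g = w beta, the length increase of the edge
   w r_beta <- w corrected by k times the quantum drop of beta. *)
Definition step_len (y : V) (b : V * rat) : rat :=
  ninv (hrefl b.1 y) - ninv y + b.2 * copair (possum y) b.1.

Definition apos (b : V * rat) : bool :=
  [&& b.1 \in Phi, b.2 \is a Num.int & (0 < b.2) || ((b.2 == 0) && pos b.1)].

(** The combinatorics below rests on these properties alone. [as_ninv] amounts to saying that
    [step_len y (sr j)] is the sign of y on the j-th simple root, for every y; [as_ascent] and the
    properties of [ht] drive the descent on affine roots. *)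
Record affine_system (I : Type) (sr : I -> V * rat) (ht : V * rat -> rat) : Prop :=
  AffineSystem {
    as_uniq : uniq Phi;
    as_norm : forall g, g \in Phi -> 0 < B g g;
    as_hrefl : forall a g, a \in Phi -> g \in Phi -> hrefl a g \in Phi;
    as_int : forall a g, a \in Phi -> g \in Phi -> copair a g \is a Num.int;
    as_pos : forall g, g \in Phi -> pos g || pos (- g);
    as_sr : forall j, apos (sr j);
    as_arefl : forall j b, apos b -> b != sr j -> apos (arefl (sr j) b);
    as_ascent : forall b, apos b -> exists j, 0 < B b.1 (sr j).1;
    as_ninv : forall j y,
      ninv (hrefl (sr j).1 y) =
      ninv y + Num.sg (B y (sr j).1) - (sr j).2 * copair (possum y) (sr j).1;
    as_ht_arefl : forall b u, ht (arefl b u) = ht u - acopair u b * ht b;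
    as_ht_gt0 : forall b, apos b -> 0 < ht b;
    as_ht_int : forall b, apos b -> ht b \is a Num.int }.

Variables (I : Type) (sr : I -> V * rat) (ht : V * rat -> rat).
Hypothesis AS : affine_system sr ht.
Let Phi_uniq := as_uniq AS.
Let Phi_norm := as_norm AS.
Let Phi_hrefl := as_hrefl AS.
Let Phi_int := as_int AS.
Let Phi_pos := as_pos AS.
Let sr_apos := as_sr AS.
Let apos_arefl := as_arefl AS.
Let apos_ascent := as_ascent AS.
Let ninv_arefl := as_ninv AS.
Let ht_arefl := as_ht_arefl AS.
Let ht_gt0 := as_ht_gt0 AS.
Let ht_int := as_ht_int AS.

Lemma Phi_opp g : g \in Phi -> - g \in Phi.
Proof. by move=> gP; rewrite -(hrefl_self (Phi_norm gP)) Phi_hrefl. Qed.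

Lemma perm_hrefl a : a \in Phi -> perm_eq (map (hrefl a) Phi) Phi.
Proof.
move=> aP; apply: perm_map_involutive => //; first exact/hreflK/Phi_norm.
by move=> g; apply: Phi_hrefl.
Qed.

Lemma hrefl_possum a y : a \in Phi -> possum (hrefl a y) = hrefl a (possum y).
Proof.
move=> aP; have h := Phi_norm aP.
rewrite /possum -(perm_big _ (perm_hrefl aP)) big_map.
have E: forall g, B (hrefl a y) (hrefl a g) = B y g by move=> g; exact: ip_hrefl.
rewrite (eq_bigl (fun g => 0 < B y g)); last by move=> g; rewrite E.
rewrite /hrefl copair_suml scaler_suml.
by rewrite -sumrB.
Qed.

Lemma apos_root b : apos b -> b.1 \in Phi. Proof. by case/and3P. Qed.
Lemma apos_norm b : apos b -> 0 < B b.1 b.1.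
Proof. by move/apos_root; apply: Phi_norm. Qed.
Lemma sr_norm j : 0 < B (sr j).1 (sr j).1. Proof. exact/apos_norm/sr_apos. Qed.
Lemma sr_root j : (sr j).1 \in Phi. Proof. exact/apos_root/sr_apos. Qed.
Hint Resolve sr_norm sr_root sr_apos : core.

Lemma apos_ind (P : V * rat -> Prop) :
  (forall b, apos b ->
     (forall j, b != sr j -> 0 < B b.1 (sr j).1 -> P (arefl (sr j) b)) -> P b) ->
  forall b, apos b -> P b.
Proof.
(* Heights are rationals known to be integral; the floor turns them into the natural number on which
   the induction runs. *)
move=> IH b; have [m le_m] := ubnP (`|Num.floor (ht b)|%N).
elim: m b le_m => // m IHm b le_m ab; apply: IH => // j ne h.
have ab' := apos_arefl ab ne; apply: IHm => //.
have: ht (arefl (sr j) b) < ht b.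
  by rewrite ht_arefl ltrBlDr ltrDl mulr_gt0 ?ht_gt0 // copair_gt0.
have /intrP[z hz] := ht_int ab; have /intrP[z' hz'] := ht_int ab'.
have := ht_gt0 ab; have := ht_gt0 ab'; move: le_m.
rewrite hz hz' !intrKfloor !ltr0z ltr_int.
by case: z {hz} => // z; case: z' {hz'} => // z' /=; lia.
Qed.

Lemma step_len_sr j y : 0 < B y (sr j).1 -> step_len y (sr j) = 1.
Proof. by move=> h; rewrite /step_len ninv_arefl gtr0_sg //; ring. Qed.

Lemma possum_step y g : g \in Phi ->
  possum (hrefl g y) = possum y - copair (possum y) g *: g.
Proof. by move=> gP; rewrite hrefl_possum. Qed.

(** [as_ninv] applies at both ends y and r_b y and produces the two signs. The leftover terms in
    [possum] cancel against the change of level from b to [arefl (sr j) b], because [possum] is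
    equivariant. *)
Lemma step_len_arefl j b y : b.1 \in Phi ->
  step_len (hrefl (sr j).1 y) (arefl (sr j) b) =
  step_len y b + Num.sg (B (hrefl b.1 y) (sr j).1) - Num.sg (B y (sr j).1).
Proof.
move=> bP; have h := sr_norm j.
rewrite /step_len /= hrefl_conj // !ninv_arefl (hrefl_possum _ (sr_root j)) copair_hrefl //.
rewrite possum_step // copairB copairZ /acopair; ring.
Qed.

Lemma ip_step_lt y b a : 0 < B y b -> 0 < B b b -> 0 < B b a ->
  B (hrefl b y) a < B y a.
Proof.
move=> h1 h2 h3; rewrite /hrefl ipBl ipZl ltrBlDr ltrDl mulr_gt0 //.
by rewrite copair_gt0.
Qed.

Lemma step_len_ge1 b : apos b -> forall y, 0 < B y b.1 -> 1 <= step_len y b.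
Proof.
move: b; apply: apos_ind => b ab IH y hy.
have [j hj] := apos_ascent ab.
have [eb|ne] := eqVneq b (sr j).
  by rewrite eb step_len_sr // -eb.
have lt := ip_step_lt hy (apos_norm ab) hj.
have := IH j ne hj (hrefl (sr j).1 y); rewrite ip_hrefl // => /(_ hy).
rewrite step_len_arefl ?apos_root //.
by have := le_sgr (ltW lt); lra.
Qed.

(** If the sign on the j-th simple root dropped along a step of length 1, reflecting this step by
    r_j would give a step of length at most 0 along a positive root. *)
Lemma step_sgr_mono b y j : apos b -> b != sr j -> 0 < B y b.1 ->
  step_len y b = 1 -> Num.sg (B y (sr j).1) <= Num.sg (B (hrefl b.1 y) (sr j).1).
Proof.
move=> ab ne hy D1.
have := @step_len_ge1 _ (apos_arefl ab ne) (hrefl (sr j).1 y).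
rewrite ip_hrefl // => /(_ hy); rewrite step_len_arefl ?apos_root // D1; lra.
Qed.

(** * Chains and covers among level-zero weights *)

Inductive chain : nat -> V * rat -> V * rat -> Prop :=
| chain_nil u : chain 0 u u
| chain_cons k b u v : apos b -> B u.1 b.1 < 0 -> chain k (arefl b u) v ->
    chain k.+1 u v.

Lemma chain_cat k l u v w : chain k u v -> chain l v w -> chain (k + l) u w.
Proof. by elim=> // {}k b {}u {}v ab h _ IH /IH; apply: chain_cons. Qed.

Lemma chain1 b u : apos b -> B u.1 b.1 < 0 -> chain 1 u (arefl b u).
Proof. by move=> ab h; apply: chain_cons ab h (chain_nil _). Qed.

(** Each step adds a positive multiple of a positive affine root. Height thus stands in for a length
    function and rules out cycles. *)
Lemma chain_ht k u v : chain k u v -> if k is 0 then u = v else ht u < ht v.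
Proof.
elim=> // {}k b {}u {}v ab h _ IH.
have lt : ht u < ht (arefl b u).
  rewrite ht_arefl ltrDl oppr_gt0 nmulr_rlt0 ?ht_gt0 //.
  by rewrite copair_lt0 // apos_norm.
by case: k IH => [<- //|k]; apply: lt_trans.
Qed.

Lemma chain_acyclic k u : chain k u u -> k = 0.
Proof. by move/chain_ht; case: k => // k; rewrite ltxx. Qed.

Lemma sr_step j u : B u.1 (sr j).1 < 0 -> chain 1 u (arefl (sr j) u).
Proof. exact: chain1. Qed.

(** Deodhar's lifting argument: r_j maps every step with label other than alpha_j to a step with
    positive label. At the first step labelled alpha_j the reflected chain has already reached the
    next weight, so that step is saved and the rest is kept. The mirror statement below uses the
    last such step. *)
Lemma chain_arefl_left j k u v : chain k u v ->
  chain k (arefl (sr j) u) (arefl (sr j) v) \/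
  (0 < k)%N /\ chain k.-1 (arefl (sr j) u) v.
Proof.
have h := sr_norm j.
elim=> [w|{}k b {}u {}v ab hb c IH]; first by left; apply: chain_nil.
have [eb|ne] := eqVneq b (sr j); first by right; rewrite -eb.
have hb' : B (arefl (sr j) u).1 (arefl (sr j) b).1 < 0 by rewrite ip_hrefl.
have ab' := apos_arefl ab ne.
case: IH => [c'|[k0 c']]; [left|right].
  by apply: chain_cons ab' hb' _; rewrite arefl_conj.
split=> //=; rewrite -(prednK k0); apply: chain_cons ab' hb' _.
by rewrite arefl_conj.
Qed.

Lemma chain_arefl_right j k u v : chain k u v ->
  chain k (arefl (sr j) u) (arefl (sr j) v) \/
  (0 < k)%N /\ chain k.-1 u (arefl (sr j) v).
Proof.
have h := sr_norm j.
elim=> [w|{}k b {}u {}v ab hb c IH]; first by left; apply: chain_nil.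
case: IH => [c'|[k0 c']]; last first.
  by right; split=> //=; rewrite -(prednK k0); apply: chain_cons ab hb _.
have [eb|ne] := eqVneq b (sr j).
  by right; split=> //=; rewrite eb areflK in c'.
left; apply: (chain_cons (apos_arefl ab ne)); first by rewrite ip_hrefl.
by rewrite arefl_conj.
Qed.

(** If a step is saved at one end, the common nonzero sign allows a step labelled alpha_j at one end
    of the chain, which restores the length. *)
Lemma chain_arefl j k u v :
  Num.sg (B u.1 (sr j).1) = Num.sg (B v.1 (sr j).1) -> B u.1 (sr j).1 != 0 ->
  chain k u v -> chain k (arefl (sr j) u) (arefl (sr j) v).
Proof.
have h := sr_norm j => sg; rewrite neq_lt => /orP[] h0 c.
  have [//|[k0 c']] := chain_arefl_left j c.
  have hv : B v.1 (sr j).1 < 0 by rewrite -sgr_lt0 -sg sgr_lt0.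
  by rewrite -(prednK k0) -addn1; apply: chain_cat c' (sr_step hv).
have [//|[k0 c']] := chain_arefl_right j c.
have hu : B (arefl (sr j) u).1 (sr j).1 < 0 by rewrite ip_hrefl_self // oppr_lt0.
rewrite -(prednK k0) -add1n; apply: chain_cat (sr_step hu) _.
by rewrite areflK.
Qed.

Definition cover u v := chain 1 u v /\ forall k, chain k u v -> (k <= 1)%N.

Lemma cover_sr j u : B u.1 (sr j).1 < 0 -> cover u (arefl (sr j) u).
Proof.
move=> hu; split=> [|k c]; first exact: sr_step.
have h := sr_norm j.
(* Either the reflected chain leads from r_j u back to u and closes a cycle with c, or it leads from
   r_j u to itself in k - 1 steps. *)
have [c'|[k0 /chain_acyclic]] := chain_arefl_left j c; last by case: k k0 {c} => [|[]].
rewrite areflK // in c'.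
by have /chain_acyclic/eqP := chain_cat c c'; rewrite addn_eq0 => /andP[/eqP->].
Qed.

Lemma cover_arefl j u v :
  Num.sg (B u.1 (sr j).1) = Num.sg (B v.1 (sr j).1) -> B u.1 (sr j).1 != 0 ->
  cover u v <-> cover (arefl (sr j) u) (arefl (sr j) v).
Proof.
have h := sr_norm j => sg u0; split=> [] [c1 cn]; split.
- exact: chain_arefl.
- move=> k c; apply: cn; rewrite -(areflK h u) -(areflK h v).
  by apply: chain_arefl => //=; rewrite !ip_hrefl_self ?sgrN ?sg ?oppr_eq0.
- rewrite -(areflK h u) -(areflK h v).
  by apply: chain_arefl => //=; rewrite !ip_hrefl_self ?sgrN ?sg ?oppr_eq0.
- by move=> k c; apply: cn; apply: chain_arefl.
Qed.

Lemma cover_step_len b : apos b -> forall u, B u.1 b.1 < 0 ->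
  cover u (arefl b u) <-> step_len (arefl b u).1 b = 1.
Proof.
move: b; apply: apos_ind => b ab IH u hu.
have nb := apos_norm ab.
have [j hj] := apos_ascent ab; have h := sr_norm j.
set v := arefl b u.
have vb : 0 < B v.1 b.1 by rewrite ip_hrefl_self // oppr_gt0.
have [eb|ne] := eqVneq b (sr j).
  split=> _; first by rewrite eb step_len_sr // -eb.
  by rewrite /v eb; apply: cover_sr; rewrite -eb.
have ub : hrefl b.1 v.1 = u.1 by rewrite hreflK.
have lt : B u.1 (sr j).1 < B v.1 (sr j).1 by rewrite -ub ip_step_lt.
have D : step_len v.1 b = step_len (hrefl (sr j).1 v.1) (arefl (sr j) b)
    + Num.sg (B v.1 (sr j).1) - Num.sg (B u.1 (sr j).1).
  by rewrite step_len_arefl ?apos_root // ub; ring.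
have ab' := apos_arefl ab ne.
(* The value on alpha_j strictly increases from u to v. Equal signs are therefore nonzero, and the
   whole situation can be reflected by r_j. *)
have := le_sgr (ltW lt); rewrite le_eqVlt => /orP[/eqP sg|sg].
  rewrite D sg addrK.
  have u0 : B u.1 (sr j).1 != 0.
    apply/eqP => u0; move: sg lt; rewrite u0 sgr0 => /esym/eqP.
    by rewrite sgr_eq0 => /eqP ->; rewrite ltxx.
  rewrite (cover_arefl sg u0) /v -arefl_conj //.
  have -> : hrefl (sr j).1 (arefl b u).1 = (arefl (arefl (sr j) b) (arefl (sr j) u)).1.
    by rewrite arefl_conj.
  by apply: IH => //; rewrite ip_hrefl.
(* If the sign increases, both sides of the equivalence fail: the step has length at least 2, and u,
   r_j u, r_j v, v form a chain with at least two steps. An outer step is absent only when r_j fixes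
   that end. *)
have : 1 <= step_len (hrefl (sr j).1 v.1) (arefl (sr j) b).
  by apply: step_len_ge1 => //; rewrite ip_hrefl.
move=> D'; split=> [[_ cn]|]; last by have := sgr_lt_ge1 sg; lra.
have mid : chain 1 (arefl (sr j) u) (arefl (sr j) v).
  by rewrite -arefl_conj //; apply: chain1; rewrite // ip_hrefl.
have head : B u.1 (sr j).1 < 0 -> (chain 2 u (arefl (sr j) v)).
  by move=> /sr_step s; apply: chain_cat s mid.
have tail : 0 < B v.1 (sr j).1 -> (chain 2 (arefl (sr j) u) v).
  move=> s; have -> : v = arefl (sr j) (arefl (sr j) v) by rewrite areflK.
  by apply: chain_cat mid (sr_step _); rewrite ip_hrefl_self // oppr_lt0.
have zero w : B w.1 (sr j).1 = 0 -> arefl (sr j) w = w.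
  move=> w0; have c0 : copair w.1 (sr j).1 = 0 by rewrite /copair w0 mulr0 mul0r.
  by case: w {w0} c0 => w x /= c0; rewrite /arefl /hrefl /acopair /= c0 scale0r mul0r !subr0.
(* [ltrgt0P] lists the positive case first, so [u_lt0] says 0 < _ and [u_gt0] says _ < 0. A positive
   value at u is excluded, the sign at v being larger. *)
have [u_lt0|u_gt0|u0] := ltrgt0P (B u.1 (sr j).1).
- have [v_lt0|v_gt0|v0] := ltrgt0P (B v.1 (sr j).1).
  + by move: sg; rewrite !gtr0_sg ?ltxx.
  + by move: sg; rewrite gtr0_sg // ltr0_sg.
  + by move: sg; rewrite gtr0_sg // v0 sgr0.
- have [v_gt0|v_lt0|v0] := ltrgt0P (B v.1 (sr j).1).
  + have: chain 3 u v by apply: chain_cat (sr_step u_gt0) (tail v_gt0).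
    by move/cn.
  + by move: sg; rewrite !ltr0_sg ?ltxx.
  + by have := head u_gt0; rewrite zero // => /cn.
- have v_gt0 : 0 < B v.1 (sr j).1 by rewrite -u0.
  by have := tail v_gt0; rewrite zero // => /cn.
Qed.

(** * Levels of affine roots and quantum edges *)

Lemma apos_shift g k : g \in Phi -> k \is a Num.int -> 0 < k -> apos (g, k).
Proof. by move=> gP kZ k0; rewrite /apos /= gP kZ k0. Qed.

Lemma apos_pos g : g \in Phi -> pos g -> apos (g, 0).
Proof. by move=> gP p; apply/and3P; rewrite /= p. Qed.

Lemma step_len_opp y g k l : g \in Phi ->
  step_len y (g, k) + step_len (hrefl g y) (- g, l) =
  (k + l) * copair (possum y) g.
Proof.
move=> gP; have h := Phi_norm gP.
rewrite /step_len /= hreflN hreflK // hrefl_possum // copairNr.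
have -> : copair (hrefl g (possum y)) g = - copair (possum y) g.
  by rewrite -{2}[g]opprK -(hrefl_self h) copairNr copair_hrefl.
by ring.
Qed.

Lemma step_len_reverse_ge1 y g l : 0 < B y g -> apos (- g, l) ->
  1 <= step_len (hrefl g y) (- g, l).
Proof.
move=> hy a; apply: (step_len_ge1 a) => /=.
rewrite ipNr ip_hrefl_self ?opprK //.
by have := apos_norm a; rewrite ipNl ipNr opprK.
Qed.

(** One of g, -g is positive at level 0 and the other becomes positive at level 1. The step along
    one and the way back along the other both have length at least 1, and by [step_len_opp] their
    lengths add up to this pairing. *)
Lemma possum_ge2 y g : g \in Phi -> 0 < B y g -> 2 <= copair (possum y) g.
Proof.
move=> gP hy; have gN := Phi_opp gP.
have /orP[p|p] := Phi_pos gP.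
- have a1 : apos (g, 0) by exact: apos_pos.
  have a2 : apos (- g, 1) by apply: apos_shift.
  have := step_len_reverse_ge1 hy a2; have := step_len_ge1 a1 hy.
  by have := step_len_opp y 0 1 gP; rewrite add0r mul1r => <-; lra.
- have a1 : apos (- g, 0) by exact: apos_pos.
  have a2 : apos (g, 1) by apply: apos_shift.
  have := step_len_reverse_ge1 hy a1; have := step_len_ge1 a2 hy.
  by have := step_len_opp y 1 0 gP; rewrite addr0 mul1r => <-; lra.
Qed.

Definition qstep (y g : V) : Prop :=
  ninv (hrefl g y) = ninv y + 1 \/
  ninv (hrefl g y) = ninv y - copair (possum y) g + 1.

Lemma qstepP y g : g \in Phi -> 0 < B y g ->
  qstep y g <-> exists k, apos (g, k) /\ step_len y (g, k) = 1.
Proof.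
move=> gP hy; split=> [[]e|[k [a D1]]].
- have /orP[p|p] := Phi_pos gP.
    exists 0; split; last by rewrite /step_len /= e; ring.
    exact: apos_pos.
  (* A Bruhat edge cannot have a negative g: the way back along -g at level 0 would have length at
     least 1, while both lengths sum to 0. *)
  have a : apos (- g, 0) by exact: apos_pos (Phi_opp gP) p.
  have := step_len_reverse_ge1 hy a; have := step_len_opp y 0 0 gP.
  by rewrite /step_len /= e; lra.
- exists 1; split; last by rewrite /step_len /= e; ring.
  exact: apos_shift.
have [k0|[k1|k1]] : k = 0 \/ k = 1 \/ 1 < k.
- case/and3P: a => /= _ /intrP[z ->].
  rewrite ltr0z intr_eq0 -[1]/(1%:~R) ltr_int => z0.
  by case: (z) z0 => [[|[|m]]|m] //=; auto.
- by left; move: D1; rewrite /step_len /= k0; lra.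
- by right; move: D1; rewrite /step_len /= k1; lra.
(* For k > 1 the level k - 1 is still admissible with length at least 1, so level k would have
   length at least 3. *)
have a' : apos (g, k - 1).
  by apply: apos_shift; rewrite ?subr_gt0 // rpredB ?rpred1 //; case/and3P: a.
have := step_len_ge1 a' hy; have := possum_ge2 gP hy.
by move: D1; rewrite /step_len /=; lra.
Qed.

(** * Directed paths of vectors with an integrality condition *)

Section Paths.
Variable s : rat.

(** At s = 0 the integrality condition is empty, which covers arbitrary directed paths. The path
    runs from its first vector to its second. *)
Inductive qpath : nat -> V -> V -> Prop :=
| qpath_nil y : qpath 0 y y
| qpath_cons n b y x : apos b -> 0 < B y b.1 -> step_len y b = 1 ->
    s * copair y b.1 \is a Num.int -> qpath n (hrefl b.1 y) x -> qpath n.+1 y x.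

Lemma qpath_cat m n y z x : qpath m y z -> qpath n z x -> qpath (m + n) y x.
Proof.
elim=> // {}m b {}y {}z ab hy D1 sy _ IH /IH; exact: (qpath_cons ab).
Qed.

Lemma qpath_rcons_inv n y x : qpath n.+1 y x -> exists z b,
  [/\ qpath n y z, apos b, 0 < B z b.1, step_len z b = 1 &
      s * copair z b.1 \is a Num.int /\ x = hrefl b.1 z].
Proof.
elim: n y => [|n IH] y p; inversion p as [|n' b' y' x' ab hy D1 sy q]; subst.
  by inversion q; subst; exists y, b'; split=> //; apply: qpath_nil.
have [z [b [r ab2 hz D2 sz]]] := IH _ q.
by exists z, b; split=> //; apply: qpath_cons r.
Qed.

Lemma qpath_sr j y : 0 < B y (sr j).1 -> s * copair y (sr j).1 \is a Num.int ->
  qpath 1 y (hrefl (sr j).1 y).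
Proof.
move=> hy sy; apply: (qpath_cons (sr_apos j) hy _ sy); last exact: qpath_nil.
exact: step_len_sr.
Qed.

Lemma step_int y a g : a \in Phi -> g \in Phi -> s * copair y a \is a Num.int ->
  s * copair (hrefl a y) g - s * copair y g \is a Num.int.
Proof.
move=> aP gP sy; rewrite /hrefl copairB copairZ mulrBr addrAC subrr sub0r rpredN.
by rewrite mulrA rpredM // Phi_int.
Qed.

Lemma qpath_int n y x g : g \in Phi -> qpath n y x ->
  s * copair x g - s * copair y g \is a Num.int.
Proof.
move=> gP; elim=> [z|{}n b {}y {}x ab _ _ sy _ IH]; first by rewrite subrr rpred0.
have := rpredD IH (step_int (apos_root ab) gP sy).
by rewrite addrA subrK.
Qed.

Lemma int_subr (a b : rat) :
  a - b \is a Num.int -> b \is a Num.int -> a \is a Num.int.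
Proof. by move=> h /(rpredD h); rewrite subrK. Qed.

Lemma int_subl (a b : rat) :
  a - b \is a Num.int -> a \is a Num.int -> b \is a Num.int.
Proof. by move=> h /(rpredB h); rewrite addrAC subrr sub0r rpredN. Qed.

Lemma qpath_hrefl_cons j n b y x : apos b -> b != sr j -> 0 < B y b.1 ->
  step_len y b = 1 -> s * copair y b.1 \is a Num.int ->
  Num.sg (B y (sr j).1) = Num.sg (B (hrefl b.1 y) (sr j).1) ->
  qpath n (hrefl (sr j).1 (hrefl b.1 y)) x -> qpath n.+1 (hrefl (sr j).1 y) x.
Proof.
move=> ab ne hy D1 sy sg p; have h := sr_norm j.
apply: (qpath_cons (apos_arefl ab ne)).
- by rewrite ip_hrefl.
- by rewrite step_len_arefl ?apos_root // D1 -sg addrK.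
- by rewrite copair_hrefl.
- by rewrite hrefl_conj.
Qed.

(** By [step_sgr_mono] the sign on alpha_j stays positive up to the first edge labelled alpha_j, so
    the reflected edges again have length 1. The edge labelled alpha_j, if there is one, is absorbed
    by the reflection, and its integrality is transported back to y. *)
Lemma qpath_hrefl_left j n y x : qpath n y x -> 0 < B y (sr j).1 ->
  (0 < B x (sr j).1 /\ qpath n (hrefl (sr j).1 y) (hrefl (sr j).1 x)) \/
  [/\ (0 < n)%N, qpath n.-1 (hrefl (sr j).1 y) x &
      s * copair y (sr j).1 \is a Num.int].
Proof.
elim=> [z hz|{}n b {}y {}x ab hb D1 sy q IH hy].
  by left; split=> //; apply: qpath_nil.
have [eb|ne] := eqVneq b (sr j); first by right; split; rewrite // -eb.
have mono := step_sgr_mono ab ne hb D1.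
have hz : 0 < B (hrefl b.1 y) (sr j).1.
  by rewrite -sgr_gt0; apply: lt_le_trans mono; rewrite sgr_gt0.
have sg : Num.sg (B y (sr j).1) = Num.sg (B (hrefl b.1 y) (sr j).1).
  by rewrite !gtr0_sg.
have [[hx p]|[n0 p sz]] := IH hz; [left|right]; split=> //.
- exact: qpath_hrefl_cons p.
- by rewrite -(prednK n0); apply: qpath_hrefl_cons p.
exact: int_subl (step_int (apos_root ab) (sr_root j) sy) sz.
Qed.

Lemma qpath_hrefl_right j n y x : qpath n y x -> B x (sr j).1 < 0 ->
  (B y (sr j).1 < 0 /\ qpath n (hrefl (sr j).1 y) (hrefl (sr j).1 x)) \/
  [/\ (0 < n)%N, qpath n.-1 y (hrefl (sr j).1 x) &
      s * copair x (sr j).1 \is a Num.int].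
Proof.
elim=> [z hz|{}n b {}y {}x ab hb D1 sy p IH hx].
  by left; split=> //; apply: qpath_nil.
have [[hz q]|[n0 q sx]] := IH hx; last first.
  by right; split=> //; rewrite -(prednK n0); apply: qpath_cons q.
have [eb|ne] := eqVneq b (sr j).
  right; split=> //; first by move: q; rewrite eb hreflK.
  have /(qpath_int (sr_root j)) h := qpath_cons ab hb D1 sy p.
  by apply: int_subr h _; rewrite -eb.
have mono := step_sgr_mono ab ne hb D1.
have hy : B y (sr j).1 < 0.
  by rewrite -sgr_lt0; apply: le_lt_trans mono _; rewrite sgr_lt0.
left; split=> //; apply: qpath_hrefl_cons q => //.
by rewrite !ltr0_sg.
Qed.

Lemma qpath_hrefl_gt0 j n y x : 0 < B y (sr j).1 -> 0 < B x (sr j).1 ->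
  qpath n y x -> qpath n (hrefl (sr j).1 y) (hrefl (sr j).1 x).
Proof.
move=> hy hx p; have [[//]|[n0 q sy]] := qpath_hrefl_left p hy.
rewrite -(prednK n0) -addn1; apply: qpath_cat q (qpath_sr hx _).
exact: int_subr (qpath_int (sr_root j) p) sy.
Qed.

Lemma qpath_hrefl_lt0 j n y x : B y (sr j).1 < 0 -> B x (sr j).1 < 0 ->
  qpath n y x -> qpath n (hrefl (sr j).1 y) (hrefl (sr j).1 x).
Proof.
move=> hy hx p; have [[//]|[n0 q sx]] := qpath_hrefl_right p hx.
have h := sr_norm j.
have hy' : 0 < B (hrefl (sr j).1 y) (sr j).1 by rewrite ip_hrefl_self // oppr_gt0.
rewrite -(prednK n0) -add1n; apply: (@qpath_cat 1 n.-1 _ y) q.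
rewrite -{2}(hreflK h y); apply: qpath_sr => //.
rewrite -[X in copair _ X]opprK copairNr -(hrefl_self h) copair_hrefl //.
by rewrite mulrN rpredN; apply: int_subl (qpath_int (sr_root j) p) sx.
Qed.

End Paths.

(** A certificate that every directed path from y to x can be cut at an end: after simple
    reflections applied to both vectors while their signs agree, a simple root is reached on which
    the sign of x is smaller. By [step_sgr_mono] only an edge labelled by that root can lower the
    sign. *)
Inductive separated : V -> V -> Prop :=
| sep_now j y x : Num.sg (B x (sr j).1) < Num.sg (B y (sr j).1) -> separated y x
| sep_hrefl j y x : Num.sg (B y (sr j).1) = Num.sg (B x (sr j).1) ->
    separated (hrefl (sr j).1 y) (hrefl (sr j).1 x) -> separated y x.

Lemma sgr_addM (c p q u v : rat) : 0 < c -> Num.sg p <= Num.sg q ->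
  Num.sg u < Num.sg v -> Num.sg (p + c * u) <= Num.sg (q + c * v).
Proof.
move=> c0 pq uv.
have [u0 v0] : u <= 0 /\ 0 <= v.
  by move: uv; case: (sgrP u) => ?; case: (sgrP v) => ?; lra.
have cu : c * u <= 0 by rewrite pmulr_rle0.
have cv : 0 <= c * v by rewrite pmulr_rge0.
apply: le_trans (le_trans pq _); apply: le_sgr; lra.
Qed.

(** Descent on b once more. If the signs on alpha_j agree, y, x and b are all reflected. Otherwise y
    is at most 0 and x at least 0 on alpha_j, and adding a positive multiple of these values
    preserves the inequality for r_j b. *)
Lemma not_separated_sgr b : apos b -> forall y x, ~ separated y x ->
  Num.sg (B y b.1) <= Num.sg (B x b.1).
Proof.
move: b; apply: apos_ind => b ab IH y x ns.
have [j hj] := apos_ascent ab; have h := sr_norm j.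
have le_j : Num.sg (B y (sr j).1) <= Num.sg (B x (sr j).1).
  by rewrite leNgt; apply/negP => lt; apply: ns; apply: sep_now lt.
have [eb|ne] := eqVneq b (sr j); first by rewrite eb.
move: (le_j); rewrite le_eqVlt => /orP[/eqP sg|sg].
  rewrite -(ip_hrefl y b.1 h) -(ip_hrefl x b.1 h).
  by apply: (IH j) => // ns'; apply: ns; apply: sep_hrefl ns'.
have := IH j ne hj y x ns; rewrite /= /hrefl !ipBr !ipZr.
move=> /(sgr_addM (c := copair b.1 (sr j).1)); rewrite copair_gt0 //.
by move=> /(_ _ _ hj sg); rewrite !subrK.
Qed.

Variable orb : V -> Prop.
Hypothesis orb_sr : forall j y, orb y -> orb (hrefl (sr j).1 y).
Hypothesis orb_sgr : forall y x, orb y -> orb x ->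
  (forall g, g \in Phi -> Num.sg (B y g) = Num.sg (B x g)) -> y = x.

(** Both g + delta and -g + delta are positive affine roots, so the inequality of signs holds on g
    and on -g and is an equality. Signs on the finite roots determine an element of the orbit. *)
Lemma separatedP y x : orb y -> orb x -> ~ separated y x -> y = x.
Proof.
move=> oy ox ns; apply: orb_sgr => // g gP; apply/eqP; rewrite eq_le.
apply/andP; split; first exact: (@not_separated_sgr (g, 1) (apos_shift gP _ _)).
have := @not_separated_sgr (- g, 1) (apos_shift (Phi_opp gP) _ _) _ _ ns.
by rewrite !ipNr !sgrN lerN2; apply.
Qed.

(** The outer induction is on the length of the unrestricted path p, the inner one on the
    certificate of separation. Cutting at an end shortens p and q together; reflecting both ends
    keeps their lengths and uses up the certificate. The length m of q is arbitrary throughout. *)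
Lemma qpath_shorten s n m y x : orb y -> orb x ->
  qpath 0 n y x -> qpath s m y x -> exists2 k, (k <= n)%N & qpath s k y x.
Proof.
elim: n y x m => [|n IHn] y x m oy ox p q.
  by inversion p; exists 0%N => //; apply: qpath_nil.
have [->|/eqP ne] := eqVneq y x; first by exists 0%N => //; apply: qpath_nil.
have [sp|ns] := pselect (separated y x); last by case: ne; apply: separatedP.
elim: sp m oy ox p q {ne} => {y x} [j y x lt|j y x sg _ IH] m oy ox p q.
  (* If y is positive on alpha_j, then x is not, so p and q both contain an edge labelled alpha_j.
     Both are cut to start at r_j y, and the edge from y to r_j y is prepended to the result; its
     integrality comes from q. *)
  have [hy|hy] := ltP 0 (B y (sr j).1).
    have hx : (0 < B x (sr j).1) = false.
      by apply/negP => hx; move: lt; rewrite !gtr0_sg ?ltxx.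
    have [[]|[_ p' _]] := qpath_hrefl_left p hy; first by rewrite hx.
    have [[]|[_ q' sy]] := qpath_hrefl_left q hy; first by rewrite hx.
    have [k le_k r] := IHn _ _ _ (orb_sr _ oy) ox p' q'.
    by exists k.+1 => //; rewrite -add1n; apply: qpath_cat (qpath_sr hy sy) r.
  have hx : B x (sr j).1 < 0.
    rewrite -sgr_lt0; apply: lt_le_trans lt _; rewrite -[0](@sgr0 rat).
    exact: le_sgr.
  have hy0 : (B y (sr j).1 < 0) = false.
    by apply/negP => hy0; move: lt; rewrite !ltr0_sg ?ltxx.
  have [[]|[_ p' _]] := qpath_hrefl_right p hx; first by rewrite hy0.
  have [[]|[_ q' sx]] := qpath_hrefl_right q hx; first by rewrite hy0.
  have [k le_k r] := IHn _ _ _ oy (orb_sr _ ox) p' q'.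
  have h := sr_norm j.
  exists k.+1 => //; rewrite -addn1; apply: qpath_cat r _.
  rewrite -{2}(hreflK h x); apply: qpath_sr.
    by rewrite ip_hrefl_self // oppr_gt0.
  rewrite -[X in copair _ X]opprK copairNr -(hrefl_self h) copair_hrefl //.
  by rewrite mulrN rpredN.
have h := sr_norm j.
have oy' := orb_sr j oy; have ox' := orb_sr j ox.
have [y0|y0|y0] := ltrgt0P (B y (sr j).1).
- have x0 : 0 < B x (sr j).1 by rewrite -sgr_gt0 -sg sgr_gt0.
  have [k le_k r] := IH _ oy' ox' (qpath_hrefl_gt0 y0 x0 p) (qpath_hrefl_gt0 y0 x0 q).
  exists k => //; rewrite -(hreflK h y) -(hreflK h x).
  by apply: qpath_hrefl_lt0 r; rewrite ip_hrefl_self // oppr_lt0.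
- have x0 : B x (sr j).1 < 0 by rewrite -sgr_lt0 -sg sgr_lt0.
  have [k le_k r] := IH _ oy' ox' (qpath_hrefl_lt0 y0 x0 p) (qpath_hrefl_lt0 y0 x0 q).
  exists k => //; rewrite -(hreflK h y) -(hreflK h x).
  by apply: qpath_hrefl_gt0 r; rewrite ip_hrefl_self // oppr_gt0.
have fix0 z : B z (sr j).1 = 0 -> hrefl (sr j).1 z = z.
  by move=> z0; rewrite /hrefl /copair z0 mulr0 mul0r scale0r subr0.
have x0 : B x (sr j).1 = 0 by apply/eqP; rewrite -sgr_eq0 -sg y0 sgr0.
by move: IH; rewrite !fix0 // => IH; apply: IH q.
Qed.

End AffineRoots.
End Reflection.

(** * Symmetrizability of a Cartan matrix of finite type *)

Section Symmetrizer.

Variables (n : nat) (A : GCM n).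
Hypothesis GCM_A : is_GCM A.
Variable u : 'I_n -> rat.
Hypothesis u_gt0 : forall i, 0 < u i.
Hypothesis Au_gt0 : forall i, 0 < \sum_(j < n) (A i j)%:~R * u j.

Lemma GCM_diag i : A i i = 2. Proof. by have [h _] := GCM_A; apply: h. Qed.
Lemma GCM_off i j : i != j -> A i j <= 0. Proof. by have [_ [h _]] := GCM_A; apply: h. Qed.
Lemma GCM_zero i j : A i j = 0 -> A j i = 0.
Proof. by have [_ [_ h]] := GCM_A => /h. Qed.

(* Summing (A u)_i > 0 over S, a vertex with two neighbours in S contributes a
   non-positive amount, so the Dynkin graph has no cycle. *)
Lemma leaf_ex (S : {set 'I_n}) : S != finset.set0 ->
  exists2 l, l \in S & forall p q, p \in S -> q \in S -> p != l -> q != l ->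
    A l p != 0 -> A l q != 0 -> p = q.
Proof.
move=> S0; apply: contrapT => no.
have two l : l \in S -> exists p q, [/\ p \in S, q \in S, p != q &
    [/\ p != l, q != l, A l p != 0 & A l q != 0]].
  move=> lS; apply: contrapT => h; apply: no; exists l => // p q pS qS pl ql hp hq.
  by apply/eqP; apply: contraT => pq; case: h; exists p, q.
have : 0 < \sum_(i in S) \sum_(j in S) (A i j)%:~R * u j.
  have [l lS] := finset.set0Pn _ S0.
  rewrite (bigD1 l) //=; apply: ltr_wpDr.
    apply: sumr_ge0 => i /andP[iS _]; apply: le_trans (ltW (Au_gt0 i)) _.
    rewrite [leRHS]big_mkcond /=; apply: ler_sum => j _.
    case: ifP => // /negbT jS; rewrite pmulr_lle0 // lerz0 GCM_off //.
    by apply: contraNneq jS => <-.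
  apply: lt_le_trans (Au_gt0 l) _.
  rewrite [leRHS]big_mkcond /=; apply: ler_sum => j _.
  case: ifP => // /negbT jS; rewrite pmulr_lle0 // lerz0 GCM_off //.
  by apply: contraNneq jS => <-.
rewrite exchange_big /= ltNge => /negP; apply.
apply: sumr_le0 => j jS; rewrite -mulr_suml pmulr_lle0 //.
rewrite -rmorph_sum /= lerz0.
have [p [q [pS qS pq [pj qj hp hq]]]] := two j jS.
rewrite (bigD1 j) //= GCM_diag (bigD1 p) /=; last by rewrite pS.
rewrite (bigD1 q) /=; last by rewrite qS qj eq_sym.
have neg i : i != j -> A j i != 0 -> A i j <= -1.
  move=> ij h; have := GCM_off ij; have : A i j != 0 by apply: contra_neq h => /GCM_zero.
  by lia.
set r := (X in _ + (_ + (_ + X))).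
have r0 : r <= 0 by apply: sumr_le0 => i /andP[/andP[/andP[_ ij] _] _]; apply: GCM_off.
have := neg _ pj hp; have := neg _ qj hq; move: r r0 => r; lia.
Qed.

(** Induction by removing a leaf l of the Dynkin graph: [dl] is forced by the symmetry condition
    with the only neighbour p of l, and it is positive because both off-diagonal entries are
    negative. *)
Lemma symmetrizer_on (k : nat) (S : {set 'I_n}) : #|S| = k ->
  exists d : 'I_n -> rat, (forall i, 0 < d i) /\
    (forall i j, i \in S -> j \in S -> d i * (A i j)%:~R = d j * (A j i)%:~R).
Proof.
elim: k S => [|k IH] S cS.
  exists (fun=> 1); split=> // i j; rewrite (cards0_eq cS) inE //.
have S0 : S != finset.set0 by rewrite -card_gt0 cS.
have [l lS leaf] := leaf_ex S0.
have [d [d0 dsym]] := IH (S :\ l) ltac:(by have := cardsD1 l S; rewrite lS cS => -[]).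
have [[p /and3P[pS pl hp]]|no] := pselect (exists p, [&& p \in S, p != l & A l p != 0]).
  pose dl := d p * (A p l)%:~R / (A l p)%:~R.
  have hlp : A l p < 0 by rewrite lt_neqAle hp GCM_off // eq_sym.
  have hpl : A p l < 0.
    by rewrite lt_neqAle GCM_off // andbT; apply: contra_neq hp => /GCM_zero.
  have sym_l j : j \in S -> j != l -> dl * (A l j)%:~R = d j * (A j l)%:~R.
    move=> jS jl; have [e|h] := eqVneq (A l j) 0.
      by rewrite e (GCM_zero e) !mulr0.
    by rewrite (leaf j p) // /dl mulfVK // intr_eq0.
  exists (fun i => if i == l then dl else d i); split=> [i|i j iS jS].
    case: ifP => // _; rewrite /dl -mulrA pmulr_rgt0 // nmulr_rgt0 ?ltrz0 //.
    by rewrite invr_lt0 ltrz0.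
  case: eqVneq => [->|il]; case: eqVneq => [->|jl] //; first exact: sym_l.
    by rewrite sym_l.
  by apply: dsym; rewrite !inE ?il ?jl.
exists d; split=> // i j iS jS.
have z j' : j' \in S -> j' != l -> A l j' = 0.
  by move=> jS' jl; apply/eqP; apply: contraT => h; case: no; exists j'; rewrite jS' jl.
case: (eqVneq i l) => [->|il]; case: (eqVneq j l) => [->|jl] //.
- by rewrite (z j) // (GCM_zero (z j jS jl)) !mulr0.
- by rewrite (z i) // (GCM_zero (z i iS il)) !mulr0.
by apply: dsym; rewrite !inE ?il ?jl.
Qed.

Lemma symmetrizer_ex : exists d : 'I_n -> rat, (forall i, 0 < d i) /\
    (forall i j, d i * (A i j)%:~R = d j * (A j i)%:~R).
Proof.
have [d [d0 h]] := symmetrizer_on (erefl #|finset.setT : {set 'I_n}|).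
by exists d; split=> // i j; apply: h; rewrite finset.in_setT.
Qed.

Variable d : 'I_n -> rat.
Hypothesis d_gt0 : forall i, 0 < d i.
Hypothesis d_sym : forall i j, d i * (A i j)%:~R = d j * (A j i)%:~R.

(** After substituting v_i = u_i w_i, the form has matrix H with nonpositive off-diagonal entries
    and positive row sums. The estimate w_i w_j <= (w_i^2 + w_j^2) / 2 then bounds it below by the
    row sums times w_i^2. The explicit bound also yields the finiteness of the root system. *)
Lemma form_lower_bound : exists c : 'I_n -> rat, (forall i, 0 < c i) /\
  forall v : 'I_n -> rat, \sum_(i < n) c i * v i ^+ 2 <=
    \sum_(i < n) \sum_(j < n) v i * (d i * (A i j)%:~R) * v j.
Proof.
exists (fun i => d i * (\sum_(j < n) (A i j)%:~R * u j) / u i); split=> [i|v].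
  by rewrite divr_gt0 ?mulr_gt0.
pose w i := v i / u i.
have vE i : v i = w i * u i by rewrite /w divfK // gt_eqF.
pose H i j := d i * (A i j)%:~R * u i * u j.
have Hsym i j : H i j = H j i.
  by rewrite /H d_sym -!mulrA (mulrC (u i)).
have -> : \sum_(i < n) d i * (\sum_(j < n) (A i j)%:~R * u j) / u i * v i ^+ 2 =
    \sum_(i < n) \sum_(j < n) H i j * ((w i ^+ 2 + w j ^+ 2) / 2).
  have -> : \sum_(i < n) \sum_(j < n) H i j * ((w i ^+ 2 + w j ^+ 2) / 2) =
      \sum_(i < n) \sum_(j < n) H i j * w i ^+ 2 / 2 +
      \sum_(i < n) \sum_(j < n) H i j * w j ^+ 2 / 2.
    rewrite -big_split /=; apply: eq_bigr => i _.
    by rewrite -big_split /=; apply: eq_bigr => j _; ring.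
  rewrite [X in _ = _ + X]exchange_big /= -big_split /=; apply: eq_bigr => i _.
  rewrite -big_split /= mulr_sumr !mulr_suml; apply: eq_bigr => j _.
  by rewrite (Hsym j i) vE /H; field; rewrite gt_eqF.
apply: ler_sum => i _; apply: ler_sum => j _.
have -> : v i * (d i * (A i j)%:~R) * v j = H i j * (w i * w j).
  by rewrite !vE /H; ring.
have [->|ij] := eqVneq i j; first by rewrite le_eqVlt; apply/orP; left; apply/eqP; field.
apply: ler_wnM2l; last by have := sqr_ge0 (w i - w j); nra.
by rewrite /H -!mulrA pmulr_rle0 // pmulr_lle0 ?mulr_gt0 // lerz0 GCM_off.
Qed.

End Symmetrizer.

(** * Finite root systems *)

Lemma coroot_spec N (M : GCM N) b : is_real_root M b ->
  exists (w : seq 'I_N) (j : 'I_N),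
    wact M w (evec j) = b /\ wcact M w (evec j) = coroot M b.
Proof.
case=> w [j wj]; apply: (epsilon_spec (inhabits (0 : ivec N)) (fun c =>
  exists w j, wact M w (evec j) = b /\ wcact M w (evec j) = c)).
by exists (wcact M w (evec j)), w, j.
Qed.

(** Simple reflections preserve the proportionality between a coroot vector and the root vector
    scaled by d. This makes the dual root 2 b / (b, b), a formula independent of the word chosen in
    [coroot]. *)
Lemma wcact_symmetrized N (M : GCM N) (d : 'I_N -> rat) (t : rat) w (c m : ivec N) :
  (forall i j, d i * (M i j)%:~R = d j * (M j i)%:~R) ->
  (forall l, (c l)%:~R * t = d l * (m l)%:~R) ->
  forall l, (wcact M w c l)%:~R * t = d l * (wact M w m l)%:~R.
Proof.
move=> sym; elim: w => // j w IH h l.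
rewrite /= /scref /sref !ffunE /=; case: eqP => [->|_]; last by rewrite !subr0 IH.
have {}IH := IH h; rewrite !rmorphB /= mulrBl mulrBr IH; congr (_ - _).
rewrite /cr_pair /rt_pair !rmorph_sum /= mulr_suml mulr_sumr.
apply: eq_bigr => k _; rewrite !rmorphM /= mulrAC IH mulrAC sym; ring.
Qed.

Section FiniteRoots.

Variables (n : nat) (A : GCM n) (d : 'I_n -> rat).

Definition rform (u v : 'rV[rat]_n) : rat :=
  \sum_(i < n) \sum_(j < n) u 0 i * (d i * (A i j)%:~R) * v 0 j.
Definition ratv (b : ivec n) : 'rV[rat]_n := \row_i (b i)%:~R.
Definition al (j : 'I_n) : 'rV[rat]_n := ratv (evec j).
Definition vact (w : seq 'I_n) (v : 'rV[rat]_n) : 'rV[rat]_n :=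
  foldr (fun j => hrefl rform (al j)) v w.

Record cartan_form : Prop := CartanForm {
  cf_GCM : is_GCM A;
  cf_gt0 : forall i, 0 < d i;
  cf_sym : forall i j, d i * (A i j)%:~R = d j * (A j i)%:~R;
  cf_lower : exists c : 'I_n -> rat, (forall i, 0 < c i) /\
    forall v : 'rV_n, \sum_(i < n) c i * v 0 i ^+ 2 <= rform v v }.

Hypothesis CF : cartan_form.
Let GCM_A := cf_GCM CF.
Let d_gt0 := cf_gt0 CF.
Let d_sym := cf_sym CF.
Let rform_lower := cf_lower CF.

Lemma rform_bilin : symmetric_bilinear rform.
Proof.
split=> [u v w|c u w|u v].
- rewrite /rform -big_split; apply: eq_bigr => i _; rewrite -big_split.
  by apply: eq_bigr => j _; rewrite mxE !mulrDl.
- rewrite /rform mulr_sumr; apply: eq_bigr => i _; rewrite mulr_sumr.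
  by apply: eq_bigr => j _; rewrite mxE !mulrA.
rewrite /rform exchange_big; apply: eq_bigr => i _; apply: eq_bigr => j _.
by rewrite d_sym; ring.
Qed.
Let RB := rform_bilin.
Let fZl := sb_Zl RB.
Let fC := sb_C RB.

Lemma rform_gt0 v : v != 0 -> 0 < rform v v.
Proof.
move=> v0; have [c [c0 h]] := rform_lower; apply: lt_le_trans (h v).
have [i vi] : exists i, v 0 i != 0.
  apply: contrapT => no; move/eqP: v0; apply; apply/rowP => i; rewrite mxE.
  by apply/eqP; apply: contraT => vi; case: no; exists i.
rewrite (bigD1 i) //=; apply: ltr_wpDr.
  by apply: sumr_ge0 => j _; rewrite mulr_ge0 ?sqr_ge0 // ltW.
by rewrite mulr_gt0 // lt_neqAle eq_sym sqrf_eq0 vi sqr_ge0.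
Qed.

Lemma rform_ge0 v : 0 <= rform v v.
Proof.
have [->|/rform_gt0/ltW //] := eqVneq v 0; by rewrite (ip0l RB).
Qed.

Lemma ratv_inj : injective ratv.
Proof.
move=> a b /rowP h; apply/ffunP => i; have := h i; rewrite !mxE => /eqP.
by rewrite eqr_int => /eqP.
Qed.

Lemma al_coef i j : al j 0 i = (i == j)%:R.
Proof. by rewrite mxE ffunE; case: eqP. Qed.

Lemma rform_al v j : rform v (al j) = d j * \sum_(i < n) (A j i)%:~R * v 0 i.
Proof.
rewrite /rform mulr_sumr; apply: eq_bigr => i _.
rewrite (bigD1 j) //= big1 ?addr0 => [|k kj]; rewrite al_coef.
  by rewrite eqxx mulr1 d_sym; ring.
by rewrite (negbTE kj) mulr0.
Qed.

Lemma rform_al_al j : rform (al j) (al j) = 2 * d j.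
Proof.
rewrite rform_al (bigD1 j) //= big1 ?addr0 => [|k kj]; rewrite al_coef.
  by rewrite eqxx (GCM_diag GCM_A) mulr1 mulrC.
by rewrite (negbTE kj) mulr0.
Qed.

Lemma al_norm j : 0 < rform (al j) (al j).
Proof. by rewrite rform_al_al mulr_gt0. Qed.

Lemma copair_al v j : copair rform v (al j) = \sum_(i < n) (A j i)%:~R * v 0 i.
Proof. by rewrite /copair rform_al rform_al_al; field; rewrite gt_eqF. Qed.

Lemma rform_coord u v : rform u v = \sum_(i < n) v 0 i * rform u (al i).
Proof.
rewrite fC {1}/rform; apply: eq_bigr => i _.
by rewrite rform_al !mulr_sumr; apply: eq_bigr => j _; ring.
Qed.

Lemma rt_pairE m j : (rt_pair A m j)%:~R = copair rform (ratv m) (al j).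
Proof.
rewrite copair_al /rt_pair rmorph_sum; apply: eq_bigr => i _.
by rewrite rmorphM mulrC mxE.
Qed.

Lemma ratv_sref j m : ratv (sref A j m) = hrefl rform (al j) (ratv m).
Proof.
apply/rowP => k; rewrite /hrefl !mxE -rt_pairE !ffunE rmorphB.
by case: eqP => _; rewrite ?mulr1 ?mulr0.
Qed.

Lemma ratv_wact w m : ratv (wact A w m) = vact w (ratv m).
Proof. by elim: w => //= j w <-; rewrite ratv_sref. Qed.

Lemma vact_cat w1 w2 v : vact (w1 ++ w2) v = vact w1 (vact w2 v).
Proof. by rewrite /vact foldr_cat. Qed.

Lemma rform_vact w u v : rform (vact w u) (vact w v) = rform u v.
Proof. by elim: w => //= j w; rewrite (ip_hrefl RB) ?al_norm. Qed.

Lemma copair_vact w u v : copair rform (vact w u) (vact w v) = copair rform u v.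
Proof. by rewrite /copair !rform_vact. Qed.

Lemma vact_rev w : cancel (vact (rev w)) (vact w).
Proof.
elim: w => // j w IH v; rewrite rev_cons -cats1 vact_cat /= IH.
by rewrite (hreflK RB) // al_norm.
Qed.

Lemma vact_revK w : cancel (vact w) (vact (rev w)).
Proof. by move=> v; rewrite -[X in vact _ (vact X _)](revK w) vact_rev. Qed.

Lemma vactB w u v : vact w (u - v) = vact w u - vact w v.
Proof. by elim: w => //= j w ->; rewrite (hreflB RB). Qed.
Lemma vactZ w c u : vact w (c *: u) = c *: vact w u.
Proof. by elim: w => //= j w ->; rewrite (hreflZ RB). Qed.
Lemma vactN w u : vact w (- u) = - vact w u.
Proof. by rewrite -!scaleN1r vactZ. Qed.

Lemma vact_hrefl w g v :
  hrefl rform (vact w g) (vact w v) = vact w (hrefl rform g v).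
Proof. by rewrite /hrefl copair_vact vactB vactZ. Qed.

Lemma rform_vact_swap w u v : rform (vact w u) v = rform u (vact (rev w) v).
Proof. by rewrite -[in LHS](vact_rev w v) rform_vact. Qed.

Lemma real_root_norm b : is_real_root A b ->
  exists j, rform (ratv b) (ratv b) = 2 * d j.
Proof.
by case=> w [j <-]; exists j; rewrite ratv_wact rform_vact rform_al_al.
Qed.

Lemma real_root_norm_gt0 b : is_real_root A b -> 0 < rform (ratv b) (ratv b).
Proof. by case/real_root_norm => j ->; rewrite mulr_gt0. Qed.

Lemma coroot_coef b l : is_real_root A b ->
  (coroot A b l)%:~R = 2 * d l * (b l)%:~R / rform (ratv b) (ratv b).
Proof.
move=> rb; have [w [j [wb <-]]] := coroot_spec rb.
have := @wcact_symmetrized _ A d (d j) w (evec j) (evec j) d_sym.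
rewrite wb => /(_ _ l) h; rewrite -wb ratv_wact rform_vact rform_al_al wb.
have -> : 2 * d l * (b l)%:~R = 2 * (d l * (b l)%:~R) by rewrite mulrA.
rewrite -h; first by field; rewrite gt_eqF.
by move=> k; rewrite ffunE; case: eqP => [->|_]; ring.
Qed.

Lemma rc_pairE m b : is_real_root A b ->
  (rc_pair A m (coroot A b))%:~R = copair rform (ratv m) (ratv b).
Proof.
move=> rb; rewrite /copair rform_coord mulr_sumr mulr_suml /rc_pair rmorph_sum.
apply: eq_bigr => l _; rewrite rmorphM /= coroot_coef // rt_pairE copair_al rform_al.
by rewrite mxE; ring.
Qed.

Lemma ratv_reflr b m : is_real_root A b ->
  ratv (reflr A b m) = hrefl rform (ratv b) (ratv m).
Proof.
move=> rb; apply/rowP => k; rewrite /hrefl -rc_pairE // !mxE !ffunE.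
by rewrite rmorphB rmorphM.
Qed.

Lemma real_root_sref j b : is_real_root A b -> is_real_root A (sref A j b).
Proof. by case=> w [i <-]; exists (j :: w), i. Qed.

Lemma real_root_evec j : is_real_root A (evec j).
Proof. by exists [::], j. Qed.

Lemma real_root_reflr a b : is_real_root A a -> is_real_root A b ->
  is_real_root A (reflr A a b).
Proof.
move=> ra [w [i wb]]; have [v [j va]] := ra.
exists (v ++ j :: rev v ++ w), i; apply: ratv_inj.
rewrite ratv_reflr // -va -wb !ratv_wact vact_cat /= vact_cat.
by rewrite -{2}(vact_rev v (vact w _)) vact_hrefl.
Qed.

Lemma real_root_opp b : is_real_root A b -> is_real_root A (- b).
Proof.
move=> rb; have -> : - b = reflr A b b.
  apply: ratv_inj; rewrite ratv_reflr // hrefl_self ?real_root_norm_gt0 //.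
  by apply/rowP => k; rewrite !mxE ffunE rmorphN.
exact: real_root_reflr.
Qed.

Lemma rform_CS u v : rform u v ^+ 2 <= rform u u * rform v v.
Proof.
have [->|v0] := eqVneq v 0.
  by rewrite fC (ip0l RB) expr0n /= (ip0l RB) mulr0.
have h := rform_gt0 v0.
have := rform_ge0 (rform v v *: u - rform u v *: v).
rewrite !(ipBl RB, ipBr RB, fZl, ipZr RB) (fC v u).
set X := rform u u; set Y := rform v v; set Z := rform u v => E.
have : 0 <= Y * (X * Y - Z ^+ 2).
  by apply: le_trans E _; rewrite le_eqVlt; apply/orP; left; apply/eqP; ring.
by rewrite pmulr_rge0 // subr_ge0.
Qed.

Lemma rform_CS_eq u v : v != 0 -> rform u v ^+ 2 = rform u u * rform v v ->
  u = (rform u v / rform v v) *: v.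
Proof.
move=> v0 E; have h := rform_gt0 v0; apply/eqP; rewrite -subr_eq0.
apply: contraT => /rform_gt0.
rewrite !(ipBl RB, ipBr RB, fZl, ipZr RB) (fC v u).
have E' : rform u u = rform u v ^+ 2 / rform v v by rewrite E mulfK // gt_eqF.
rewrite E'; set Y := rform v v in h *; set Z := rform u v.
have -> : Z ^+ 2 / Y - Z / Y * Z - (Z / Y * Z - Z / Y * (Z / Y * Y)) = 0.
  by field; rewrite gt_eqF.
by rewrite ltxx.
Qed.

(* Otherwise both pairings of g and alpha_j are at most -2, the coroot of g
   having integer coefficients, against Cauchy-Schwarz. *)
Lemma real_root_not_mixed g j i : is_real_root A g ->
  (forall k, k != j -> 0 <= g k) -> g j < 0 -> i != j -> g i = 0.
Proof.
move=> rg gk gj ij; have ng := real_root_norm_gt0 rg; have nj := al_norm j.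
have dj := d_gt0 j.
set G := rform (ratv g) (ratv g) in ng.
have offA k : k != j -> (A j k)%:~R * (g k)%:~R <= 0 :> rat.
  move=> kj; rewrite -rmorphM lerz0 /= mulr_le0_ge0 ?gk //.
  by apply: (GCM_off GCM_A); rewrite eq_sym.
have pE : rform (ratv g) (al j) <= 2 * d j * (g j)%:~R.
  rewrite rform_al (bigD1 j) //= (GCM_diag GCM_A) mxE mulrDr mulrA (mulrC (d j) 2).
  rewrite gerDl pmulr_rle0 //; apply: sumr_le0 => k kj; rewrite mxE; exact: offA.
have g1 : (g j)%:~R <= -1 :> rat by rewrite -(rmorphN1 intr) ler_int; lia.
have c1 : 2 * d j * (g j)%:~R / G <= -1.
  rewrite -coroot_coef // -(rmorphN1 intr) ler_int.
  have : (coroot A g j)%:~R < 0 :> rat.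
    by rewrite coroot_coef // pmulr_llt0 ?invr_gt0 // pmulr_rlt0 ?ltrz0 // mulr_gt0.
  by rewrite ltrz0; lia.
have c2 : 2 * d j * (g j)%:~R <= - G by rewrite ler_pdivrMr // mulN1r in c1.
have CS := rform_CS (ratv g) (al j); rewrite rform_al_al -/G in CS.
have p1 : rform (ratv g) (al j) <= - G := le_trans pE c2.
have p2 : rform (ratv g) (al j) <= - (2 * d j)
  by apply: le_trans pE _; rewrite -[leRHS]mulrN1 ler_pM2l ?mulr_gt0.
have EQ : rform (ratv g) (al j) ^+ 2 = G * (2 * d j).
  apply/eqP; rewrite eq_le CS /= -sqrrN expr2.
  by apply: ler_pM; rewrite ?(ltW ng) ?mulr_ge0 ?(ltW dj) // lerNr.
rewrite -rform_al_al in EQ.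
have aj0 : al j != 0 by apply: contraTneq nj => ->; rewrite (ip0l RB) ltxx.
have /rowP/(_ i) := rform_CS_eq aj0 EQ.
rewrite !mxE ffunE (negbTE ij) mulr0 => /eqP.
by rewrite intr_eq0 => /eqP.
Qed.

(** The dual root of c alpha_j is alpha_j^vee / c; as c and 1 / c are both integers, c is 1 or
    -1. *)
Lemma real_root_multiple g j : is_real_root A g -> (forall i, i != j -> g i = 0) ->
  g = evec j \/ g = - evec j.
Proof.
move=> rg z; have gE : ratv g = (g j)%:~R *: al j.
  apply/rowP => k; rewrite !mxE ffunE; case: eqP => [->|/eqP kj]; rewrite ?mulr1 //.
  by rewrite z // mulr0.
have ng := real_root_norm_gt0 rg; have := coroot_coef j rg.
rewrite gE fZl (ipZr RB) rform_al_al => e.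
have gj0 : (g j)%:~R != 0 :> rat.
  by apply: contraTneq ng => e0; rewrite gE e0 scale0r (ip0l RB) ltxx.
have {e} : (coroot A g j * g j)%:~R = 1 :> rat.
  by rewrite rmorphM /= e; field; rewrite gt_eqF.
rewrite -[1]/(1%:~R) => /eqP; rewrite eqr_int => /eqP e.
have /eqP : (`|coroot A g j| * `|g j|)%N = 1 by rewrite -abszM e.
rewrite muln_eq1 => /andP[_ /eqP g1].
have : g j = 1 \/ g j = -1 by lia.
by case=> e1; [left|right]; apply/ffunP => k; rewrite !ffunE;
  case: eqP => [->|/eqP kj]; rewrite ?e1 // z ?oppr0.
Qed.

Lemma pos_root_sref b j : is_real_root A b -> is_pos b -> b != evec j ->
  is_pos (sref A j b).
Proof.
move=> rb pb ne k; have rs := real_root_sref j rb.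
have off i : i != j -> sref A j b i = b i by move=> ij; rewrite ffunE (negbTE ij) subr0.
have [->|kj] := eqVneq k j; last by rewrite off.
rewrite leNgt; apply/negP => neg.
have z i : i != j -> b i = 0.
  by move=> ij; rewrite -off //; apply: (real_root_not_mixed rs) neg ij => // l lj; rewrite off.
case: (real_root_multiple rb z) => e; first by rewrite e eqxx in ne.
by have := pb j; rewrite e !ffunE eqxx.
Qed.

Lemma evec_pos (j : 'I_n) : is_pos (evec j).
Proof. by move=> k; rewrite ffunE; case: eqP. Qed.

Lemma sref_opp j b : sref A j (- b) = - sref A j b.
Proof.
apply: ratv_inj; have E m : ratv (- m) = - ratv m.
  by apply/rowP => k; rewrite !mxE ffunE rmorphN.
by rewrite E !ratv_sref E (hrefl_opp RB).
Qed.

Lemma sref_evec (j : 'I_n) : sref A j (evec j) = - evec j.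
Proof.
apply: ratv_inj; rewrite ratv_sref hrefl_self ?al_norm //.
by apply/rowP => k; rewrite !mxE !ffunE rmorphN.
Qed.

Lemma real_root_sign b : is_real_root A b -> is_pos b \/ is_pos (- b).
Proof.
case=> w [i <-]; elim: w => [|j w IH]; first by left; apply: evec_pos.
set b' := wact A w (evec i) in IH *; have rb : is_real_root A b' by exists w, i.
rewrite -[wact A (j :: w) _]/(sref A j b') -sref_opp.
have rN := real_root_opp rb.
case: IH => p.
- have [->|ne] := eqVneq b' (evec j); last by left; apply: pos_root_sref.
  by right; rewrite sref_opp sref_evec opprK; apply: evec_pos.
- have [e|ne] := eqVneq (- b') (evec j); last by right; apply: pos_root_sref.
  left; rewrite -[b']opprK e sref_opp sref_evec opprK; exact: evec_pos.
Qed.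

(** Real roots have norm 2 d_j for some j, so [cf_lower] bounds every coordinate; the roots are
    filtered out of a finite box of integer vectors. *)
Lemma real_roots_finite : exists P : seq (ivec n),
  uniq P /\ forall b, b \in P <-> is_real_root A b.
Proof.
have [c [c0 lower]] := rform_lower.
pose M := \sum_(j < n) 2 * d j.
pose K := \sum_(i < n) `|Num.ceil (M / c i)|%N.
have bound b i : is_real_root A b -> (`|b i| <= K)%N.
  move=> rb; have [j nb] := real_root_norm rb.
  have le1 : c i * (b i)%:~R ^+ 2 <= M.
    apply: le_trans (_ : rform (ratv b) (ratv b) <= _).
      apply: le_trans (lower _); rewrite (bigD1 i) //= mxE lerDl.
      by apply: sumr_ge0 => k _; rewrite mulr_ge0 ?sqr_ge0 // ltW.
    rewrite nb /M (bigD1 j) //= lerDl; apply: sumr_ge0 => k _.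
    by rewrite mulr_ge0 // ltW.
  have le2 : (b i ^+ 2)%:~R <= M / c i.
    by rewrite ler_pdivlMr // rmorphXn mulrC.
  have le3 : b i ^+ 2 <= Num.ceil (M / c i).
    by rewrite -(ler_int rat); apply: le_trans le2 (ceil_ge _).
  apply: leq_trans (_ : `|Num.ceil (M / c i)| <= _)%N; last first.
    by rewrite /K (bigD1 i) //= leq_addr.
  by move: le3; rewrite expr2; move: (Num.ceil _) => z; nia.
pose toZ (f : {ffun 'I_n -> 'I_(K + K).+1}) : ivec n := [ffun i => (f i)%:Z - K%:Z].
have inj : injective toZ.
  move=> f g /ffunP h; apply/ffunP => i; apply: val_inj.
  by have := h i; rewrite !ffunE => /addIr [].
exists [seq b <- map toZ (enum {: {ffun 'I_n -> 'I_(K + K).+1}}) | `[< is_real_root A b >]].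
split; first by rewrite filter_uniq // map_inj_uniq // enum_uniq.
move=> b; rewrite mem_filter; split=> [/andP[/asboolP] //|rb].
apply/andP; split; first exact/asboolP.
apply/mapP; exists [ffun i => inord (absz (b i + K%:Z))]; first by rewrite mem_enum.
have shift (z : int) (k : nat) : (absz z <= k)%N ->
    (absz (z + k%:Z)%R < (k + k).+1)%N /\ z = (absz (z + k%:Z))%:Z - k%:Z by lia.
apply/ffunP => i; have [lt e] := shift _ _ (bound b i rb).
by rewrite !ffunE inordK.
Qed.

End FiniteRoots.

(** * The highest root and the affine root system *)

Lemma seq_argmax (T : eqType) (f : T -> int) (P : seq T) (Q : pred T) :
  (exists2 a, a \in P & Q a) ->
  exists b, [/\ b \in P, Q b & forall c, c \in P -> Q c -> f c <= f b].
Proof.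
elim: P => [|x P IH] [a aP Qa]; first by [].
have [[a' a'P Qa']|no] := pselect (exists2 a, a \in P & Q a).
  have [b [bP Qb bmax]] := IH (ex_intro2 _ _ a' a'P Qa').
  have [/andP[Qx lt]|nx] := boolP (Q x && (f b < f x)).
    exists x; split; rewrite ?inE ?eqxx // => c; rewrite inE => /orP[/eqP->//|cP] Qc.
    exact: le_trans (bmax c cP Qc) (ltW lt).
  exists b; split; rewrite ?inE ?bP ?orbT // => c; rewrite inE => /orP[/eqP->|cP] Qc.
    by move: nx; rewrite Qc /= -leNgt.
  exact: bmax.
exists a; split=> // c; rewrite inE => /orP[/eqP ->|cP] Qc.
  move: aP; rewrite inE => /orP[/eqP -> //|aP]; by case: no; exists a.
by case: no; exists c.
Qed.

Section HighestRoot.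

Variables (n : nat) (A : GCM n) (d : 'I_n -> rat).
Hypothesis CF : cartan_form A d.
Variable P : seq (ivec n).
Hypothesis P_uniq : uniq P.
Hypothesis P_root : forall b, b \in P <-> is_real_root A b.
Hypothesis indec : indecomposable A.
Hypothesis n_gt0 : (0 < n)%N.

Local Notation B := (rform A d).
Let RB := rform_bilin CF.

Lemma root_copair_int a b : is_real_root A b ->
  copair B (ratv a) (ratv b) \is a Num.int.
Proof. by move=> rb; rewrite -(rc_pairE CF) // intr_int. Qed.

Lemma ratvN (b : ivec n) : ratv (- b) = - ratv b.
Proof. by apply/rowP => k; rewrite !mxE ffunE rmorphN. Qed.

Definition height (b : ivec n) : int := \sum_(i < n) b i.

Lemma height_sref j b : height (sref A j b) = height b - rt_pair A b j.
Proof.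
rewrite /height (eq_bigr (fun i => b i - if i == j then rt_pair A b j else 0)).
  by rewrite sumrB -big_mkcond big_pred1_eq.
by move=> i _; rewrite ffunE.
Qed.

(** A negative pairing with alpha_i would make s_i b higher than b. The reflection only raises
    coordinates, so it stays in [Q], which below is either everything or the set of vectors above a
    given root. *)
Lemma maximal_root_dominant (b : ivec n) (Q : pred (ivec n)) :
  (forall c : ivec n, (forall k, b k <= c k) -> Q c) -> is_real_root A b ->
  (forall c, c \in P -> Q c -> height c <= height b) ->
  forall i, 0 <= rt_pair A b i.
Proof.
move=> Qup rb bmax i; rewrite leNgt; apply/negP => lt.
have := bmax (sref A i b) _ _; rewrite height_sref.
have h1 : sref A i b \in P by apply/P_root/real_root_sref.
have h2 : Q (sref A i b).
  by apply: Qup => k; rewrite ffunE; case: eqP => _; lia.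
by move/(_ h1 h2); lia.
Qed.

Lemma dominant_form_ge0 b (v : 'rV_n) : (forall i, 0 <= rt_pair A b i) ->
  (forall i, 0 <= v 0 i) -> 0 <= B (ratv b) v.
Proof.
move=> dom v0; rewrite (rform_coord CF); apply: sumr_ge0 => i _.
rewrite mulr_ge0 // -sgr_ge0 -(sgr_copair _ (al_norm CF i)) sgr_ge0.
by rewrite -(rt_pairE CF) ler0z.
Qed.

Lemma height_le (a b : ivec n) : (forall k, a k <= b k) -> height b <= height a ->
  a = b.
Proof.
move=> ab; rewrite -subr_le0 /height -sumrB => h; apply/ffunP => k.
apply/eqP; rewrite eq_sym -subr_eq0; move: h; rewrite le_eqVlt ltNge.
rewrite sumr_ge0 ?orbF; last by move=> i _; rewrite subr_ge0.
by rewrite psumr_eq0 => [/allP/(_ k)|i _]; rewrite ?mem_index_enum ?subr_ge0 //=; apply.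
Qed.

(** A root t of maximal height is dominant, and indecomposability gives it full support. Among the
    roots above a given g, one of maximal height b is dominant too, so (b, t) > 0; this forces b =
    t. *)
Lemma highest_root_ex : exists t, [/\ is_real_root A t, forall i, 0 <= rt_pair A t i &
  forall g, is_real_root A g -> forall k, g k <= t k].
Proof.
have i0 : 'I_n by exact: Ordinal n_gt0.
have [|t [tP _ tmax]] := @seq_argmax _ height P predT.
  by exists (evec i0) => //; apply/P_root/real_root_evec.
have rt : is_real_root A t by apply/P_root.
have tdom := maximal_root_dominant (Q := predT) (fun _ _ => isT) rt tmax.
have tpos : is_pos t.
  have [//|tneg] := real_root_sign CF rt.
  have := tmax (evec i0) ltac:(exact/P_root/real_root_evec) isT.
  have : height t <= 0 by apply: sumr_le0 => i _; have := tneg i; rewrite ffunE oppr_ge0.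
  have -> : height (evec i0) = 1.
    rewrite /height (bigD1 i0) //= big1 ?addr0 ?ffunE ?eqxx // => i ne.
    by rewrite ffunE (negbTE ne).
  by lia.
have tsupp i : 0 < t i.
  pose S := [set j : 'I_n | t j != 0].
  have [SI|SN] := ltnP #|S| n; last first.
    have /eqP ST : S == finset.setT by rewrite eqEcard finset.subsetT cardsT card_ord.
    have : i \in S by rewrite ST finset.in_setT.
    by rewrite inE lt_neqAle eq_sym (tpos i) => ->.
  have S0 : (0 < #|S|)%N.
    rewrite card_gt0; apply: contraTneq (real_root_norm_gt0 CF rt) => S0.
    have -> : ratv t = 0.
      apply/rowP => k; rewrite !mxE; apply/eqP; rewrite intr_eq0.
      apply: contraT => tk; suff : k \in S by rewrite S0 inE.
      by rewrite inE.
    by rewrite (ip0l RB) ltxx.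
  have [k [l [kS lS Akl]]] := indec S0 SI.
  have := tdom l; rewrite leNgt => /negP[].
  have tl : t l = 0 by move: lS; rewrite inE negbK => /eqP.
  have kl : k != l by apply: contraNneq lS => <-.
  have Alk : A l k < 0.
    have lk : l != k by rewrite eq_sym.
    rewrite lt_neqAle (GCM_off (cf_GCM CF) lk) andbT.
    by apply: contra_neq Akl; apply: (GCM_zero (cf_GCM CF)).
  rewrite /rt_pair (bigD1 k) //= -[ltRHS]addr0; apply: ltr_leD.
    rewrite pmulr_rlt0 // lt_neqAle eq_sym (tpos k) andbT.
    by move: kS; rewrite inE.
  apply: sumr_le0 => j _; have [->|jl] := eqVneq j l; first by rewrite tl mul0r.
  by apply: mulr_ge0_le0; rewrite ?tpos // (GCM_off (cf_GCM CF)) // eq_sym.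
exists t; split=> // g rg.
pose Q := [pred b : ivec n | [forall k, g k <= b k]].
have [|b [bP Qb bmax]] := @seq_argmax _ height P Q.
  by exists g; [exact/P_root | apply/forallP].
have rb : is_real_root A b by apply/P_root.
have gb : forall k, g k <= b k by apply/forallP.
suff -> : t = b by [].
have bdom : forall i, 0 <= rt_pair A b i.
  apply: (maximal_root_dominant (Q := Q)) => // c bc.
  by apply/forallP => k; apply: le_trans (gb k) (bc k).
have bt : 0 < B (ratv b) (ratv t).
  have := real_root_norm_gt0 CF rb; rewrite (rform_coord CF).
  move=> pos; have [i hi] : exists i, B (ratv b) (al i) != 0.
    apply: contrapT => no; move: pos; rewrite big1 ?ltxx // => i _.
    suff -> : B (ratv b) (al i) = 0 by rewrite mulr0.
    by apply/eqP; apply: contraT => hi; case: no; exists i.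
  have ge0 j : 0 <= B (ratv b) (al j).
    by apply: dominant_form_ge0 => // k; rewrite al_coef.
  rewrite (rform_coord CF) (bigD1 i) //=; apply: ltr_wpDr.
    by apply: sumr_ge0 => j _; rewrite mulr_ge0 // mxE ler0z ltW.
  by rewrite mulr_gt0 ?mxE ?ltr0z // lt_neqAle eq_sym hi ge0.
have nb := real_root_norm_gt0 CF rb; have nt := real_root_norm_gt0 CF rt.
have Phi_sub a c : is_real_root A a -> is_real_root A c ->
    copair B (ratv c) (ratv a) = 1 -> is_real_root A (c - a).
  move=> ra rc e; have -> : c - a = reflr A a c; last exact: (real_root_reflr CF).
  apply: ratv_inj; rewrite (ratv_reflr CF) // /hrefl e scale1r.
  by apply/rowP => k; rewrite !mxE !ffunE rmorphB.
(* If t - b is a root, its sign makes t and b comparable, and each is of maximal height in a class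
   then containing the other. *)
have close : is_real_root A (t - b) -> t = b.
  move=> /(real_root_sign CF)[] pos.
    have le k : b k <= t k by have := pos k; rewrite !ffunE subr_ge0.
    apply/esym/height_le => //; apply: bmax; first exact/P_root.
    by apply/forallP => k; apply: le_trans (gb k) (le k).
  have le k : t k <= b k by have := pos k; rewrite !ffunE opprB subr_ge0.
  by apply: height_le => //; apply: tmax.
have p0 : 0 < copair B (ratv b) (ratv t) by rewrite copair_gt0.
have q0 : 0 < copair B (ratv t) (ratv b) by rewrite copair_gt0 // (sb_C RB).
have [e|/eqP pN] := eqVneq (copair B (ratv b) (ratv t)) 1.
  by apply: close; rewrite -opprB; apply/(real_root_opp CF)/Phi_sub.
have [e|/eqP qN] := eqVneq (copair B (ratv t) (ratv b)) 1; first exact/close/Phi_sub.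
have ge2 q : q \is a Num.int -> 0 < q -> q <> 1 -> 2 <= q :> rat.
  move=> /intrP[z ->]; rewrite ltr0z -[2]/(2%:~R) ler_int -[1]/(1%:~R) => h1 h2.
  have z1 : z <> 1 by move=> ez; apply: h2; rewrite ez.
  by lia.
(* When both pairings are at least 2, (b, t) is at least (t, t) and (b, b), so t - b has norm at
   most 0. *)
have p2 := ge2 _ (root_copair_int b rt) p0 pN.
have q2 := ge2 _ (root_copair_int t rb) q0 qN.
move: p2 q2; rewrite /copair !ler_pdivlMr // !ler_pM2l // (sb_C RB (ratv t)) => h1 h2.
apply: ratv_inj; apply/eqP; rewrite -subr_eq0; apply: contraT => /(rform_gt0 CF).
rewrite !(ipBl RB, ipBr RB) (sb_C RB (ratv t) (ratv b)); lra.
Qed.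

(** * Pairings with the highest root *)

Local Notation theta := (highest_root A).
Local Notation th := (ratv theta).

Lemma theta_max_spec : is_real_root A theta /\
  forall g, is_real_root A g -> forall k, g k <= theta k.
Proof.
have [t [rt _ tmax]] := highest_root_ex.
by apply: (epsilon_spec (inhabits (0 : ivec n)) (fun t => is_real_root A t /\
  forall g, is_real_root A g -> forall k, g k <= t k)); exists t.
Qed.

Lemma theta_root : is_real_root A theta. Proof. by have [] := theta_max_spec. Qed.
Lemma theta_max g k : is_real_root A g -> g k <= theta k.
Proof. by have [_ h] := theta_max_spec => /h. Qed.

Lemma theta_dominant i : 0 <= rt_pair A theta i.
Proof.
have [t [rt tdom tmax]] := highest_root_ex.
suff -> : theta = t by [].
by apply/ffunP => k; apply/eqP; rewrite eq_le tmax ?theta_max //; apply: theta_root.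
Qed.

Lemma theta_pos : is_pos theta.
Proof. by move=> k; apply: le_trans (theta_max k (real_root_evec A k)); rewrite ffunE eqxx. Qed.

Lemma theta_norm : 0 < B th th. Proof. exact: (real_root_norm_gt0 CF theta_root). Qed.

Lemma theta_copair b : is_real_root A b -> is_pos b -> b != theta ->
  copair B (ratv b) th = 0 \/ copair B (ratv b) th = 1.
Proof.
move=> rb pb ne.
have ge0 : 0 <= copair B (ratv b) th.
  rewrite -sgr_ge0 sgr_copair ?theta_norm // sgr_ge0 (sb_C RB).
  by apply: dominant_form_ge0 => [i|i]; [exact: theta_dominant | rewrite mxE ler0z].
have /intrP[z ez] := root_copair_int b theta_root; rewrite ez ler0z in ge0 *.
have [z1|z2] := leP z 1; first by have [->|->] : z = 0 \/ z = 1 by [lia]; [left|right].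
(* If z >= 2, the root -r_theta b = z theta - b lies below theta, so (z - 1) theta <= b <= theta
   coordinatewise and b = theta. *)
case/eqP: ne; apply/ffunP => k.
have rr : is_real_root A (- reflr A theta b).
  by apply/(real_root_opp CF)/(real_root_reflr CF) => //; apply: theta_root.
have := theta_max k rr; have := theta_max k rb; have := theta_pos k.
rewrite !ffunE.
have -> : rc_pair A b (coroot A theta) = z.
  by apply/eqP; rewrite -(eqr_int rat) (rc_pairE CF) ?ez //; apply: theta_root.
move: (theta k) (b k) => t x t0 xt; nia.
Qed.

Lemma theta_copair_cases b : is_real_root A b ->
  [\/ b = theta, b = - theta,
      is_pos b /\ (copair B (ratv b) th = 0 \/ copair B (ratv b) th = 1) |
      is_pos (- b) /\ (copair B (ratv b) th = 0 \/ copair B (ratv b) th = -1)].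
Proof.
move=> rb; have ratvN c : ratv (- c : ivec n) = - ratv c.
  by apply/rowP => k; rewrite !mxE ffunE rmorphN.
have [p|p] := real_root_sign CF rb.
  have [->|ne] := eqVneq b theta; first by constructor 1.
  by constructor 3; split=> //; apply: theta_copair.
have [e|ne] := eqVneq (- b) theta; first by constructor 2; rewrite -e opprK.
constructor 4; split=> //; have := theta_copair (real_root_opp CF rb) p ne.
rewrite ratvN (copairNl RB) => -[e|e]; [left|right].
  by apply/eqP; rewrite -oppr_eq0 e.
by rewrite -[LHS]opprK e.
Qed.

(** * The positive affine roots and their simple roots *)

Definition root_vecs : seq 'rV[rat]_n := map (@ratv n) P.
Definition posv (v : 'rV[rat]_n) : bool := [forall k, 0 <= v 0 k].
Definition sr (j : 'I_n.+1) : 'rV[rat]_n * rat :=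
  if unlift ord0 j is Some i then (al i, 0) else (- th, 1).
(* The height of g + k delta, as delta = alpha_0 + theta. *)
Definition aheight (b : 'rV[rat]_n * rat) : rat :=
  \sum_(i < n) b.1 0 i + b.2 * (1 + \sum_(i < n) th 0 i).

Lemma root_vecP v : reflect (exists2 b, is_real_root A b & v = ratv b) (v \in root_vecs).
Proof.
by apply: (iffP mapP) => [[b /P_root rb ->]|[b rb ->]]; exists b => //; apply/P_root.
Qed.

Lemma mem_ratv b : is_real_root A b -> ratv b \in root_vecs.
Proof. by move=> rb; apply/root_vecP; exists b. Qed.

Lemma posvP b : reflect (is_pos b) (posv (ratv b)).
Proof.
by apply: (iffP forallP) => h k; have := h k; rewrite mxE ler0z.
Qed.

Lemma root_not_both_signs b : is_real_root A b -> is_pos b -> ~ is_pos (- b).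
Proof.
move=> rb p q; have := real_root_norm_gt0 CF rb; suff -> : ratv b = 0.
  by rewrite (ip0l RB) ltxx.
apply/rowP => k; rewrite !mxE; apply/eqP; rewrite intr_eq0 eq_le p.
by have := q k; rewrite ffunE oppr_ge0 => ->.
Qed.

Lemma posvN v : v \in root_vecs -> posv (- v) = ~~ posv v.
Proof.
case/root_vecP => b rb ->; rewrite -ratvN; have [p|p] := real_root_sign CF rb.
  rewrite (introT (posvP b) p); apply/negP => /posvP.
  exact: (root_not_both_signs rb p).
rewrite (introT (posvP (- b)) p); apply/esym/negP => /posvP q.
exact: (root_not_both_signs rb q p).
Qed.

Lemma root_vecs_uniq : uniq root_vecs.
Proof. by rewrite map_inj_uniq //; apply: ratv_inj. Qed.
Lemma root_vecs_norm g : g \in root_vecs -> 0 < B g g.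
Proof. by case/root_vecP => b rb ->; apply: (real_root_norm_gt0 CF rb). Qed.
Lemma root_vecs_hrefl a g : a \in root_vecs -> g \in root_vecs ->
  hrefl B a g \in root_vecs.
Proof.
case/root_vecP => b rb ->; case/root_vecP => c rc ->.
by rewrite -(ratv_reflr CF) //; apply: mem_ratv; apply: (real_root_reflr CF).
Qed.
Lemma root_vecs_opp g : g \in root_vecs -> - g \in root_vecs.
Proof.
by case/root_vecP => b rb ->; rewrite -ratvN; apply/mem_ratv/(real_root_opp CF).
Qed.
Lemma root_vecs_int a g : a \in root_vecs -> g \in root_vecs ->
  copair B a g \is a Num.int.
Proof. by case/root_vecP => b rb ->; case/root_vecP => c rc ->; apply: root_copair_int. Qed.
Lemma al_root i : al i \in root_vecs. Proof. exact/mem_ratv/real_root_evec. Qed.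
Lemma th_root : th \in root_vecs. Proof. exact/mem_ratv/theta_root. Qed.

Lemma posv_al i : posv (al i). Proof. exact/posvP/evec_pos. Qed.
Lemma posv_th : posv th. Proof. exact/posvP/theta_pos. Qed.

Lemma posv_hrefl_al i g : g \in root_vecs -> posv g -> g != al i ->
  posv (hrefl B (al i) g).
Proof.
case/root_vecP => b rb -> /posvP pb ne; rewrite -(ratv_sref CF); apply/posvP.
by apply: (pos_root_sref CF) => //; apply: contra_neq ne => ->.
Qed.

Local Notation apos := (apos root_vecs posv).

Lemma sr_affine_pos j : apos (sr j).
Proof.
rewrite /sr; case: unliftP => [i _|_]; apply/and3P; split=> //=.
- exact: al_root.
- by rewrite posv_al.
- exact/root_vecs_opp/th_root.
Qed.

Lemma theta_coef_ge0 b k : is_real_root A b -> 0 <= (b k)%:~R + th 0 k.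
Proof.
move=> rb; rewrite mxE -rmorphD ler0z /= -[b k]opprK addrC subr_ge0.
by have := theta_max k (real_root_opp CF rb); rewrite ffunE.
Qed.

Lemma apos_coef b k : apos b -> 0 <= b.1 0 k + b.2 * th 0 k.
Proof.
case: b => g q /and3P[/= /root_vecP[b rb ->] qZ].
have tk : 0 <= th 0 k by rewrite mxE ler0z theta_pos.
case/orP => [q0|/andP[/eqP -> /posvP p]]; last by rewrite mul0r addr0 mxE ler0z.
have b0 := theta_coef_ge0 k rb; have q1 := Qint_ge1 qZ q0.
have : 0 <= (q - 1) * th 0 k by rewrite mulr_ge0 ?subr_ge0.
have -> : (ratv b, q).1 0 k = (b k)%:~R by rewrite mxE.
rewrite mulrBl mul1r /=; lra.
Qed.

Lemma apos_level_ge0 b : apos b -> 0 <= b.2.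
Proof. by case/and3P => _ _ /orP[/ltW //|/andP[/eqP -> _]]. Qed.

(** g + k delta is the sum of (g_i + k theta_i) alpha_i and k alpha_0, with nonnegative
    coefficients. As (g, g) > 0, some simple root pairs positively with g. *)
Lemma sr_ascent b : apos b -> exists j, 0 < B b.1 (sr j).1.
Proof.
move=> ab; apply: contrapT => no.
have le0 j : B b.1 (sr j).1 <= 0.
  by rewrite leNgt; apply/negP => h; apply: no; exists j.
have := root_vecs_norm (apos_root ab).
have -> : B b.1 b.1 = \sum_(i < n) (b.1 0 i + b.2 * th 0 i) * B b.1 (al i) +
    b.2 * B b.1 (- th).
  rewrite (ipNr RB) (rform_coord CF _ th) mulrN mulr_sumr.
  rewrite {1}(rform_coord CF) -sumrB; apply: eq_bigr => i _; ring.
rewrite ltNge => /negP; apply; rewrite -[leRHS]addr0; apply: lerD.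
  apply: sumr_le0 => i _; apply: mulr_ge0_le0; first exact: apos_coef.
  by have := le0 (lift ord0 i); rewrite /sr liftK.
apply: mulr_ge0_le0; first exact: apos_level_ge0.
by have := le0 ord0; rewrite /sr unlift_none.
Qed.

Lemma sr_arefl j b : apos b -> b != sr j -> apos (arefl B (sr j) b).
Proof.
case: b => g q ab; have [/= gP qZ sgn] := and3P ab.
rewrite /sr; case: unliftP => [i _|_] /= ne.
  apply/and3P; rewrite /arefl /= mulr0 subr0; split=> //.
    exact: root_vecs_hrefl (al_root i) gP.
  move: sgn => /orP[->//|/andP[/eqP q0 pg]]; rewrite q0 eqxx ltxx /=.
  apply: (posv_hrefl_al gP pg); apply: contraNneq ne => ->.
  by rewrite q0 eqxx.
apply/and3P; rewrite /arefl /acopair /= mulr1 (copairNr RB) opprK (hreflN RB).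
split=> //; first by apply: root_vecs_hrefl; rewrite ?th_root.
  by rewrite rpredD // root_vecs_int ?th_root.
case/root_vecP: gP ne sgn ab => b rb -> ne sgn ab.
have tt := copair_refl theta_norm.
(* Under r_0 the level q becomes q + <b, theta^vee>. It can drop by 2 only for b = -theta, where q =
   1 is alpha_0 itself and q = 2 ends at theta in level 0; a drop by 1 to level 0 ends at b + theta,
   whose coefficients are nonnegative. *)
case: (theta_copair_cases rb) => [e|e|[pb e]|[nb e]].
- rewrite e tt; apply/orP; left; have := apos_level_ge0 ab => /=; lra.
- move: ne; rewrite e ratvN (copairNl RB) tt (hrefl_opp RB) hrefl_self ?theta_norm //.
  rewrite opprK posv_th andbT => ne.
  have q0 : 0 < q.
    move: sgn; rewrite e => /orP[//|/andP[_ /posvP p]].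
    by case: (root_not_both_signs theta_root theta_pos).
  have /intrP[z ez] := qZ; move: q0 ne; rewrite ez ltr0z => z0 ne.
  have z1 : z != 1 by apply: contraNneq ne => ->.
  have : z = 2 \/ 2 < z by lia.
  case=> [->//|lt2]; apply/orP; left; rewrite subr_gt0 -[2]/(2%:~R) ltr_int //.
- have /= q0 := apos_level_ge0 ab.
  case: e => e; rewrite e; last by apply/orP; left; lra.
  rewrite addr0; move: sgn => /orP[->//|/andP[/eqP ->]].
  by rewrite eqxx ltxx /= /hrefl e scale0r subr0.
- have q0 : 0 < q.
    move: sgn => /orP[//|/andP[_ /posvP p]].
    by case: (root_not_both_signs rb p).
  case: e => e; rewrite e; first by rewrite addr0 q0.
  have := Qint_ge1 qZ q0; rewrite le_eqVlt => /orP[/eqP <-|lt1].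
    apply/orP; right; rewrite subrr eqxx /=; apply/forallP => k.
    by rewrite /hrefl e !mxE mulN1r opprK; have := theta_coef_ge0 k rb; rewrite mxE.
  by rewrite subr_gt0 lt1.
Qed.

Local Notation ninv := (ninv B root_vecs posv).
Local Notation possum := (possum B root_vecs).

Lemma root_vecs_perm a : a \in root_vecs ->
  perm_eq (map (hrefl B a) root_vecs) root_vecs.
Proof.
move=> aP; apply: perm_map_involutive; first exact: root_vecs_uniq.
  exact: (hreflK RB (root_vecs_norm aP)).
by move=> g; apply: root_vecs_hrefl.
Qed.

Lemma root_vecs_perm_opp : perm_eq (map -%R root_vecs) root_vecs.
Proof.
apply: perm_map_involutive; [exact: root_vecs_uniq | exact: opprK |].
exact: root_vecs_opp.
Qed.

Lemma ninvE y : ninv y = \sum_(a <- root_vecs) (posv a)%:R * (B y a < 0)%R%:R.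
Proof.
rewrite /ninv -sum1_count big_mkcond natr_sum; apply: eq_bigr => a _.
by case: (posv a); case: (_ < _); rewrite ?mulr1 ?mul0r.
Qed.

(** Reindexing by the reflection moves its effect from y to the positivity of the roots, which for
    alpha_i and theta is known explicitly. *)
Lemma ninv_hrefl a y : a \in root_vecs ->
  ninv (hrefl B a y) - ninv y =
  \sum_(g <- root_vecs) ((posv (hrefl B a g))%:R - (posv g)%:R) * (B y g < 0)%R%:R.
Proof.
move=> aP; have h := root_vecs_norm aP.
rewrite (ninvE y) {1}ninvE -(perm_big _ (root_vecs_perm aP)) big_map -sumrB.
by apply: eq_bigr => g _; rewrite (ip_hrefl RB) // mulrBl.
Qed.

Lemma sum_root_delta g y : g \in root_vecs ->
  \sum_(a <- root_vecs) ((a == g)%:R - (a == - g)%:R) * (B y a < 0)%R%:R =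
  - Num.sg (B y g).
Proof.
move=> gP; have delta x : x \in root_vecs ->
    \sum_(a <- root_vecs) (a == x)%:R * (B y a < 0)%R%:R = (B y x < 0)%R%:R :> rat.
  move=> xP; rewrite (big_rem x) //= eqxx mul1r big1_seq ?addr0 // => a /andP[_ aP].
  move: aP; rewrite mem_rem_uniq ?root_vecs_uniq // inE => /andP[/negbTE -> _].
  by rewrite mul0r.
rewrite (eq_bigr (fun a => (a == g)%:R * (B y a < 0)%R%:R -
  (a == - g)%:R * (B y a < 0)%R%:R)) => [|a _]; last by rewrite mulrBl.
rewrite sumrB !delta ?root_vecs_opp // (ipNr RB) oppr_lt0.
by case: (ltrgt0P (B y g)) => [h|h|->]; rewrite ?(gtr0_sg h) ?(ltr0_sg h) ?sgr0.
Qed.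

Lemma ninv_sr_al i y :
  ninv (hrefl B (al i) y) = ninv y + Num.sg (B y (al i)).
Proof.
apply/eqP; rewrite addrC -subr_eq ninv_hrefl ?al_root //.
rewrite -[Num.sg _]opprK -sum_root_delta ?al_root // -sumrN; apply/eqP.
apply: eq_big_seq => g gP; rewrite -mulNr opprB; congr (_ * _).
have aN : hrefl B (al i) (- al i) = al i.
  by rewrite (hrefl_opp RB) hrefl_self ?opprK ?(al_norm CF).
have pN : posv (- al i) = false by rewrite posvN ?al_root ?posv_al.
have neq : (al i == - al i) = false.
  by apply: contraTF (posv_al i) => /eqP ->; rewrite pN.
have [->|ne] := eqVneq g (al i).
  by rewrite hrefl_self ?(al_norm CF) // pN posv_al neq sub0r.
have [->|neN] := eqVneq g (- al i); first by rewrite aN pN posv_al.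
rewrite subrr; have [pg|ng] := boolP (posv g).
  by rewrite posv_hrefl_al // subrr.
suff -> : posv (hrefl B (al i) g) = false by rewrite subrr.
have gN : posv (- g) by rewrite posvN.
have := posv_hrefl_al (i := i) (root_vecs_opp gP) gN; rewrite eqr_oppLR => /(_ neN).
by rewrite (hrefl_opp RB) posvN ?root_vecs_hrefl ?al_root // => /negbTE.
Qed.

Lemma copair_possum y g : copair B (possum y) g =
  \sum_(a <- root_vecs) - copair B a g * (B y a < 0)%R%:R.
Proof.
rewrite /possum (copair_suml RB) -(perm_big _ root_vecs_perm_opp) big_map big_mkcond.
apply: eq_bigr => a _; rewrite (ipNr RB) oppr_gt0 (copairNl RB).
by case: ifP; rewrite ?mulr1 ?mulr0.
Qed.

Lemma posv_hrefl_th g : g \in root_vecs ->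
  (posv (hrefl B th g))%:R - (posv g)%:R = - Num.sg (copair B g th) :> rat.
Proof.
have tt := copair_refl theta_norm; have pt := posv_th; have tP := th_root.
have tN : posv (- th) = false by rewrite posvN // pt.
case/root_vecP => b rb ->; have bP := mem_ratv rb.
have fixed : copair B (ratv b) th = 0 -> (posv (hrefl B th (ratv b)))%:R -
    (posv (ratv b))%:R = - Num.sg (copair B (ratv b) th) :> rat.
  by move=> e; rewrite /hrefl e scale0r subr0 subrr sgr0 oppr0.
case: (theta_copair_cases rb) => [->|->|[pb [//|e]]|[nb [//|e]]].
- by rewrite tt hrefl_self ?theta_norm // tN pt.
- rewrite ratvN (copairNl RB) tt (hrefl_opp RB) hrefl_self ?theta_norm //.
  by rewrite opprK pt tN.
- rewrite e (introT (posvP b) pb).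
  suff -> : posv (hrefl B th (ratv b)) = false by [].
  apply/negbTE; rewrite -posvN ?root_vecs_hrefl //; apply/forallP => k.
  by rewrite /hrefl e scale1r !mxE opprB -rmorphB ler0z subr_ge0 theta_max.
rewrite e; have -> : posv (ratv b) = false.
  by apply/negbTE; rewrite -posvN // -ratvN; apply/posvP.
suff -> : posv (hrefl B th (ratv b)) by [].
apply/forallP => k; rewrite /hrefl e scaleN1r opprK mxE.
by have := theta_coef_ge0 k rb; rewrite [ratv b 0 k]mxE.
Qed.

(** By [posv_hrefl_th] each root contributes minus the sign of its pairing with theta. This is minus
    the pairing itself except at theta and -theta, where the pairing is 2 or -2; the pairings sum to
    the [possum] term and the two exceptions give the sign term. *)
Lemma ninv_th y : ninv (hrefl B th y) =
  ninv y - Num.sg (B y th) + copair B (possum y) th.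
Proof.
apply/eqP; rewrite -addrA addrC -subr_eq ninv_hrefl ?th_root //; apply/eqP.
rewrite -sum_root_delta ?th_root // copair_possum -big_split /=.
apply: eq_big_seq => g gP; rewrite posv_hrefl_th // -mulrDl; congr (_ * _).
have tt := copair_refl theta_norm; have tP := th_root; have tn := theta_norm.
have tN : (th == - th) = false.
  by apply: contraTF posv_th => /eqP ->; rewrite posvN // posv_th.
have [->|ne] := eqVneq g th; first by rewrite tt tN.
have [->|neN] := eqVneq g (- th); first by rewrite (copairNl RB) tt.
case/root_vecP: gP ne neN => b rb -> ne neN.
by case: (theta_copair_cases rb) ne neN => [->|->|[pb [->|->]]|[nb [->|->]]];
  rewrite ?ratvN ?eqxx.
Qed.

Lemma affine_roots : affine_system B root_vecs posv sr aheight.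
Proof.
split.
- exact: root_vecs_uniq.
- exact: root_vecs_norm.
- exact: root_vecs_hrefl.
- exact: root_vecs_int.
- by move=> g gP; rewrite posvN // orbN.
- exact: sr_affine_pos.
- exact: sr_arefl.
- exact: sr_ascent.
- move=> j y; rewrite /sr; case: unliftP => [i _|_] /=.
    by rewrite ninv_sr_al mul0r subr0.
  by rewrite (hreflN RB) ninv_th (ipNr RB) (copairNr RB) sgrN mul1r opprK.
- move=> b u; rewrite /aheight /arefl /= /hrefl /acopair.
  rewrite (eq_bigr (fun i => u.1 0 i - copair B u.1 b.1 * b.1 0 i)).
    by rewrite sumrB -mulr_sumr; ring.
  by move=> i _; rewrite !mxE.
- move=> b ab; have -> : aheight b = \sum_(i < n) (b.1 0 i + b.2 * th 0 i) + b.2.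
    by rewrite /aheight big_split /= -mulr_sumr; ring.
  have ge0 i : 0 <= b.1 0 i + b.2 * th 0 i by apply: apos_coef.
  have [b0|b0] := eqVneq b.2 0; last first.
    apply: ltr_wpDl; first by apply: sumr_ge0.
    by rewrite lt_neqAle eq_sym b0 apos_level_ge0.
  rewrite [X in _ + X]b0 addr0; have nb := root_vecs_norm (apos_root ab).
  have s0 : 0 <= \sum_(i < n) (b.1 0 i + b.2 * th 0 i) by apply: sumr_ge0.
  rewrite lt_neqAle s0 andbT; apply: contraTneq nb => /esym/eqP.
  rewrite psumr_eq0 // => /allP z; suff -> : b.1 = 0 by rewrite (ip0l RB) ltxx.
  apply/rowP => i; have := z i; rewrite mem_index_enum b0 mul0r addr0 => /(_ isT)/eqP ->.
  by rewrite mxE.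
- move=> b ab; rewrite /aheight; have [bP bZ _] := and3P ab.
  case/root_vecP: bP => c rc ->.
  by rewrite rpredD ?rpredM ?rpredD ?rpred_sum // => i _; rewrite mxE intr_int.
Qed.

End HighestRoot.

(** * Words and minimal coset representatives *)

Section Words.

Variables (n : nat) (A : GCM n) (d : 'I_n -> rat).
Hypothesis CF : cartan_form A d.
Variable P : seq (ivec n).
Hypothesis P_uniq : uniq P.
Hypothesis P_root : forall b, b \in P <-> is_real_root A b.

Local Notation B := (rform A d).
Local Notation Phi := (root_vecs P).
Local Notation vact := (vact A d).
Local Notation ninv := (ninv B Phi (@posv n)).
Local Notation possum := (possum B Phi).
Let RB := rform_bilin CF.

(** * Finite weights, inversions and reduced words *)

Definition cartan_mx : 'M[rat]_n := \matrix_(i, j) (A j i)%:~R.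
(** The weight with i-th fundamental coordinate c_i, written in simple-root coordinates; [rhov] is
    then rho. *)
Definition wvec (c : 'I_n -> rat) : 'rV[rat]_n := (\row_i c i) *m invmx cartan_mx.

Lemma mul_cartan_mx v j : (v *m cartan_mx) 0 j = copair B v (al j).
Proof.
by rewrite (copair_al CF) mxE; apply: eq_bigr => i _; rewrite !mxE mulrC.
Qed.

Lemma copair_al_eq0 v : (forall i, copair B v (al i) = 0) -> v = 0.
Proof.
move=> h; apply/eqP; apply: contraT => /(rform_gt0 CF).
rewrite (rform_coord CF) big1 ?ltxx // => i _.
have/eqP := h i; rewrite -sgr_eq0 sgr_copair ?(al_norm CF) // sgr_eq0 => /eqP ->.
by rewrite mulr0.
Qed.

Lemma cartan_mx_unit : cartan_mx \in unitmx.
Proof.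
rewrite -row_free_unit; apply/inj_row_free => v v0.
by apply: copair_al_eq0 => i; rewrite -mul_cartan_mx v0 mxE.
Qed.

Lemma copair_wvec c i : copair B (wvec c) (al i) = c i.
Proof. by rewrite -mul_cartan_mx /wvec mulmxKV ?cartan_mx_unit // mxE. Qed.

Lemma wvec_copair v : wvec (fun i => copair B v (al i)) = v.
Proof.
apply/eqP; rewrite -subr_eq0; apply/eqP/copair_al_eq0 => i.
by rewrite (copairB RB) copair_wvec subrr.
Qed.

Definition dominant (v : 'rV[rat]_n) : Prop := forall i, 0 <= B v (al i).

Lemma dominant_posv v g : dominant v -> posv g -> 0 <= B v g.
Proof.
move=> dv /forallP pg; rewrite (rform_coord CF); apply: sumr_ge0 => i _.
exact: mulr_ge0.
Qed.

Lemma dominant_negv v g : dominant v -> g \in Phi -> ~~ posv g -> B v g <= 0.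
Proof.
move=> dv gP; rewrite -(posvN CF P_root gP) => /(dominant_posv dv).
by rewrite (ipNr RB) oppr_ge0.
Qed.

Definition rhov : 'rV[rat]_n := wvec (fun=> 1).

Lemma rhov_al i : 0 < B rhov (al i).
Proof. by rewrite -copair_gt0 ?(al_norm CF) // copair_wvec. Qed.

Lemma rhov_dominant : dominant rhov. Proof. by move=> i; apply/ltW/rhov_al. Qed.

Lemma rhov_neq0 g : g \in Phi -> B rhov g != 0.
Proof.
move=> gP; wlog pg : g gP / posv g.
  move=> W; have [/W|] := boolP (posv g); first exact.
  rewrite -(posvN CF P_root gP) => /(W _ (root_vecs_opp CF P_root gP)).
  by rewrite (ipNr RB) oppr_eq0.
have /forallP g0 := pg; have := root_vecs_norm CF P_root gP.
apply: contraTneq; rewrite (rform_coord CF) => /eqP.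
rewrite psumr_eq0 => [/allP z|i _]; last by rewrite mulr_ge0 // rhov_dominant.
suff -> : g = 0 by rewrite (ip0l RB) ltxx.
apply/rowP => i; have := z i; rewrite mem_index_enum mxE => /(_ isT).
by rewrite mulf_eq0 (gt_eqF (rhov_al i)) orbF => /eqP.
Qed.

Lemma rhov_lt0 g : g \in Phi -> (B rhov g < 0) = ~~ posv g.
Proof.
move=> gP; have [p|p] := boolP (posv g).
  by rewrite ltNge dominant_posv //; apply: rhov_dominant.
by rewrite lt_neqAle rhov_neq0 // dominant_negv //; apply: rhov_dominant.
Qed.

Lemma rhov_sgr g : g \in Phi -> Num.sg (B rhov g) = if posv g then 1 else -1.
Proof.
move=> gP; have := rhov_lt0 gP; case: ifP => _ /=; last by move/ltr0_sg.
move/negbT; rewrite -leNgt le_eqVlt eq_sym (negbTE (rhov_neq0 gP)) /=.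
exact: gtr0_sg.
Qed.

Lemma vact_root w g : g \in Phi -> vact w g \in Phi.
Proof.
move=> gP; elim: w => //= j w IH; apply: (root_vecs_hrefl CF P_root) => //.
exact: (al_root P_root).
Qed.

Lemma vact_suml (w : seq 'I_n) v : vact w v = \sum_i v 0 i *: vact w (al i).
Proof.
have E : v = \sum_i v 0 i *: al i.
  apply/rowP => k; rewrite summxE (bigD1 k) //= big1 ?addr0 => [|i ik].
    by rewrite mxE al_coef eqxx mulr1.
  by rewrite mxE al_coef eq_sym (negbTE ik) mulr0.
rewrite {1}E; elim: w {E} => //= j w ->.
rewrite /hrefl (copair_suml RB) scaler_suml -sumrB; apply: eq_bigr => i _.
by rewrite scalerBr scalerA (copairZ RB).
Qed.

Lemma weqbP u v : reflect (vact u =1 vact v) (weqb A u v).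
Proof.
apply: (iffP forallP) => [h x|h i].
  rewrite !(vact_suml _ x); apply: eq_bigr => i _; congr (_ *: _).
  by rewrite -!(ratv_wact CF); have /eqP -> := h i.
by apply/eqP/ratv_inj; rewrite !(ratv_wact CF) h.
Qed.

(* The number of positive roots g with w g < 0, as B (w^-1 rho) g = B rho (w g). *)
Definition winv (w : seq 'I_n) : rat := ninv (vact (rev w) rhov).

Lemma winv_ge0 w : 0 <= winv w. Proof. exact: ler0n. Qed.

Lemma winv_nat w : exists k, winv w = k%:R.
Proof. by eexists. Qed.

Lemma eq_vact_rev u v : vact u =1 vact v -> vact (rev u) =1 vact (rev v).
Proof. by move=> e x; rewrite -{1}(vact_rev CF v x) -e (vact_revK CF). Qed.

Lemma eq_winv u v : vact u =1 vact v -> winv u = winv v.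
Proof. by move=> /eq_vact_rev e; rewrite /winv e. Qed.

Lemma winv_rcons w j :
  winv (rcons w j) = if posv (vact w (al j)) then winv w + 1 else winv w - 1.
Proof.
rewrite /winv rev_rcons /= (ninv_sr_al CF P_uniq P_root).
have -> : B (vact (rev w) rhov) (al j) = B rhov (vact w (al j)).
  by rewrite (rform_vact_swap CF) revK.
by rewrite (rhov_sgr (vact_root w (al_root P_root j))); case: ifP.
Qed.

Lemma vact_cons j w v : vact (j :: w) v = hrefl B (al j) (vact w v).
Proof. by []. Qed.

Lemma vact_rcons w j v : vact (rcons w j) v = vact w (hrefl B (al j) v).
Proof. by rewrite -cats1 (vact_cat). Qed.

Lemma vact_rcons2 w j v : vact (rcons (rcons w j) j) v = vact w v.
Proof. by rewrite !vact_rcons (hreflK RB) ?(al_norm CF). Qed.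

Lemma exchange_word w j : ~~ posv (vact w (al j)) ->
  exists2 v, (size v < size w)%N & vact v =1 vact (rcons w j).
Proof.
elim: w => [|i u IH] /=; first by rewrite posv_al.
have uP := vact_root u (al_root P_root j).
have [pu|/IH[v sv e]] := boolP (posv (vact u (al j))); last first.
  by exists (i :: v) => // x; rewrite !vact_cons e.
move=> neg; have ua : vact u (al j) = al i.
  apply/eqP; apply: contraNT neg => ne.
  exact: (posv_hrefl_al CF P_root).
exists u => // x; rewrite vact_cons vact_rcons -ua (vact_hrefl CF) (hreflK RB) //.
exact: (al_norm CF).
Qed.

Lemma word_id w : (forall j, posv (vact w (al j))) -> vact w =1 id.
Proof.
have [m] := ubnP (size w); elim: m w => // m IH w le_m pw.
case: (lastP w) le_m pw => // u j le_m pu.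
have neg : ~~ posv (vact u (al j)).
  have := pu j; rewrite vact_rcons hrefl_self ?(al_norm CF) // (vactN CF).
  by rewrite (posvN CF P_root) // vact_root // (al_root P_root).
have [v sv e] := exchange_word neg.
move=> x; rewrite -e; apply: IH => [|i]; last by rewrite e.
by rewrite size_rcons ltnS in le_m; apply: leq_trans sv (ltnW le_m).
Qed.

(** The induction is on the number of inversions: [rcons w j] is a longer word but has one inversion
    fewer. *)
Lemma word_descent (Q : seq 'I_n -> Prop) :
  (forall w, vact w =1 id -> Q w) ->
  (forall w j, ~~ posv (vact w (al j)) -> Q (rcons w j) -> Q w) ->
  forall w, Q w.
Proof.
move=> Q1 QS w; have [k ek] := winv_nat w.
elim: k w ek => [|k IH] w ek.
  all: have [p|/existsNP[j /negP neg]] := pselect (forall j, posv (vact w (al j)));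
    first exact/Q1/word_id.
  have := winv_ge0 (rcons w j); rewrite winv_rcons (negbTE neg) ek; lra.
apply: (QS w j neg); apply: IH; rewrite winv_rcons (negbTE neg) ek -natr1; ring.
Qed.

Lemma reduced_word w : exists2 v, vact v =1 vact w & winv w = (size v)%:R.
Proof.
elim/word_descent: w => [w e|w j neg [v e sv]].
  exists [::] => [x|]; first by rewrite e.
  rewrite (eq_winv (v := [::])) // /winv /ninv /=.
  rewrite (eq_in_count (a2 := pred0)) ?count_pred0 // => g gP /=.
  by rewrite (rhov_lt0 gP) andbN.
exists (rcons v j) => [x|]; first by rewrite vact_rcons e -vact_rcons vact_rcons2.
by rewrite size_rcons -natr1 -sv winv_rcons (negbTE neg) subrK.
Qed.

Lemma winv_le_size w : winv w <= (size w)%:R.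
Proof.
elim/last_ind: w => [|w j IH].
  rewrite /winv /ninv (eq_in_count (a2 := pred0)) ?count_pred0 // => g gP /=.
  by rewrite (rhov_lt0 gP) andbN.
rewrite winv_rcons size_rcons -natr1; case: ifP; lra.
Qed.

Lemma wlenE w : (wlen A w)%:R = winv w.
Proof.
rewrite /wlen; case: ex_minnP => k /existsP[v /weqbP e] kmin.
have le := winv_le_size v; rewrite size_tuple in le.
apply/eqP; rewrite eq_le -(eq_winv e) le andbT.
have [u eu su] := reduced_word v; rewrite su ler_nat; apply: kmin.
apply/existsP; exists (in_tuple u); apply/weqbP => x.
by rewrite -e -eu.
Qed.

(** * Stabilizers and minimal coset representatives of a dominant weight *)

Variable L : 'rV[rat]_n.
Hypothesis L_dom : dominant L.
Variable J : {set 'I_n}.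
Hypothesis J_spec : forall j, (j \in J) = (B L (al j) == 0).

Lemma Jhrefl j : j \in J -> hrefl B (al j) L = L.
Proof.
by rewrite J_spec => /eqP h; rewrite /hrefl /copair h mulr0 mul0r scale0r subr0.
Qed.

Lemma Jword_fix v : Jword J v -> vact v L = L.
Proof. by elim: v => //= j v IH /andP[jJ /IH ->]; apply: Jhrefl. Qed.

Lemma descent_in_J w j : (forall g, posv g -> 0 <= B (vact w L) g) ->
  ~~ posv (vact w (al j)) -> j \in J.
Proof.
move=> dom neg; rewrite J_spec eq_le L_dom andbT -(rform_vact CF w).
have wP := vact_root w (al_root P_root j).
have := dom (- vact w (al j)); rewrite (posvN CF P_root wP) neg (ipNr RB) oppr_ge0.
by apply.
Qed.

(** Every descent of an element fixing L lies in J by [descent_in_J], and removing it leaves an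
    element that still fixes L. *)
Lemma stabilizer_word w : vact w L = L ->
  exists2 v, Jword J v & vact v =1 vact w.
Proof.
elim/word_descent: w => [w e _|w j neg IH wL].
  by exists [::] => // x; rewrite e.
have jJ : j \in J.
  by apply: descent_in_J neg => g pg; rewrite wL; apply: dominant_posv.
have [v Jv e] := IH ltac:(by rewrite vact_rcons Jhrefl).
exists (rcons v j) => [|x]; first by rewrite /Jword all_rcons jJ.
by rewrite vact_rcons e -vact_rcons vact_rcons2.
Qed.

Lemma dominant_unique w : dominant (vact w L) -> vact w L = L.
Proof.
elim/word_descent: w => [w e _|w j neg IH dom]; first exact: e.
have jJ : j \in J by apply: descent_in_J neg => g; apply: dominant_posv.
by have := IH; rewrite vact_rcons Jhrefl // => /(_ dom).
Qed.

(** Equal signs make w1^-1 w2 L dominant, and L is the only dominant element of its orbit. *)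
Lemma orbit_sgr_inj w1 w2 :
  (forall g, g \in Phi -> Num.sg (B (vact w1 L) g) = Num.sg (B (vact w2 L) g)) ->
  vact w1 L = vact w2 L.
Proof.
move=> sg; rewrite -[RHS](vact_rev CF w1); congr (vact w1 _).
rewrite -vact_cat; apply/esym/dominant_unique => i.
rewrite vact_cat (rform_vact_swap CF) revK -sgr_ge0 -sg ?vact_root ?(al_root P_root) //.
by rewrite (rform_vact CF) sgr_ge0.
Qed.

Lemma posv_J_image x (g : 'rV_n) : (forall j, j \in J -> posv (vact x (al j))) ->
  posv g -> (forall k, k \notin J -> g 0 k = 0) -> posv (vact x g).
Proof.
move=> px /forallP pg z; apply/forallP => k; rewrite vact_suml summxE.
apply: sumr_ge0 => i _; rewrite mxE; have [iJ|iJ] := boolP (i \in J).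
  by rewrite mulr_ge0 //; have /forallP := px i iJ.
by rewrite z // mul0r.
Qed.

Lemma L_zero_J g : posv g -> B L g = 0 -> forall k, k \notin J -> g 0 k = 0.
Proof.
move=> /forallP pg /eqP; rewrite (rform_coord CF) psumr_eq0 => [/allP z k kJ|i _].
  have := z k; rewrite mem_index_enum mulf_eq0 -J_spec (negbTE kJ) orbF => /(_ isT).
  by move/eqP.
exact: mulr_ge0.
Qed.

Lemma L_J_zero (g : 'rV_n) : (forall k, k \notin J -> g 0 k = 0) -> B L g = 0.
Proof.
move=> z; rewrite (rform_coord CF) big1 // => i _.
have [|iJ] := boolP (i \in J); last by rewrite z // mul0r.
by rewrite J_spec => /eqP ->; rewrite mulr0.
Qed.

Lemma minrep_posv x j : minrep A J x -> j \in J -> posv (vact x (al j)).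
Proof.
move=> mx jJ; apply: contraT => neg; have := mx [:: j]; rewrite /Jword /= jJ.
move/(_ isT); rewrite cats1 -(ler_nat rat) !wlenE winv_rcons (negbTE neg); lra.
Qed.

(** The bijection g -> -x g matches the two counts except possibly at inversions g of x with (L, g)
    = 0. Such a g would lie in Delta_J, whose positive roots a minimal x keeps positive. *)
Lemma minrep_ninv x : minrep A J x -> (wlen A x)%:R = ninv (vact x L).
Proof.
move=> mx; rewrite wlenE /winv /ninv; congr (_%:R).
pose f g := - vact x g.
have perm : perm_eq (map f Phi) Phi.
  have inj : injective f.
    by move=> a b /oppr_inj /(can_inj (vact_revK CF x)).
  have uP := root_vecs_uniq P_uniq.
  apply: uniq_perm => //; first by rewrite (map_inj_uniq inj).
  move=> g; apply/mapP/idP => [[h hP ->]|gP].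
    exact/(root_vecs_opp CF P_root)/vact_root.
  exists (- vact (rev x) g); last by rewrite /f (vactN CF) opprK (vact_rev CF).
  exact/(root_vecs_opp CF P_root)/vact_root.
rewrite -[RHS](permP perm) [RHS]count_map; apply: eq_in_count => g gP /=.
rewrite (rform_vact_swap CF) revK (rhov_lt0 (vact_root x gP)) /f.
rewrite (posvN CF P_root (vact_root x gP)) (ipNr RB) (rform_vact CF) oppr_lt0.
rewrite andbC; apply: andb_id2l => neg.
apply/idP/idP => [pg|]; last first.
  by apply: contraTT => ng; rewrite -leNgt dominant_negv.
rewrite lt_neqAle eq_sym dominant_posv // andbT; apply: contraNneq neg => Lg.
apply: posv_J_image => // [j jJ|]; first exact: minrep_posv.
exact: L_zero_J.
Qed.

Lemma minrep_ex w : exists2 x, minrep A J x & vact x L = vact w L.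
Proof.
have ex : exists k, `[< exists2 x, vact x L = vact w L & wlen A x = k >].
  by exists (wlen A w); apply/asboolP; exists w.
case: (ex_minnP ex) => k /asboolP[x xw xk] kmin; exists x => // v Jv.
rewrite xk; apply: kmin; apply/asboolP; exists (x ++ v) => //.
by rewrite vact_cat Jword_fix.
Qed.

Lemma Jword_coord v u k : Jword J v -> k \notin J -> vact v u 0 k = u 0 k.
Proof.
elim: v => //= j v IH /andP[jJ Jv] kJ; rewrite /hrefl !mxE IH //.
by rewrite ffunE; case: eqP kJ => [->|_ _]; rewrite ?jJ // mulr0 subr0.
Qed.

(** Here y = x v with v in W_J. If v alpha_j were negative, j would lie in J, since otherwise the
    coefficient of alpha_j remains 1. As x keeps positive roots of Delta_J positive, y alpha_j would
    be negative, against minimality of y. *)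
Lemma minrep_unique x y : minrep A J x -> minrep A J y -> vact x L = vact y L ->
  vact x =1 vact y.
Proof.
move=> mx my e.
have [|v Jv ev] := stabilizer_word (w := rev x ++ y).
  by rewrite vact_cat -e (vact_revK CF).
have yE u : vact y u = vact x (vact v u).
  by rewrite ev vact_cat (vact_rev CF).
suff v1 : vact v =1 id by move=> u; rewrite yE v1.
apply: word_id => j; have vP := vact_root v (al_root P_root j).
have [jJ|jJ] := boolP (j \in J).
  apply: contraT => neg; have := minrep_posv my jJ; rewrite yE.
  have : posv (vact x (- vact v (al j))).
    apply: posv_J_image; first by move=> i; apply: minrep_posv.
      by rewrite (posvN CF P_root vP).
    move=> k kJ; rewrite mxE (Jword_coord _ Jv kJ) al_coef.
    by case: eqP kJ => [->|_ _]; rewrite ?jJ ?oppr0.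
  by rewrite (vactN CF) (posvN CF P_root (vact_root x vP)) => /negbTE ->.
apply: contraT; rewrite -(posvN CF P_root vP) => /forallP /(_ j).
by rewrite mxE (Jword_coord _ Jv jJ) al_coef eqxx oppr_ge0 ler10.
Qed.

Lemma posroot_notJP b : posroot_notJ A J b <->
  is_real_root A b /\ 0 < B L (ratv b).
Proof.
have zE : in_DJ J b <-> forall k, k \notin J -> ratv b 0 k = 0.
  split=> h k kJ; have := h k kJ; rewrite mxE; first by move=> ->.
  by move/eqP; rewrite intr_eq0 => /eqP.
split=> [[[rb pb] nJ]|[rb Lb]].
  split=> //; rewrite lt_neqAle dominant_posv ?andbT //; last exact/posvP.
  by apply/eqP => /esym /(L_zero_J (introT (posvP _) pb)) /zE.
have bP := mem_ratv P_root rb.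
split; last by move=> /zE /L_J_zero e; rewrite e ltxx in Lb.
split=> //; apply/posvP; apply: contraTT Lb => ng.
by rewrite -leNgt dominant_negv.
Qed.

(** By [posroot_notJP] the summation runs over the roots positive on L, so 2 (rho - rho_J) is
    [possum L]. *)
Lemma two_rho_JE b : is_real_root A b ->
  (two_rho_J A J b)%:~R = copair B (possum L) (ratv b).
Proof.
move=> rb; rewrite /two_rho_J /possum (copair_suml RB) big_map.
have -> : [set a | posroot_notJ A J a]%classic =
    [set` [seq a <- P | 0 < B L (ratv a)]]%classic.
  apply/seteqP; split=> a /=; rewrite mem_filter.
    by move=> /posroot_notJP[/P_root -> ->].
  by move=> /andP[La /P_root ra]; apply/posroot_notJP.
rewrite -fsbig_seq ?filter_uniq // big_filter rmorph_sum.
by apply: eq_bigr => a _; rewrite -(rc_pairE CF).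
Qed.

End Words.

(** * Affine weights, LS paths and quantum LS paths *)

Lemma plmap_cons (R : realType) N (v : ivec N) vs a b sg t k :
  @plmap R N (v :: vs) (a :: b :: sg) t k =
  (Num.min (Num.max t (ratr a)) (ratr b) - ratr a) * (v k)%:~R +
  plmap vs (b :: sg) t k.
Proof. by rewrite /plmap /= big_ord_recl. Qed.

Lemma plmap_merge (R : realType) N (v : ivec N) vs a b c sg : a <= b -> b <= c ->
  @plmap R N (v :: v :: vs) (a :: b :: c :: sg) = plmap (v :: vs) (a :: c :: sg).
Proof.
move=> ab bc; apply/funext => t; apply/funext => k.
rewrite !plmap_cons addrA -mulrDl; congr (_ * _ + _).
have : ratr a <= ratr b :> R by rewrite ler_rat.
have : ratr b <= ratr c :> R by rewrite ler_rat.
move: (ratr a) (ratr b) (ratr c) => x y z yz xy.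
by case: (leP t x) => tx; case: (leP t y) => ty; repeat (case: leP => ?); lra.
Qed.

Lemma sigma_gt0 sg s k : sigma_ok sg s -> (k.+1 < s)%N -> 0 < nth 0 sg k.+1.
Proof.
move=> [ss s0 _ so] lt; rewrite -[X in X < _]s0.
apply: (sorted_ltn_nth lt_trans 0 so); rewrite ?inE ?ss //.
exact: (ltnW lt).
Qed.

Section AffineWeights.

Variables (n : nat) (A : GCM n) (d : 'I_n -> rat).
Hypothesis CF : cartan_form A d.
Variable P : seq (ivec n).
Hypothesis P_uniq : uniq P.
Hypothesis P_root : forall b, b \in P <-> is_real_root A b.
Hypothesis indec : indecomposable A.
Hypothesis n_gt0 : (0 < n)%N.

Local Notation B := (rform A d).
Local Notation Phi := (root_vecs P).
Local Notation vact := (vact A d).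
Local Notation th := (ratv (highest_root A)).
Local Notation sr := (sr A).
Local Notation apos := (apos Phi (@posv n)).
Local Notation arefl := (arefl B).
Local Notation chain := (chain B Phi (@posv n)).
Local Notation cover := (cover B Phi (@posv n)).
Let RB := rform_bilin CF.
Let AS := affine_roots CF P_uniq P_root indec n_gt0.
Let th_is_root := theta_root CF P_uniq P_root indec n_gt0.

(** * Affine roots and level-zero weights as pairs of a finite vector and a level *)

Lemma sr_lift i : sr (lift ord0 i) = (al i, 0).
Proof. by rewrite /sr liftK. Qed.
Lemma sr0 : sr ord0 = (- th, 1).
Proof. by rewrite /sr unlift_none. Qed.
Lemma sr_level j : (sr j).2 = (j == ord0)%:R.
Proof. by case: (unliftP ord0 j) => [i|] ->; rewrite ?sr_lift ?sr0. Qed.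

Lemma copair_coroot v b : is_real_root A b ->
  copair B v (ratv b) = \sum_(i < n) (coroot A b i)%:~R * copair B v (al i).
Proof.
move=> rb; rewrite {1}/copair (rform_coord CF) mulr_sumr mulr_suml.
apply: eq_bigr => i _; rewrite (coroot_coef CF) // /copair (rform_al_al CF) mxE.
by field; rewrite !gt_eqF ?(cf_gt0 CF) ?(real_root_norm_gt0 CF).
Qed.

Lemma affE i j : (aff A i j)%:~R = copair B (sr j).1 (sr i).1.
Proof.
have tn := theta_norm CF P_uniq P_root indec n_gt0.
rewrite /aff; case: (unliftP ord0 i) => [i'|] ->; case: (unliftP ord0 j) => [j'|] ->;
  rewrite ?sr_lift ?sr0 /=.
- rewrite (copair_al CF) (bigD1 j') //= big1 => [|k kj].
    by rewrite al_coef eqxx mulr1 addr0.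
  by rewrite al_coef (negbTE kj) mulr0.
- by rewrite rmorphN /= (rt_pairE CF) (copairNl RB).
- rewrite rmorphN /= (copairNr RB); congr (- _).
  rewrite /cr_pair rmorph_sum (copair_coroot _ th_is_root).
  apply: eq_bigr => k _; rewrite rmorphM /=; congr (_ * _).
  rewrite (copair_al CF) (bigD1 j') //= big1 => [|l lj].
    by rewrite al_coef eqxx mulr1 addr0.
  by rewrite al_coef (negbTE lj) mulr0.
by rewrite (copairNl RB) (copairNr RB) opprK copair_refl.
Qed.

Lemma sr_form_gt0 j : 0 < B (sr j).1 (sr j).1.
Proof. exact: (sr_norm AS). Qed.

Definition affd (j : 'I_n.+1) : rat := B (sr j).1 (sr j).1 / 2.

Lemma affd_sym i j : affd i * (aff A i j)%:~R = affd j * (aff A j i)%:~R.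
Proof.
rewrite !affE /affd /copair (sb_C RB (sr i).1).
by field; rewrite !gt_eqF ?sr_form_gt0.
Qed.

(** Passes from simple-root coordinates to g + k delta. As alpha_0 = delta - theta, the level k is
    the coefficient of alpha_0. *)
Definition psi (b : ivec n.+1) : 'rV[rat]_n * rat :=
  (\sum_(j < n.+1) (b j)%:~R *: (sr j).1, (b ord0)%:~R).

Arguments psi : simpl never.

Lemma aff_rt_pairE b j : (rt_pair (aff A) b j)%:~R = copair B (psi b).1 (sr j).1.
Proof.
rewrite /rt_pair rmorph_sum /psi /= (copair_suml RB); apply: eq_bigr => l _.
by rewrite rmorphM /= affE (copairZ RB).
Qed.

Lemma psi_evec j : psi (evec j) = sr j.
Proof.
rewrite /psi (bigD1 j) //= big1 ?addr0 => [|k kj].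
  rewrite [RHS]surjective_pairing sr_level !ffunE eqxx scale1r eq_sym.
  by case: eqP.
by rewrite ffunE (negbTE kj) scale0r.
Qed.

Lemma psi_sref j b : psi (sref (aff A) j b) = arefl (sr j) (psi b).
Proof.
rewrite /arefl /psi /hrefl /acopair /= -aff_rt_pairE; congr pair.
  rewrite [in RHS](bigD1 j) //= [in LHS](bigD1 j) //= ffunE eqxx rmorphB scalerBl addrAC.
  congr (_ + _ - _); apply: eq_bigr => k kj; by rewrite ffunE (negbTE kj) subr0.
rewrite ffunE rmorphB sr_level eq_sym /=; congr (_ - _).
by case: eqP; rewrite ?mulr1 ?mulr0.
Qed.

Lemma psi_coef b i : (psi b).1 0 i + (psi b).2 * th 0 i = (b (lift ord0 i))%:~R.
Proof.
have -> : (psi b).1 = \sum_(k < n) (b (lift ord0 k))%:~R *: al k - (psi b).2 *: th.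
  rewrite /psi /= big_ord_recl sr0 /= scalerN addrC; congr (_ - _).
  by apply: eq_bigr => k _; rewrite sr_lift.
rewrite mxE [X in _ + X + _]mxE [X in _ - X + _]mxE subrK summxE (bigD1 i) //=.
rewrite big1 => [|k ki]; rewrite mxE al_coef.
  by rewrite eqxx mulr1 addr0.
by rewrite eq_sym (negbTE ki) mulr0.
Qed.

Lemma psi_inj : injective psi.
Proof.
move=> b c e; apply/ffunP => j; apply/eqP; rewrite -(eqr_int rat); apply/eqP.
case: (unliftP ord0 j) => [i|] ->; first by rewrite -!psi_coef e.
by case: e.
Qed.

Lemma real_root_psi b : is_real_root (aff A) b -> (psi b).1 \in Phi.
Proof.
case=> w [j <-]; elim: w => [|i w IH].
  by rewrite -[wact _ _ _]/(evec j) psi_evec; apply: (sr_root AS).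
rewrite -[wact _ _ _]/(sref _ i (wact _ w _)) psi_sref.
by apply: (as_hrefl AS) => //; apply: (sr_root AS).
Qed.

(** For the converse, the descent by simple reflections takes any positive g + k delta to a simple
    root, which exhibits it as a real root. *)
Lemma apos_psi b : is_pos_real_root (aff A) b <-> apos (psi b).
Proof.
split=> [[rb pb]|].
  apply/and3P; split; [exact: real_root_psi|exact: intr_int|].
  rewrite ltr0z intr_eq0; have := pb ord0; rewrite le_eqVlt eq_sym.
  case/orP => [b0|->//]; rewrite b0; apply/orP; right; apply/forallP => i.
  have := psi_coef b i; rewrite /psi /= (eqP b0) mul0r addr0 => ->.
  by rewrite ler0z.
move: {1 3}(psi b) (erefl (psi b)) => u eu au; move: au b eu.
move: u; apply: (apos_ind AS) => u au IH b eu.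
split; last first.
  move=> j; rewrite -(ler0z rat); case: (unliftP ord0 j) => [i|] ->.
    by rewrite -psi_coef -eu; apply: (apos_coef CF P_uniq P_root indec n_gt0 _ au).
  by have := apos_level_ge0 au; rewrite eu.
have [j hj] := as_ascent AS au.
have [e|ne] := eqVneq u (sr j).
  by exists [::], j; apply: psi_inj; rewrite /= psi_evec -e eu.
have [] := IH j ne hj (sref (aff A) j b); first by rewrite psi_sref eu.
move=> [w [i wi]] _; exists (j :: w), i; apply: psi_inj.
by rewrite /= wi !psi_sref (areflK RB) // sr_form_gt0.
Qed.

Lemma apos_psi_ex u : apos u -> exists2 b, is_pos_real_root (aff A) b & psi b = u.
Proof.
move=> au; suff [b bu] : exists b, psi b = u by exists b => //; apply/apos_psi; rewrite bu.
move: u au; apply: (apos_ind AS) => u au IH.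
have [j hj] := as_ascent AS au.
have [e|ne] := eqVneq u (sr j); first by exists (evec j); rewrite psi_evec.
have [b eb] := IH j ne hj; exists (sref (aff A) j b).
by rewrite psi_sref eb (areflK RB) // sr_form_gt0.
Qed.

Lemma aff_coroot_coef b l : is_real_root (aff A) b ->
  (coroot (aff A) b l)%:~R = 2 * affd l * (b l)%:~R / B (psi b).1 (psi b).1.
Proof.
move=> rb; have [w [j [wb <-]]] := coroot_spec rb.
have := @wcact_symmetrized _ _ affd (affd j) w (evec j) (evec j) affd_sym.
rewrite wb => /(_ _ l) h.
have -> : B (psi b).1 (psi b).1 = B (sr j).1 (sr j).1.
  rewrite -wb; elim: w {wb h} => [|i w IH].
    by rewrite -[wact _ _ _]/(evec j) psi_evec.
  by rewrite -[wact _ _ _]/(sref _ i (wact _ w _)) psi_sref (ip_hrefl RB) ?sr_form_gt0.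
have -> : 2 * affd l * (b l)%:~R = 2 * (affd l * (b l)%:~R) by rewrite mulrA.
have nj := sr_form_gt0 j.
rewrite -h; first by rewrite /affd; field; rewrite gt_eqF.
by move=> k; rewrite ffunE; case: eqP => [->|_]; ring.
Qed.

(** The pairing at node 0 is tested against -theta, which encodes level zero, so the finite vector
    and the delta-coordinate determine the weight. *)
Definition rep (mu : wt n) (u : 'rV[rat]_n * rat) : Prop :=
  (forall k, (mu.1 k)%:~R = copair B u.1 (sr k).1) /\ mu.2%:~R = u.2.

Lemma rep_fun mu u v : rep mu u -> rep mu v -> u = v.
Proof.
case: u v => [u a] [v c] [/= hu <-] [/= hv <-]; congr pair.
rewrite -(wvec_copair CF u) -(wvec_copair CF v); congr (_ *m _).
apply/rowP => i; rewrite !mxE.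
by have := hu (lift ord0 i); rewrite hv sr_lift.
Qed.

Lemma rep_inj mu nu u : rep mu u -> rep nu u -> mu = nu.
Proof.
case: mu nu => [mu a] [nu c] [/= hm am] [/= hn an]; congr pair.
  by apply/ffunP => k; apply/eqP; rewrite -(eqr_int rat) hm hn.
by apply/eqP; rewrite -(eqr_int rat) am an.
Qed.

Lemma wt_pairE mu u b : rep mu u -> is_real_root (aff A) b ->
  (wt_pair mu (coroot (aff A) b))%:~R = copair B u.1 (psi b).1.
Proof.
move=> [hm _] rb; rewrite /wt_pair rmorph_sum.
have -> : copair B u.1 (psi b).1 =
    \sum_(k < n.+1) 2 * ((b k)%:~R * B u.1 (sr k).1) / B (psi b).1 (psi b).1.
  rewrite -mulr_suml -mulr_sumr /copair; congr (2 * _ / _).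
  rewrite (sb_C RB) {1}/psi (ip_suml RB); apply: eq_bigr => k _.
  by rewrite (sb_Zl RB) (sb_C RB).
apply: eq_bigr => k _; rewrite rmorphM /= hm aff_coroot_coef // /affd /copair.
have nb := root_vecs_norm CF P_root (real_root_psi rb).
by field; rewrite !gt_eqF ?sr_form_gt0.
Qed.

Lemma rep_rref mu u b : rep mu u -> is_real_root (aff A) b ->
  rep (rref A b mu) (arefl (psi b) u).
Proof.
move=> hr rb; have [hm am] := hr; split=> [k|]; rewrite /rref /= ?ffunE rmorphB rmorphM /=.
  by rewrite (wt_pairE hr rb) hm aff_rt_pairE /hrefl (copairB RB) (copairZ RB).
by rewrite (wt_pairE hr rb) am.
Qed.

Lemma rep_wsref mu u j : rep mu u -> rep (wsref A j mu) (arefl (sr j) u).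
Proof.
move=> [hm am]; split=> [k|]; rewrite /= ?ffunE rmorphB rmorphM /=.
  by rewrite !hm affE /hrefl (copairB RB) (copairZ RB).
by rewrite hm am sr_level; case: eqP.
Qed.

Definition awact (w : seq 'I_n.+1) (u : 'rV[rat]_n * rat) :=
  foldr (fun j => arefl (sr j)) u w.

Lemma rep_wtact mu u w : rep mu u -> rep (wtact A w mu) (awact w u).
Proof. by move=> hr; elim: w => //= j w; apply: rep_wsref. Qed.

Lemma awact_cat w1 w2 u : awact (w1 ++ w2) u = awact w1 (awact w2 u).
Proof. by rewrite /awact foldr_cat. Qed.

Lemma arefl_awact w j u :
  arefl (awact w (sr j)) u = awact (w ++ j :: rev w) u.
Proof.
elim: w u => // i w IH u; have ni := sr_form_gt0 i.
rewrite -[LHS]/(arefl (arefl (sr i) (awact w (sr j))) u) -{1}(areflK RB ni u).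
rewrite (arefl_conj RB _ _ ni) IH rev_cons -cats1.
by rewrite -[RHS]/(arefl (sr i) (awact (w ++ j :: (rev w ++ [:: i])) u))
  -cat_cons catA [in RHS]awact_cat.
Qed.

Lemma psi_wact w b : psi (wact (aff A) w b) = awact w (psi b).
Proof.
by elim: w => // j w IH; rewrite -[LHS]/(psi (sref _ j (wact _ w b))) psi_sref IH.
Qed.

Lemma hrefl_word g : g \in Phi -> exists r, vact r =1 hrefl B g.
Proof.
case/(root_vecP P_root) => b [w [j <-]] ->; exists (w ++ j :: rev w) => v.
rewrite vact_cat /= (ratv_wact CF) -[in RHS](vact_rev CF w v).
by rewrite (vact_hrefl CF).
Qed.

Variable m : 'I_n -> nat.

Definition Lv : 'rV[rat]_n := wvec A (fun i => (m i)%:R).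
Local Notation J := (Jof A m).
Local Notation lam := (lam A m).
Local Notation worb := (Defs.in_orbit A lam).

Lemma Lam_lift i : Lam A m (lift ord0 i) = (m i)%:Z.
Proof.
rewrite /Lam /= ffunE (bigD1 i) //= ffunE eqxx mulr1 big1 ?addr0 // => k ki.
rewrite ffunE (inj_eq lift_inj) (eq_sym i) (negbTE ki).
by rewrite (eq_sym _ ord0) (negbTE (neq_lift _ _)) mulr0.
Qed.

Lemma rep_lam : rep lam (Lv, 0).
Proof.
split=> // k; case: (unliftP ord0 k) => [i|] -> /=.
  by rewrite sr_lift (copair_wvec CF) -/(Lam A m) Lam_lift.
rewrite sr0 /= (copairNr RB) (copair_coroot _ th_is_root) ffunE rmorph_sum.
rewrite -sumrN; apply: eq_bigr => i _; rewrite (copair_wvec CF) rmorphM ffunE.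
by rewrite (negbTE (neq_lift _ _)) eqxx rmorphN /= mulrN mulrC.
Qed.

Lemma Lv_dom : dominant A d Lv.
Proof.
move=> i; rewrite -sgr_ge0 -(sgr_copair _ (al_norm CF i)) sgr_ge0 (copair_wvec CF).
exact: ler0n.
Qed.

Lemma J_spec j : (j \in J) = (B Lv (al j) == 0).
Proof.
rewrite inE Lam_lift -[RHS]sgr_eq0 -(sgr_copair _ (al_norm CF j)) [RHS]sgr_eq0.
rewrite (copair_wvec CF); by rewrite pnatr_eq0.
Qed.

Lemma rep_orbit mu : worb mu -> exists u, rep mu u.
Proof. by case=> w <-; exists (awact w (Lv, 0)); apply: rep_wtact rep_lam. Qed.

Lemma orbit_rref mu b : worb mu -> is_real_root (aff A) b -> worb (rref A b mu).
Proof.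
move=> [w wm] rb; have [v [j vb]] := rb.
have hr : rep mu (awact w (Lv, 0)) by rewrite -wm; apply: rep_wtact rep_lam.
exists ((v ++ j :: rev v) ++ w); apply: rep_inj (rep_rref hr rb).
by rewrite -vb psi_wact psi_evec arefl_awact -awact_cat; apply: rep_wtact rep_lam.
Qed.

Definition vorb (v : 'rV[rat]_n) : Prop := exists x, v = vact x Lv.

Lemma vorb_hrefl g v : g \in Phi -> vorb v -> vorb (hrefl B g v).
Proof.
by move=> /hrefl_word[r er] [x ->]; exists (r ++ x); rewrite vact_cat er.
Qed.

Lemma vorb_orbit mu u : worb mu -> rep mu u -> vorb u.1.
Proof.
case=> w <- hr; rewrite -(rep_fun (rep_wtact w rep_lam) hr).
elim: w {hr} => [|j w IH] /=; first by exists [::].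
by apply: vorb_hrefl IH; apply: (sr_root AS).
Qed.

Lemma rep_clact x : rep (wtact A (map (lift ord0) x) lam) (vact x Lv, 0).
Proof.
have -> : (vact x Lv, 0) = awact (map (lift ord0) x) (Lv, 0).
  elim: x => //= i x <-; rewrite sr_lift /arefl /=.
  by rewrite mulr0 subr0.
exact: rep_wtact rep_lam.
Qed.

Lemma clact_rep mu u x : rep mu u -> u.1 = vact x Lv -> clact A x (Lam A m) = mu.1.
Proof.
move=> [hm _] e; rewrite /clact -[(Lam A m, 0)]/lam.
have [hx _] := rep_clact x; apply/ffunP => k; apply/eqP.
by rewrite -(eqr_int rat) hm hx e.
Qed.

Lemma clpairE b : is_real_root A b ->
  (clpair (Lam A m) (coroot A b))%:~R = copair B Lv (ratv b).
Proof.
move=> rb; rewrite /clpair rmorph_sum (copair_coroot _ rb); apply: eq_bigr => i _.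
by rewrite rmorphM /= Lam_lift (copair_wvec CF).
Qed.

(** * Sigma-chains of weights and directed paths of vectors *)

Local Notation possum := (possum B Phi).
Local Notation step_len := (step_len B Phi (@posv n)).
Local Notation qpath := (qpath B Phi (@posv n)).
Local Notation qstep := (qstep B Phi (@posv n)).

Lemma wt_pair_lt0 mu u b : rep mu u -> is_real_root (aff A) b ->
  (wt_pair mu (coroot (aff A) b) < 0) = (B u.1 (psi b).1 < 0).
Proof.
move=> hr rb; rewrite -(ltrz0 rat) (wt_pairE hr rb) copair_lt0 //.
exact: (root_vecs_norm CF P_root (real_root_psi rb)).
Qed.

Lemma chain_len0 mu nu : chain_len A lam mu nu 0 <-> worb mu /\ mu = nu.
Proof.
split=> [[mus [bs [_ <- <- /(_ 0%N isT) o _]]]|[o <-]]; first by [].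
by exists [:: mu], [::]; split=> // i; rewrite leqn0 => /eqP ->.
Qed.

Lemma chain_lenS mu nu k : chain_len A lam mu nu k.+1 <->
  worb mu /\ exists b, [/\ is_pos_real_root (aff A) b,
    wt_pair mu (coroot (aff A) b) < 0 & chain_len A lam (rref A b mu) nu k].
Proof.
split=> [[[|mu0 mus] [[|b bs] [[//= [sm] [sb]] e0 ek o h]]]|[o [b [rb lt]]]].
  have /= [rb e1 lt] := h 0%N isT; have /= o0 := o 0%N isT.
  rewrite -e0; split=> //; exists b; split=> //; exists mus, bs; split=> // i ik.
    exact: (o i.+1 ik).
  exact: (h i.+1 ik).
case=> mus [bs [[sm sb] e0 ek oi h]].
exists (mu :: mus), (b :: bs); split=> //=; first by rewrite sm sb.
  by case=> //= i; apply: oi.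
by case=> [_|i] /=; [rewrite e0 | apply: h].
Qed.

Lemma chain_len_end mu nu k : chain_len A lam mu nu k -> worb nu.
Proof. by case=> mus [bs [_ _ <- o _]]; apply: o. Qed.

Lemma chain_lenP k mu nu u v : worb mu -> rep mu u -> rep nu v ->
  chain_len A lam mu nu k <-> chain k u v.
Proof.
move=> o hu hv; split.
  elim: k mu u o hu => [|k IH] mu u o hu.
    by case/chain_len0 => _ e; rewrite (rep_fun hu (v := v)) ?e //; apply: chain_nil.
  case/chain_lenS => _ [b [pb lt c]]; have rb := pb.1.
  apply: (@chain_cons _ _ _ _ k (psi b)); first exact/apos_psi.
    by rewrite -(wt_pair_lt0 hu rb).
  by apply: IH c; [apply: orbit_rref | apply: rep_rref].
move=> c; elim: c mu nu o hu hv => [w|{}k b {}u {}v ab lt _ IH] mu nu o hu hv.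
  by apply/chain_len0; split=> //; apply: rep_inj hu hv.
have [b0 pb eb] := apos_psi_ex ab; have rb := pb.1; subst b.
apply/chain_lenS; split=> //; exists b0; split=> //.
  by rewrite (wt_pair_lt0 hu rb).
by apply: IH => //; [apply: orbit_rref | apply: rep_rref].
Qed.

Lemma dist1P mu nu u v : worb mu -> rep mu u -> rep nu v ->
  dist1 A lam mu nu <-> cover u v.
Proof.
move=> o hu hv; split=> [] [c1 cn]; split; try exact/(chain_lenP _ o hu hv).
- by move=> k /(chain_lenP k o hu hv); apply: cn.
- by move=> k /(chain_lenP k o hu hv); apply: cn.
Qed.

Definition sstep (s : rat) (mu nu : wt n) : Prop :=
  [/\ wgt A lam mu nu, dist1 A lam mu nu &
    exists b, [/\ is_pos_real_root (aff A) b, rref A b mu = nu &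
      exists z : int, z < 0 /\ s * (wt_pair mu (coroot (aff A) b))%:~R = z%:~R]].

Definition schain_len s k mu nu : Prop := exists mus : seq (wt n),
  [/\ size mus = k.+1, nth (0, 0) mus 0 = mu, nth (0, 0) mus k = nu &
    forall i, (i < k)%N -> sstep s (nth (0, 0) mus i) (nth (0, 0) mus i.+1)].

Lemma schain_len0 s mu nu : schain_len s 0 mu nu <-> mu = nu.
Proof.
split=> [[mus [_ <- <- _]]//|->]; by exists [:: nu]; split.
Qed.

Lemma schain_lenS s k mu nu : schain_len s k.+1 mu nu <->
  exists2 mu1, sstep s mu mu1 & schain_len s k mu1 nu.
Proof.
split=> [[[|mu0 mus] [//= [sm] <- ek h]]|[mu1 st [mus [sm e0 ek h]]]].
  exists (nth (0, 0) mus 0); first exact: (h 0%N isT).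
  by exists mus; split=> // i ik; apply: (h i.+1 ik).
exists (mu :: mus); split=> //=; first by rewrite sm.
by case=> [_|i] /=; [rewrite e0 | apply: h].
Qed.

Definition edge (s : rat) (y x : 'rV[rat]_n) : Prop := exists b,
  [/\ apos b, 0 < B y b.1, step_len y b = 1, s * copair B y b.1 \is a Num.int &
      x = hrefl B b.1 y].

Lemma edge_qpath s y x : edge s y x -> qpath s 1 y x.
Proof.
by case=> b [ab hy D1 sy ->]; apply: qpath_cons ab hy D1 sy (qpath_nil _ _ _ _ _).
Qed.

(** Sigma-chains run against directed paths and are peeled at the front, so directed paths are
    peeled at their last edge. *)
Lemma qpathS s k y x : qpath s k.+1 y x <-> exists2 z, qpath s k y z & edge s z x.
Proof.
split=> [/qpath_rcons_inv[z [b [p ab hz D1 [sz e]]]]|[z p /edge_qpath e]].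
  by exists z => //; exists b.
by rewrite -(addn1 k); apply: qpath_cat p e.
Qed.

Lemma qpath0 s y x : qpath s 0 y x -> y = x.
Proof. by move=> p; inversion p. Qed.

Lemma qpath_vorb s k y x : vorb y -> qpath s k y x -> vorb x.
Proof.
move=> oy; elim: k x => [|k IH] x; first by move/qpath0 => <-.
case/qpathS => z /IH oz [b [ab _ _ _ ->]].
by apply: vorb_hrefl oz; apply: apos_root ab.
Qed.

Lemma sstep_edge s mu nu u v : 0 < s -> worb mu -> rep mu u -> rep nu v ->
  sstep s mu nu -> edge s v.1 u.1.
Proof.
move=> s0 o hu hv [_ ds [b [pb e [z [z0 ez]]]]]; have rb := pb.1.
have ab : apos (psi b) by apply/apos_psi.
have nb := apos_norm AS ab.
have ev : v = arefl (psi b) u by apply: rep_fun hv _; rewrite -e; apply: rep_rref.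
have lt : B u.1 (psi b).1 < 0.
  by rewrite -(wt_pair_lt0 hu rb) -(ltrz0 rat) -(pmulr_rlt0 _ s0) ez ltrz0.
have ve : B v.1 (psi b).1 = - B u.1 (psi b).1 by rewrite ev (ip_hrefl_self RB).
exists (psi b); split=> //.
- by rewrite ve oppr_gt0.
- rewrite ev; apply/(cover_step_len RB AS ab lt); rewrite -ev.
  exact/(dist1P o hu hv).
- by rewrite /copair ve mulrN mulNr mulrN rpredN -/(copair B u.1 (psi b).1)
    -(wt_pairE hu rb) ez intr_int.
by rewrite ev (hreflK RB).
Qed.

Lemma edge_sstep s nu v x : 0 < s -> worb nu -> rep nu v -> edge s v.1 x ->
  exists mu u, [/\ worb mu, rep mu u, u.1 = x, chain 1 u v & sstep s mu nu].
Proof.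
move=> s0 o hv [b [ab hy D1 sy ex]]; have nb := apos_norm AS ab.
have [b0 pb eb] := apos_psi_ex ab; have rb := pb.1; subst b.
set b := psi b0 in ab hy D1 sy ex nb.
have hu : rep (rref A b0 nu) (arefl b v) by apply: rep_rref.
have om : worb (rref A b0 nu) by apply: orbit_rref.
have lt : B (arefl b v).1 b.1 < 0 by rewrite (ip_hrefl_self RB) // oppr_lt0.
have cv : cover (arefl b v) v.
  have := (cover_step_len RB AS ab lt).2; rewrite (areflK RB) // => /(_ D1).
  by [].
have [c1 _] := cv.
exists (rref A b0 nu), (arefl b v); split=> //; split.
- split; first by exists 1%N; apply/(chain_lenP _ om hu hv).
  move=> e; move: c1; rewrite -(rep_fun hv (v := arefl b v)) //; last by rewrite -e.
  by move/(chain_acyclic AS).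
- exact/(dist1P om hu hv).
exists b0; split=> //.
  apply: rep_inj (_ : rep _ v) hv; have := rep_rref hu rb.
  by rewrite -/b (areflK RB).
have sz : s * copair B (arefl b v).1 b.1 \is a Num.int.
  by rewrite /copair (ip_hrefl_self RB) // mulrN mulNr mulrN rpredN.
have /intrP[z ez] := sz; exists z; split; last by rewrite (wt_pairE hu rb).
by rewrite -(ltrz0 rat) -ez pmulr_rlt0 // copair_lt0.
Qed.

Lemma schain_qpath s k mu nu u v : 0 < s -> worb mu -> rep mu u -> rep nu v ->
  schain_len s k mu nu -> qpath s k v.1 u.1.
Proof.
move=> s0; elim: k mu u => [|k IH] mu u o hu hv.
  by move/schain_len0 => e; rewrite (rep_fun hu (v := v)) ?e //; apply: qpath_nil.
case/schain_lenS => mu1 st c.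
have o1 : worb mu1 by case: st => _ [/chain_len_end].
have [u1 hu1] := rep_orbit o1.
by apply/qpathS; exists u1.1; [apply: IH c | apply: sstep_edge st].
Qed.

(** Any lift of the starting vector will do: an edge carries an affine root, and reflecting the lift
    in it gives the lift of the next vertex. *)
Lemma qpath_schain s k nu v x : 0 < s -> worb nu -> rep nu v -> qpath s k v.1 x ->
  exists mu u, [/\ worb mu, rep mu u, u.1 = x, chain k u v & schain_len s k mu nu].
Proof.
move=> s0 o hv; elim: k x => [|k IH] x.
  move/qpath0 <-; exists nu, v; split=> //; first exact: chain_nil.
  exact/schain_len0.
case/qpathS => z /IH[mu1 [u1 [o1 hu1 <- c1 sc]]] /(edge_sstep s0 o1 hu1).
case=> mu [u [om hu ux cu st]]; exists mu, u; split=> //.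
  exact: chain_cat cu c1.
by apply/schain_lenS; exists mu1.
Qed.

Lemma edgeP s y x : edge s y x <-> exists g,
  [/\ g \in Phi, 0 < B y g, qstep y g, s * copair B y g \is a Num.int &
      x = hrefl B g y].
Proof.
split=> [[[g k] [ab hy D1 sy ->]]|[g [gP hy st sy ->]]].
  exists g; split=> //; first exact: (apos_root ab).
  apply/(qstepP RB AS) => //; first exact: (apos_root ab).
  by exists k.
have [k [ab D1]] := (qstepP RB AS gP hy).1 st.
by exists (g, k).
Qed.

(** * Edges and paths of the parabolic quantum Bruhat graph *)

Lemma possum_vact w y : possum (vact w y) = vact w (possum y).
Proof.
elim: w => // j w IH; rewrite !vact_cons -IH; apply: (hrefl_possum RB AS).
exact: (al_root P_root).
Qed.

Lemma qedge_len w u b : minrep A J w -> minrep A J u -> is_real_root A b ->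
  vact u Lv = hrefl B (vact w (ratv b)) (vact w Lv) ->
  (wlen A u = (wlen A w).+1 \/
   (wlen A u)%:Z = (wlen A w)%:Z - two_rho_J A J b + 1) <->
  qstep (vact w Lv) (vact w (ratv b)).
Proof.
move=> mw mu rb e; have lenE x := minrep_ninv CF P_uniq P_root Lv_dom J_spec (x := x).
rewrite /qstep -e -(lenE w mw) -(lenE u mu) possum_vact (copair_vact CF).
rewrite -(two_rho_JE CF P_uniq P_root Lv_dom J_spec rb).
split=> -[h|h]; [left|right|left|right].
- by rewrite h -natr1.
- have /(congr1 (intmul (1 : rat))) := h.
  by rewrite rmorphD rmorphB.
- by apply/eqP; rewrite -(eqr_nat rat) h -natr1.
by apply/eqP; rewrite -(eqr_int rat) rmorphD rmorphB /=; apply/eqP.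
Qed.

Lemma qedge_edge s w u b : qedge A J w u b ->
  rat_is_int (s * (clpair (Lam A m) (coroot A b))%:~R) ->
  edge s (vact w Lv) (vact u Lv).
Proof.
case=> mw pb [mu [v [Jv ev]]] len [z ez].
have [rb Lb] := (posroot_notJP CF P_root Lv_dom J_spec b).1 pb.
have bP := mem_ratv P_root rb.
have [r er] := hrefl_word bP.
have uv : vact (u ++ v) =1 vact (w ++ r).
  apply/weqbP; first exact: CF; apply/forallP => i; apply/eqP/ratv_inj.
  by rewrite ev !(ratv_wact CF) vact_cat er (ratv_reflr CF).
have e : vact u Lv = hrefl B (vact w (ratv b)) (vact w Lv).
  rewrite (vact_hrefl CF) -er -vact_cat -uv vact_cat.
  by rewrite (Jword_fix J_spec Jv).
apply/edgeP; exists (vact w (ratv b)); split=> //.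
- exact: (vact_root CF P_root).
- by rewrite (rform_vact CF).
- exact: ((qedge_len mw mu rb e).1 len).
by rewrite (copair_vact CF) -clpairE // ez intr_int.
Qed.

Lemma edge_qedge s w u : minrep A J w -> minrep A J u ->
  edge s (vact w Lv) (vact u Lv) -> exists b, qedge A J w u b /\
    rat_is_int (s * (clpair (Lam A m) (coroot A b))%:~R).
Proof.
move=> mw mu /edgeP[g [gP hy st sy e]].
have [b rb eb] := root_vecP P_root _ (vact_root CF P_root (rev w) gP).
have eg : g = vact w (ratv b) by rewrite -eb (vact_rev CF).
rewrite eg (rform_vact CF) (copair_vact CF) in hy st sy e.
have bP := mem_ratv P_root rb.
have [r er] := hrefl_word bP.
exists b; split; last by rewrite clpairE //; apply/intrP.
split=> //.
- by apply/(posroot_notJP CF P_root Lv_dom J_spec).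
- split=> //.
  (* The element u^-1 w r_b fixes Lambda, hence lies in W_J; this is the coset condition on u. *)
  have [|v Jv ev] := stabilizer_word CF P_uniq P_root Lv_dom J_spec (w := rev u ++ w ++ r).
    by rewrite !vact_cat er -(vact_hrefl CF) -e (vact_revK CF).
  exists v; split=> // i; apply: ratv_inj.
  rewrite !(ratv_wact CF) vact_cat ev vact_cat (vact_rev CF) vact_cat er.
  by rewrite (ratv_reflr CF).
exact: ((qedge_len mw mu rb e).2 st).
Qed.

Definition dpath_len s k x y : Prop := exists ws bs,
  [/\ size bs = k, dpath A J x y ws bs & sigma_cond A (Lam A m) s bs].

Lemma dpath_len0 s x y : dpath_len s 0 x y <-> x = y.
Proof.
split=> [[ws [bs [/size0nil -> [_ <- <- _] _]]]//|->].
by exists [:: y], [::]; split.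
Qed.

Lemma dpath_lenS s k x y : dpath_len s k.+1 x y <-> exists z b,
  [/\ qedge A J z x b, rat_is_int (s * (clpair (Lam A m) (coroot A b))%:~R) &
      dpath_len s k z y].
Proof.
split=> [[[|x0 ws] [[|b bs] [//= [sb] [//= [sw] <- ey h] sc]]]|].
  exists (nth [::] ws 0), b; split; [exact: (h 0%N isT)|exact: (sc 0%N isT)|].
  exists ws, bs; split=> //; first by split=> // i ib; apply: (h i.+1 ib).
  by move=> i ib; apply: (sc i.+1 ib).
case=> z [b [q sb [ws [bs [sk [sw ez ey h] sc]]]]].
exists (x :: ws), (b :: bs); split=> /=; first by rewrite sk.
  by split=> //=; [rewrite sw | case=> [_|i] /=; [rewrite ez | apply: h]].
by case=> [_|i] //=; apply: sc.
Qed.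

Lemma dpath_qpath s k x y : dpath_len s k x y -> qpath s k (vact y Lv) (vact x Lv).
Proof.
elim: k x => [|k IH] x; first by move/dpath_len0 ->; apply: qpath_nil.
case/dpath_lenS => z [b [q sb /IH p]]; apply/qpathS; exists (vact z Lv) => //.
exact: qedge_edge sb.
Qed.

(** Vertices are words, so an empty path would require x and y to be the same word, whereas the
    vectors only determine their actions. A nonempty path can end in the prescribed words, with
    chosen minimal representatives in between. *)
Lemma qpath_dpath s k x y : minrep A J x -> minrep A J y ->
  qpath s k.+1 (vact y Lv) (vact x Lv) -> dpath_len s k.+1 x y.
Proof.
move=> mx my; elim: k x mx => [|k IH] x mx /qpathS[z p e]; apply/dpath_lenS.
  rewrite -(qpath0 p) in e; have [b [q sb]] := edge_qedge my mx e.
  by exists y, b; split=> //; apply/dpath_len0.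
have [|w ew] := qpath_vorb _ p; first by exists y.
have [w' mw' ew'] := minrep_ex J_spec w.
rewrite ew -ew' in p e.
have [b [q sb]] := edge_qedge mw' mx e.
by exists w', b; split=> //; apply: IH.
Qed.

Lemma spath_qpath s x y : spath A J (Lam A m) s x y ->
  exists k, qpath s k (vact y Lv) (vact x Lv).
Proof.
case=> ws [bs [p sc]]; exists (size bs); apply: dpath_qpath.
by exists ws, bs.
Qed.

Lemma spath_min_of_spath s x y : minrep A J x -> minrep A J y -> ~~ weqb A x y ->
  spath A J (Lam A m) s x y -> spath_min A J (Lam A m) s x y.
Proof.
move=> mx my ne sp; have [l pl] := spath_qpath sp.
have [ws [bs [p _]]] := sp.
pose Q k := `[< exists ws bs, dpath A J x y ws bs /\ size bs = k >].
have exQ : exists k, Q k by exists (size bs); apply/asboolP; exists ws, bs.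
case: (ex_minnP exQ) => k /asboolP[ws0 [bs0 [p0 s0]]] kmin.
(* The shortest length k is taken over all directed paths, hence the parameter 0. *)
have q0 : qpath 0 k (vact y Lv) (vact x Lv).
  apply: dpath_qpath; exists ws0, bs0; split=> // i ib.
  by rewrite mul0r; exists 0.
have closed j v : vorb v -> vorb (hrefl B (sr j).1 v).
  by apply: vorb_hrefl; apply: (sr_root AS).
have sgr_inj v1 v2 : vorb v1 -> vorb v2 ->
    (forall g, g \in Phi -> Num.sg (B v1 g) = Num.sg (B v2 g)) -> v1 = v2.
  move=> [w1 ->] [w2 ->].
  exact: (orbit_sgr_inj CF P_uniq P_root Lv_dom J_spec).
have oy : vorb (vact y Lv) by exists y.
have ox : vorb (vact x Lv) by exists x.
have [l' le q] := qpath_shorten RB AS closed sgr_inj oy ox q0 pl.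
case: l' le q => [_ /qpath0 e|l' le q].
  by case/negP: ne; apply/(weqbP CF)/(minrep_unique CF P_uniq P_root Lv_dom J_spec).
have [ws1 [bs1 [s1 p1 sc1]]] := qpath_dpath mx my q.
exists ws1, bs1; split=> // ws' bs' p'; rewrite s1; apply: leq_trans le _.
by apply: kmin; apply/asboolP; exists ws', bs'.
Qed.

Lemma QLS_tilde_hat (R : realType) : QLS_tilde A m R = QLS_hat A m R.
Proof.
apply/seteqP; split=> eta /= [xs [sg [s0 sgo mx link e]]]; exists xs, sg; split=> //.
  move=> k lk; have [ne sp] := link k lk; split=> //.
  by apply: spath_min_of_spath => //; apply: mx => //; apply: ltnW.
by move=> k /link[ne [ws [bs [p sc _]]]]; split=> //; exists ws, bs.
Qed.

(** * Lifting and projecting piecewise-linear paths *)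

Lemma chain_wgt q mu nu u v : worb mu -> rep mu u -> rep nu v -> chain q.+1 u v ->
  wgt A lam mu nu.
Proof.
move=> o hu hv c; split; first by exists q.+1; apply/(chain_lenP _ o hu hv).
move=> e; move: c; rewrite (rep_fun hu (v := v)) ?e //.
by move/(chain_acyclic AS).
Qed.

(** The lifts are built from the last direction backwards, since a directed path starts at the later
    direction and its lift determines the earlier one. The paths are nonempty, which gives the
    strict order. *)
Lemma lift_LS xs sg : (0 < size xs)%N ->
  (forall k, (k.+1 < size xs)%N -> 0 < nth 0 sg k.+1 /\ exists q,
    qpath (nth 0 sg k.+1) q.+1 (vact (nth [::] xs k.+1) Lv) (vact (nth [::] xs k) Lv)) ->
  exists nus, [/\ size nus = size xs,
    forall k, (k < size xs)%N -> worb (nth (0, 0) nus k) /\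
      exists2 u, rep (nth (0, 0) nus k) u & u.1 = vact (nth [::] xs k) Lv &
    forall k, (k.+1 < size xs)%N ->
      wgt A lam (nth (0, 0) nus k) (nth (0, 0) nus k.+1) /\
      schain A lam (nth 0 sg k.+1) (nth (0, 0) nus k) (nth (0, 0) nus k.+1)].
Proof.
elim: xs sg => // x [|y r] IH sg _ link.
  exists [:: wtact A (map (lift ord0) x) lam]; split=> //.
  case=> // _ /=; split; first by exists (map (lift ord0) x).
  by exists (vact x Lv, 0) => //; apply: rep_clact.
have [|nus' [sn onus lnus]] := IH (behead sg) isT.
  by move=> k lk; rewrite nth_behead; apply: (link k.+1).
case: nus' sn onus lnus => [//|nu nus] [sn] onus lnus.
have /= [o [v hv ev]] := onus 0%N isT.
have /= [s0 [q p]] := link 0%N isT; rewrite -ev in p.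
have [mu [u [om hu eu c sc]]] := qpath_schain s0 o hv p.
exists [:: mu, nu & nus]; split=> /=; first by rewrite sn.
  by case=> [_|k lk] /=; [split=> //; exists u | apply: onus].
case=> [_|k lk] /=; last by have := lnus k lk; rewrite nth_behead.
by split; [apply: chain_wgt c | exists q.+1].
Qed.

(** The tail is merged first and its head keeps the same vector, so the link from x still applies.
    Empty or closed links are allowed in the input; they occur when two directions have the same
    projection. *)
Lemma merge_links (R : realType) xs sg : (0 < size xs)%N ->
  size sg = (size xs).+1 -> sorted (fun a b => a < b) sg ->
  (forall k, (k < size xs)%N -> minrep A J (nth [::] xs k)) ->
  (forall k, (k.+1 < size xs)%N -> exists q,
    qpath (nth 0 sg k.+1) q (vact (nth [::] xs k.+1) Lv) (vact (nth [::] xs k) Lv)) ->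
  exists xs' sg',
  [/\ (0 < size xs')%N /\ vact (nth [::] xs' 0) Lv = vact (nth [::] xs 0) Lv,
      [/\ size sg' = (size xs').+1, nth 0 sg' 0 = nth 0 sg 0,
          nth 0 sg' (size xs') = nth 0 sg (size xs) &
          sorted (fun a b => a < b) sg'],
      forall k, (k < size xs')%N -> minrep A J (nth [::] xs' k),
      forall k, (k.+1 < size xs')%N ->
        ~~ weqb A (nth [::] xs' k) (nth [::] xs' k.+1) /\
        spath A J (Lam A m) (nth 0 sg' k.+1) (nth [::] xs' k) (nth [::] xs' k.+1) &
      @plmap R _ [seq clact A x (Lam A m) | x <- xs'] sg' =
      plmap [seq clact A x (Lam A m) | x <- xs] sg].
Proof.
elim: xs sg => // x [|y r] IH sg _ ss so mx link.
  by exists [:: x], sg; split.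
case: sg ss so link => [//|a [//|b sg]] [ss] /= /andP[ab so] link.
have [||||xs' [sg' [[s0 e0] [ss' ea el so'] mx' link' epl]]] := IH (b :: sg) isT.
- by rewrite /= ss.
- exact: so.
- by move=> k lk; apply: (mx k.+1).
- by move=> k lk; apply: (link k.+1).
case: xs' s0 e0 ss' el mx' link' epl => // x' r' _ /= e0 ss' el mx' link' epl.
case: sg' ea ss' el so' link' epl => [//|b' [//|c sg']] /= -> [ss'] el /andP[bc so'] link' epl.
have [qq p] := link 0%N isT; rewrite /= in p.
have mx0 : minrep A J x := mx 0%N isT.
have clE z w : vact z Lv = vact w Lv -> clact A z (Lam A m) = clact A w (Lam A m).
  by move=> e; rewrite !(clact_rep (rep_clact w)).
(* For equal vectors x and the breakpoint b are dropped: x' takes over the first interval, and its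
   link at c is unchanged. *)
have [exy|/eqP nxy] := eqVneq (vact x Lv) (vact x' Lv).
  exists (x' :: r'), [:: a, c & sg']; split=> //=.
  - split=> //; first by rewrite ss'.
    by rewrite (lt_trans ab bc) so'.
  apply/funext => t; apply/funext => k.
  rewrite [RHS]plmap_cons -epl (clE _ _ exy) -plmap_cons.
  by rewrite (plmap_merge _ _ _ _ (ltW ab) (ltW bc)).
exists [:: x, x' & r'], [:: a, b, c & sg']; split=> //=.
- split=> //; first by rewrite ss'.
  by rewrite ab bc so'.
- by case=> [_|k lk] //; apply: mx'.
- case=> [_|k lk] /=; last exact: link'.
  split; first by apply/negP => /(weqbP CF) e; apply: nxy; rewrite e.
  rewrite -e0 in p; case: qq p => [/qpath0 e|qq p]; first by case: nxy; rewrite e.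
  by have [ws [bs [_ dp sc]]] := qpath_dpath mx0 (mx' 0%N isT) p; exists ws, bs.
by apply/funext => t; apply/funext => k; rewrite [LHS]plmap_cons [RHS]plmap_cons epl.
Qed.

Lemma QLS_tilde_LS (R : realType) : QLS_tilde A m R = LS_cl A m R.
Proof.
apply/seteqP; split=> eta /=.
  move=> [xs [sg [s0 sgo mx link ->]]].
  have [|nus [sn onus lnus]] := lift_LS (sg := sg) s0.
    move=> k lk; split; first exact: sigma_gt0 sgo lk.
    have [ne /spath_qpath[q p]] := link k lk.
    case: q p => [/qpath0 e|q p]; last by exists q.
    case/negP: ne; apply/(weqbP CF)/(minrep_unique CF P_uniq P_root Lv_dom J_spec) => //.
      by apply: mx => //; apply: ltnW.
    exact: mx.
  exists nus, sg; split; rewrite ?sn //; first by move=> k /onus[].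
  congr plmap; apply: (@eq_from_nth _ 0); rewrite !size_map // => k lk.
  rewrite (nth_map [::]) // (nth_map (0, 0)) ?sn //.
  by have [_ [u hu eu]] := onus k lk; rewrite (clact_rep hu eu).
move=> [nus [sg [s0 sgo onus lnus ->]]].
(* Stated as an implication so that a word can be chosen for every weight, with an arbitrary value
   outside the orbit. *)
pose is_word mu x := worb mu -> minrep A J x /\
  exists2 u, rep mu u & u.1 = vact x Lv.
have repx mu : exists x, is_word mu x.
  have [o|no] := pselect (worb mu); last by exists [::].
  have [u hu] := rep_orbit o; have [w ew] := vorb_orbit o hu.
  have [x mx ex] := minrep_ex J_spec w.
  by exists x => _; split=> //; exists u => //; rewrite ew.
have /choice[wd wdP] := repx.
have [sz_sg sg0 sg1 sg_lt] := sgo.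
have mxs k : (k < size (map wd nus))%N -> minrep A J (nth [::] (map wd nus) k).
  by rewrite size_map => lk; rewrite (nth_map (0, 0)) //; have [] := wdP _ (onus k lk).
have links k : (k.+1 < size (map wd nus))%N -> exists q,
    qpath (nth 0 sg k.+1) q (vact (nth [::] (map wd nus) k.+1) Lv)
      (vact (nth [::] (map wd nus) k) Lv).
  rewrite size_map => lk; have lk' := ltnW lk; rewrite !(nth_map (0, 0)) //.
  have [_ [u hu <-]] := wdP _ (onus k lk'); have [_ [v hv <-]] := wdP _ (onus _ lk).
  have [_ [q sc]] := lnus k lk.
  exists q; apply: schain_qpath sc => //; [exact: sigma_gt0 sgo lk | exact: onus].
have := @merge_links R (map wd nus) sg; rewrite size_map in mxs links *.
case/(_ s0 sz_sg sg_lt mxs links) => xs [sg' [[s0' _] [ss' e0 e1 so'] mx link epl]].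
exists xs, sg'; split=> //.
  by split=> //; rewrite ?e0 ?e1.
rewrite epl -map_comp; congr plmap; apply: (@eq_from_nth _ 0); rewrite !size_map // => k lk.
rewrite !(nth_map (0, 0)) //=; have [_ [u hu eu]] := wdP _ (onus k lk).
by rewrite (clact_rep hu eu).
Qed.

End AffineWeights.

Theorem theorem4p1 (n : nat) (A : GCM n) (m : 'I_n -> nat) (R : realType) :
  (0 < n)%N -> finite_type A ->
  QLS_tilde A m R = QLS_hat A m R /\ QLS_hat A m R = LS_cl A m R.
Proof.
move=> n_gt0 [GCM_A indec [u [u_gt0 Au_gt0]]].
have [d [d_gt0 d_sym]] := symmetrizer_ex GCM_A u_gt0 Au_gt0.
have CF : cartan_form A d.
  split=> //; have [c [c0 lower]] := form_lower_bound GCM_A u_gt0 Au_gt0 d_gt0 d_sym.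
  by exists c; split=> // v; apply: lower.
have [P [P_uniq P_root]] := real_roots_finite CF.
have tilde_hat := QLS_tilde_hat CF P_uniq P_root indec n_gt0 m R.
by rewrite -tilde_hat (QLS_tilde_LS CF P_uniq P_root indec n_gt0).
Qed.
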